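(* Let $\gamma\in[3/4,1)$ and let $f:\mathbb{R}_+\to\mathbb{R}_+$ satisfy $f(1)=1$ and, for all real $a,n\ge 1$, $$a^{3/4}f(n)\le f(an)\le a^{\gamma}f(n).$$ Then there is a bounded sequence $m=(m_\ell)_{\ell\ge1}$ of integers $m_\ell\ge 2$ such that the switch-walk-switch random walk $X_n$ on the permutation wreath product $\mathbb{Z}\wr_S\mathcal{M}_m$ satisfies $\mathbf{E}|X_n|\asymp f(n)$ for integers $n\ge1$, with implied constants depending on $\gamma$ only; that is, there are constants $0<c\le C<\infty$ depending only on $\gamma$ with $c f(n)\le \mathbf{E}|X_n|\le C f(n)$ for all integers $n\ge 1$.
   Context: Tree and groups. For a bounded sequence $m=(m_i)_{i\ge1}$ of integers $m_i\ge2$, let $\mathbb{T}_m$ be the rooted tree whose vertices are the finite words $w_k\cdots w_1$ with $w_i\in\{0,\dots,m_i-1\}$ (root: empty word), with edges $\{w_k\cdots w_1,\,w_{k-1}\cdots w_1\}$. Let $\tau m=(m_2,m_3,\dots)$. A rooted automorphism $\gamma$ of $\mathbb{T}_m$ is written $\gamma=\langle\gamma_0,\dots,\gamma_{m_1-1}\rangle\sigma$ with $\sigma\in\mathrm{Sym}(m_1)$ (the permutations of $\{0,\dots,m_1-1\}$) and $\gamma_i\in\mathrm{Aut}(\mathbb{T}_{\tau m})$; it acts on the right on left-infinite words by $(\cdots w_3w_2w_1).\gamma=\big((\cdots w_3w_2).\gamma_{w_1}\big)\,(w_1.\sigma)$. A permutation $\sigma\in\mathrm{Sym}(m_1)$ is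 identified with the automorphism $\langle id,\dots,id\rangle\sigma$. Given $\sigma_\ell\in\mathrm{Sym}(m_\ell)$ for all $\ell$, define recursively $a_\ell=\langle a_{\ell+1},\sigma_{\ell+1},\dots,\sigma_{\ell+1}\rangle\,id\in \mathrm{Aut}(\mathbb{T}_{\tau^{\ell-1}m})$; the automorphism $a_1$ of $\mathbb{T}_m$ is called a propagating action. Explicitly, if $i$ is the least index with $w_i\ne0$, then $a_1$ changes only the letter $w_{i+1}$, to $w_{i+1}.\sigma_{i+1}$, and $a_1$ fixes $\cdots000$. Let $\mathcal{H}$ be the finite group of all propagating actions for which $\sigma_\ell$ depends only on the value $m_\ell$ (i.e. $\sigma_\ell=\sigma_{\ell'}$ whenever $m_\ell=m_{\ell'}$). The piecewise mother group $\mathcal{M}_m$ is the group of automorphisms of $\mathbb{T}_m$ generated by $\mathcal{H}$ and $\mathrm{Sym}(m_1)$. It acts on the right on the set $S$ of left-infinite words $\cdots w_3w_2w_1$ with $w_i\in\{0,\dots,m_i-1\}$ and all but finitely many $w_i$ equal to $0$, with root $o=\cdots000$. Permutation wreath product. For a group $\Lambda$ and a group $\Gamma$ acting on the right on a set $S$ with root $o$, $\Lambda\wr_S\Gamma$ is the semidirect product of $\Lambda^S$ with $\Gamma$, with multiplication $(\ell,g)(\ell',g')=(\ell\,\ell'^{g^{-1}},gg')$, where $\ell'^{g^{-1}}(s)=\ell'(s.g)$. For $L\in\Lambda$ let $\bar L$ denote the element $(\ell,id_\Gamma)$ with $\ell(o)=L$ and $\ell(s)=id_\Lambda$ for $s\ne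 o$. The switch-walk-switch random walk is $X_n=\prod_{i=1}^n\bar L_iG_i\bar L_i'$, where $G_i$ are i.i.d. from a fixed symmetric finitely supported measure on $\Gamma$ (regarded inside the wreath product), $L_i,L_i'$ are i.i.d. from a fixed symmetric finitely supported measure on $\Lambda$, and all are independent. Here $\Gamma=\mathcal{M}_m$, with $G_i$ distributed as the even mixture (weights $1/2,1/2$) of the uniform measures on $\mathrm{Sym}(m_1)$ and on $\mathcal{H}$; and $\Lambda=\mathbb{Z}$ with $L_i,L_i'$ uniform on $\{-1,+1\}$ (simple random walk). A symmetric finitely supported measure on a group defines a Cayley graph (generators: its support), and $|g|$ denotes the corresponding graph distance of $g$ from the identity; $|X_n|$ is taken with respect to the step distribution of $X_n$. *)

(* Defs.v *)
From HB Require Import structures.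
From mathcomp Require Import all_boot all_order all_algebra all_fingroup finmap.
From mathcomp Require Import all_classical all_reals all_analysis.

Set Implicit Arguments.
Unset Strict Implicit.
Unset Printing Implicit Defensive.

Import Order.TTheory GRing.Theory Num.Theory.
Local Open Scope classical_set_scope.
Local Open Scope nat_scope.

(* Sequences are indexed from 0: [m i] is the mathematical m_(i+1). *)
Record branching := Branching {
  degree :> nat -> nat;
  degree_ge2 : forall i, 2 <= degree i;
  degree_bounded : exists B, forall i, degree i <= B }.

Lemma degree_gt0 (m : branching) i : 0 < m i.
Proof. exact: leq_trans (degree_ge2 m i). Qed.

Fact shift_ge2 (m : branching) i : 2 <= m i.+1.
Proof. exact: degree_ge2. Qed.

Fact shift_bounded (m : branching) : exists B, forall i, m i.+1 <= B.
Proof. by have [B mB] := degree_bounded m; exists B. Qed.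

Definition shift (m : branching) : branching :=
  @Branching (fun i => m i.+1) (@shift_ge2 m) (shift_bounded m).

(* The word w_k ... w_1 is the list [:: w_1; ...; w_k], so that deleting the
   letter w_k, i.e. going to the parent, deletes the last item. *)
Fixpoint is_word (m : branching) (v : seq nat) : bool :=
  if v is x :: v' then (x < m 0) && is_word (shift m) v' else true.

Lemma is_wordP (m : branching) v :
  reflect (forall i, i < size v -> nth 0 v i < m i) (is_word m v).
Proof.
elim: v m => [|x v IH] m /=; first by constructor.
apply: (iffP andP) => [[xm /IH vm] [|i] //= iv|vm]; first exact: vm.
by split; [exact: (vm 0)|apply/IH => i iv; exact: (vm i.+1)].
Qed.

Lemma is_word_rcons (m : branching) v x : is_word m (rcons v x) -> is_word m v.
Proof.
move=> /is_wordP vm; apply/is_wordP => i iv.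
by have := vm i; rewrite size_rcons nth_rcons iv; apply; exact: ltnW.
Qed.

Definition vertex (m : branching) := {v : seq nat | is_word m v}.

Definition root_vertex (m : branching) : vertex m :=
  @exist _ (fun v => is_word m v) [::] isT.

Definition child_of (m : branching) (u v : vertex m) :=
  exists x, val v = rcons (val u) x.

Definition edge (m : branching) (u v : vertex m) := child_of u v \/ child_of v u.

Record aut (m : branching) := Aut {
  aut_fun :> vertex m -> vertex m;
  aut_inv : vertex m -> vertex m;
  aut_funK : cancel aut_fun aut_inv;
  aut_invK : cancel aut_inv aut_fun;
  aut_root : aut_fun (root_vertex m) = root_vertex m;
  aut_edge : forall u v, edge u v <-> edge (aut_fun u) (aut_fun v) }.

Lemma aut_child (m : branching) (g : aut m) (u v : vertex m) :
  child_of u v -> child_of (g u) (g v).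
Proof.
have [k] := ubnP (size (val u)); elim: k u v => // k IH u v ku uv.
have /(aut_edge g) [//|[b gu]] : edge u v by left.
have [x vE] := uv.
have [u0|/eqP u0] := eqVneq (val u) [::].
  have ? : u = root_vertex m by exact: val_inj.
  by subst u; move: gu; rewrite aut_root /=; case: (val (g v)).
have [u' [c uE]] : exists u' c, val u = rcons u' c.
  by case: (lastP (val u)) u0 => [|u' c] // _; exists u', c.
have u'P : is_word m u'.
  by apply: (@is_word_rcons m u' c); rewrite -uE; exact: valP u.
pose w : vertex m := exist _ u' u'P.
have wu : child_of w u by exists c.
have ltw : size (val w) < k.
  by move: ku; rewrite uE size_rcons.
have [d gud] := IH w u ltw wu.
have /rcons_inj[gvw _] : rcons (val (g v)) b = rcons (val (g w)) d.
  by rewrite -gu -gud.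
have vw : v = w by apply: (can_inj (aut_funK g)); exact: val_inj.
move/(congr1 size): vE; rewrite vw uE !size_rcons /= => /eqP.
by rewrite -[X in X == _]addn0 -addn2 eqn_add2l.
Qed.

Lemma aut_eqP (m : branching) (g h : aut m) : g =1 h -> g = h.
Proof.
case: g h => [g g' gK g'K g1 ge] [h h' hK h'K h1 he] /= /funext gh; subst h.
have E : g' = h' by apply/funext => v; rewrite -{1}(h'K v) gK.
by subst h'; congr Aut; exact: Prop_irrelevance.
Qed.

Section AutGroup.
Variable m : branching.
Implicit Types g h : aut m.

HB.instance Definition _ := gen_eqMixin (aut m).
HB.instance Definition _ := gen_choiceMixin (aut m).

Definition aut_one : aut m.
Proof. by apply: (@Aut m id id). Defined.

(* v.(gh) = (v.g).h *)
Definition aut_mul g h : aut m.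
Proof.
apply: (@Aut m (h \o g) (aut_inv g \o aut_inv h)).
- exact: can_comp (aut_funK h) (aut_funK g).
- exact: can_comp (aut_invK g) (aut_invK h).
- by rewrite /= !aut_root.
- by move=> u v; apply: iff_trans (aut_edge g u v) (aut_edge h _ _).
Defined.

Definition aut_opp g : aut m.
Proof.
apply: (@Aut m (aut_inv g) g (aut_invK g) (aut_funK g)).
- by rewrite -{1}(aut_root g) aut_funK.
- by move=> u v; apply: iff_sym; rewrite (aut_edge g) !aut_invK.
Defined.

Fact aut_mulA : associative aut_mul.
Proof. by move=> g h k; apply: aut_eqP. Qed.
Fact aut_mul1 : left_id aut_one aut_mul.
Proof. by move=> g; apply: aut_eqP. Qed.
Fact aut_mulr1 : right_id aut_one aut_mul.
Proof. by move=> g; apply: aut_eqP. Qed.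
Fact aut_mulV : left_inverse aut_one aut_opp aut_mul.
Proof. by move=> g; apply: aut_eqP => v /=; rewrite aut_invK. Qed.
Fact aut_mulrV : right_inverse aut_one aut_opp aut_mul.
Proof. by move=> g; apply: aut_eqP => v /=; rewrite aut_funK. Qed.

HB.instance Definition _ := isGroup.Build (aut m)
  aut_mulA aut_mul1 aut_mulr1 aut_mulV aut_mulrV.

End AutGroup.



Section RawAut.
Variables (m : branching) (f f' : seq nat -> seq nat).
Hypotheses (fW : forall v, is_word m v -> is_word m (f v))
  (f'W : forall v, is_word m v -> is_word m (f' v))
  (fK : forall v, is_word m v -> f' (f v) = v)
  (f'K : forall v, is_word m v -> f (f' v) = v)
  (f0 : f [::] = [::])
  (fS : forall v x, is_word m (rcons v x) -> exists y, f (rcons v x) = rcons (f v) y)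
  (f'S : forall v x, is_word m (rcons v x) -> exists y, f' (rcons v x) = rcons (f' v) y).

Let F (v : vertex m) : vertex m := exist _ (f (val v)) (fW (valP v)).
Let F' (v : vertex m) : vertex m := exist _ (f' (val v)) (f'W (valP v)).

Definition raw_aut : aut m.
Proof.
apply: (@Aut m F F').
- by move=> v; apply: val_inj; exact: fK (valP v).
- by move=> v; apply: val_inj; exact: f'K (valP v).
- exact: val_inj.
have FS u v : child_of u v -> child_of (F u) (F v).
  by case=> x vE; have := valP v; rewrite /child_of /= vE => /fS.
have F'S u v : child_of u v -> child_of (F' u) (F' v).
  by case=> x vE; have := valP v; rewrite /child_of /= vE => /f'S.
have FK v : F' (F v) = v by apply: val_inj; exact: fK (valP v).
move=> u v; split=> -[uv|uv]; [left|right|left|right]; try exact: FS.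
  by rewrite -(FK u) -(FK v); exact: F'S.
by rewrite -(FK u) -(FK v); exact: F'S.
Defined.

End RawAut.

(* meaningful for x < n *)
Definition letter_act n (s : 'S_n) (x : nat) : nat :=
  if insub x is Some i then val (s i) else x.

Definition word_act m (g : aut m) (v : seq nat) : seq nat :=
  if insub v is Some u then val (g u) else v.

Lemma letter_actE n (s : 'S_n) (i : 'I_n) : letter_act s i = s i.
Proof. by rewrite /letter_act valK. Qed.

Lemma word_actE m (g : aut m) (v : vertex m) : word_act g (val v) = val (g v).
Proof. by rewrite /word_act valK. Qed.

Lemma word_actP m (g : aut m) v : is_word m v -> is_word m (word_act g v).
Proof. by move=> vm; rewrite (word_actE g (Sub v vm)); exact: valP. Qed.

Lemma word_actS m (g : aut m) v x : is_word m (rcons v x) ->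
  exists y, word_act g (rcons v x) = rcons (word_act g v) y.
Proof.
move=> vxm; have vm := is_word_rcons vxm.
rewrite (word_actE g (Sub v vm)) (word_actE g (Sub (rcons v x) vxm)).
by apply: aut_child; exists x.
Qed.

Section Node.
Variable m : branching.

Definition node_raw (h : 'I_(m 0) -> aut (shift m)) (t : 'S_(m 0)) (v : seq nat) :=
  if v is x :: v' then
    if insub x is Some i then (t i : nat) :: word_act (h i) v' else v
  else [::].

Fact node_rawP h t v : is_word m v -> is_word m (node_raw h t v).
Proof.
case: v => [//|x v] /andP[xm vm]; rewrite /node_raw insubT /= ltn_ord.
exact: word_actP.
Qed.

Fact node_rawS h t v x : is_word m (rcons v x) ->
  exists y, node_raw h t (rcons v x) = rcons (node_raw h t v) y.
Proof.
case: v => [|y v] /=.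
  case: insubP => [i _ _|_] _; last by exists x.
  by exists (t i); rewrite (word_actE _ (root_vertex _)) aut_root.
move=> /andP[ym vm]; rewrite insubT.
by have [z ->] := word_actS (h (Sub y ym)) vm; exists z.
Qed.

Variables (g : 'I_(m 0) -> aut (shift m)) (s : 'S_(m 0)).

Let g' (i : 'I_(m 0)) : aut (shift m) := aut_opp (g ((s^-1)%g i)).

(* <g_0, ..., g_(m_1 - 1)> s: the letter w_1 becomes w_1.s, and the rest of the
   word is acted on by g_(w_1). *)
Definition node : aut m.
Proof.
apply: (@raw_aut m (node_raw g s) (node_raw g' (s^-1)%g)).
- exact: node_rawP.
- exact: node_rawP.
- case=> [//|x v] /= /andP[xm vm]; rewrite insubT /= valK permK; congr (_ :: _).
  rewrite (word_actE _ (Sub v vm)) /g' permK.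
  by rewrite (word_actE (aut_opp _)) /= aut_funK.
- case=> [//|x v] /= /andP[xm vm]; rewrite insubT /= valK permKV; congr (_ :: _).
  rewrite (word_actE _ (Sub v vm)) /g'.
  by rewrite (word_actE (g _)) /= aut_invK.
- by [].
- exact: node_rawS.
- exact: node_rawS.
Defined.

Lemma node_cons (i : 'I_(m 0)) (v : vertex (shift m)) (w : vertex m) :
  val w = (i : nat) :: val v -> val (node w) = (s i : nat) :: val (g i v).
Proof. by move=> /= ->; rewrite /= valK word_actE. Qed.

End Node.

(* s seen as <id, ..., id> s *)
Definition rooted (m : branching) (s : 'S_(m 0)) : aut m := node (fun=> 1%g) s.

Definition perms (m : branching) := forall i, 'S_(m i).

Definition shift_perms (m : branching) (s : perms m) : perms (shift m) :=
  fun i => s i.+1.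

(* The action of a_1 on words; sigma_1 is not used. The defining recursion is
   [propagating_rec] below. *)
Fixpoint propagating_raw (m : branching) (s : perms m) (v : seq nat) : seq nat :=
  if v is x :: v' then
    x :: (if x == 0 then propagating_raw (shift_perms s) v'
          else if v' is y :: v'' then letter_act (s 1) y :: v'' else [::])
  else [::].

Lemma letter_act_lt n (s : 'S_n) x : x < n -> letter_act s x < n.
Proof. by move=> xn; rewrite /letter_act insubT; exact: ltn_ord. Qed.

Lemma letter_actK n (s : 'S_n) : cancel (letter_act s) (letter_act (s^-1)%g).
Proof.
move=> x; have [xn|nx] := boolP (x < n).
  by rewrite -[x]/(val (Ordinal xn)) !letter_actE permK.
by rewrite {2}/letter_act insubN //= /letter_act insubN.
Qed.

Lemma letter_actKV n (s : 'S_n) : cancel (letter_act (s^-1)%g) (letter_act s).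
Proof. by move=> x; have := letter_actK s^-1%g x; rewrite invgK. Qed.

Definition perms_inv (m : branching) (s : perms m) : perms m := fun i => (s i)^-1%g.

Section Propagating.

Fact propagating_rawP m (s : perms m) v :
  is_word m v -> is_word m (propagating_raw s v).
Proof.
elim: v m s => [//|x v IH] m s /= /andP[-> vm] /=.
case: ifP => _; first exact: IH.
by case: v vm {IH} => [//|y v] /= /andP[ym ->]; rewrite letter_act_lt.
Qed.

Fact propagating_rawK m (s : perms m) :
  cancel (propagating_raw s) (propagating_raw (perms_inv s)).
Proof.
move=> v; elim: v m s => [//|x v IH] m s /=; congr (_ :: _).
case: (x == 0); first exact: (IH _ (shift_perms s)).
by case: v {IH} => [//|y v]; rewrite letter_actK.
Qed.

Fact propagating_rawKV m (s : perms m) :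
  cancel (propagating_raw (perms_inv s)) (propagating_raw s).
Proof.
move=> v; elim: v m s => [//|x v IH] m s /=; congr (_ :: _).
case: (x == 0); first exact: (IH _ (shift_perms s)).
by case: v {IH} => [//|y v]; rewrite letter_actKV.
Qed.

Fact propagating_rawS m (s : perms m) v x :
  exists y, propagating_raw s (rcons v x) = rcons (propagating_raw s v) y.
Proof.
elim: v m s => [|z v IH] m s /=; first by exists x; case: ifP.
case: ifP => _; first by have [y ->] := IH _ (shift_perms s); exists y.
by case: v {IH} => [|y v] /=; [exists (letter_act (s 1) x)|exists x].
Qed.

Definition propagating m (s : perms m) : aut m.
Proof.
apply: (@raw_aut m (propagating_raw s) (propagating_raw (perms_inv s))).
- exact: propagating_rawP.
- exact: propagating_rawP.
- by move=> v _; exact: propagating_rawK.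
- by move=> v _; exact: propagating_rawKV.
- by [].
- by move=> v x _; exact: propagating_rawS.
- by move=> v x _; exact: propagating_rawS.
Defined.

(* a_l = <a_(l+1), sigma_(l+1), ..., sigma_(l+1)> id *)
Lemma propagating_rec m (s : perms m) :
  propagating s =
  node (fun i => if i == 0 :> nat then propagating (shift_perms s)
                 else rooted (m := shift m) (s 1)) 1%g.
Proof.
apply: aut_eqP => -[[|x v] vm]; apply: val_inj => //=.
have [xm v'm] := andP vm.
rewrite insubT perm1 /=; congr (_ :: _).
case: ifP => _; first by rewrite (word_actE _ (Sub v v'm)).
rewrite (word_actE _ (Sub v v'm)) /=.
case: v {vm} v'm => [//|y v] /= /andP[ym vm].
rewrite /letter_act insubT /=; congr (_ :: _).
by rewrite (word_actE _ (Sub v vm)).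
Qed.

End Propagating.

Definition value_dependent (m : branching) (s : perms m) :=
  forall i j (e : m i = m j), cast_perm e (s i) = s j.

Definition propagating_group (m : branching) : set (aut m) :=
  [set propagating s | s in [set s | value_dependent s]].

Definition rooted_group (m : branching) : set (aut m) :=
  [set rooted s | s in [set: 'S_(m 0)]].

Arguments propagating_group : clear implicits.
Arguments rooted_group : clear implicits.

Lemma finite_propagating_group m : finite_set (propagating_group m).
Proof.
have [B mB] := degree_bounded m.
pose F := {dffun forall d : 'I_B.+1, 'S_d}.
pose d i : 'I_B.+1 := Ordinal (mB i : m i < B.+1).
pose phi (f : F) := propagating (fun i => f (d i) : 'S_(m i)).
apply: (@sub_finite_set _ _ [set phi f | f in [set: F]]); last first.
  by apply: finite_image; exact: finite_finset.
move=> _ [s sv <-] /=.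
pose t (c : 'I_B.+1) : 'S_c := if pselect (exists i, m i = c) is left ic
  then cast_perm (projT2 (cid ic)) (s (projT1 (cid ic))) else 1%g.
pose f : F := finfun t.
exists f => //; congr propagating; apply: functional_extensionality_dep => i.
rewrite ffunE /t; case: pselect => [ic|[]]; last by exists i.
by case: (cid ic) => j e /=; exact: sv.
Qed.

Lemma finite_rooted_group m : finite_set (rooted_group m).
Proof. by apply: finite_image; exact: finite_finset. Qed.

Definition generated (G : groupType) (A : set G) : set G :=
  smallest [set K : set G | group_closed (mem K)] A.

Lemma generated_closed (G : groupType) (A : set G) : group_closed (mem (generated A)).
Proof.
split; first by apply/mem_set => K /= [[/set_mem]].
move=> x y /set_mem xA /set_mem yA; apply/mem_set => K [[K1 KM] AK].
by apply/set_mem/KM; apply/mem_set; [apply: xA|apply: yA].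
Qed.

Definition mother_set (m : branching) : set (aut m) :=
  generated (propagating_group m `|` rooted_group m).

Arguments mother_set : clear implicits.

Definition mother (m : branching) := {g : aut m | g \in mother_set m}.

HB.instance Definition _ m := SubType.on (mother m).
HB.instance Definition _ m := Choice.on (mother m).
HB.instance Definition _ m := SubChoice_isSubGroup.Build (aut m)
  (fun g => g \in mother_set m) (mother m) (generated_closed _).


(* The left-infinite word ... w_3 w_2 w_1 is i |-> w_(i+1). *)
Definition ray (m : branching) := forall i, 'I_(m i).

Section RayAction.
Variable m : branching.
Implicit Types (g h : aut m) (w : ray m).

Definition zero_letter i : 'I_(m i) := Ordinal (degree_gt0 m i).

Fact prefix_word w k : is_word m (mkseq (fun i => w i : nat) k).
Proof.
by apply/is_wordP => i; rewrite size_mkseq => ik; rewrite nth_mkseq // ltn_ord.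
Qed.

Definition prefix w k : vertex m :=
  exist (fun v => is_word m v) _ (prefix_word w k).

Lemma size_aut g w k : size (val (g (prefix w k))) = k.
Proof.
elim: k => [|k IH].
  have -> : prefix w 0 = root_vertex m by exact: val_inj.
  by rewrite aut_root.
have [x ->] : child_of (g (prefix w k)) (g (prefix w k.+1)).
  by apply: aut_child; exists (w k : nat); rewrite /= mkseqS.
by rewrite size_rcons IH.
Qed.

Fact ray_act_lt g w i : nth 0 (val (g (prefix w i.+1))) i < m i.
Proof. by have /is_wordP := valP (g (prefix w i.+1)); apply; rewrite size_aut. Qed.

(* The letters of w.g are read off the images of the prefixes of w. *)
Definition ray_act w g : ray m := fun i => Ordinal (ray_act_lt g w i).

Lemma prefix_ray_act w g k : prefix (ray_act w g) k = g (prefix w k).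
Proof.
elim: k => [|k IH]; apply: val_inj.
  by apply/esym/size0nil; rewrite size_aut.
have [x gx] : child_of (g (prefix w k)) (g (prefix w k.+1)).
  by apply: aut_child; exists (w k : nat); rewrite /= mkseqS.
rewrite [LHS]mkseqS gx; have /= -> := congr1 val IH; congr rcons.
by rewrite /= gx nth_rcons size_aut ltnn eqxx.
Qed.

Lemma ray_act1 w : ray_act w 1%g = w.
Proof. by apply: functional_extensionality_dep => i; apply: val_inj; rewrite /= nth_mkseq. Qed.

Lemma ray_actM w g h : ray_act w (g * h)%g = ray_act (ray_act w g) h.
Proof.
apply: functional_extensionality_dep => i; apply: val_inj => /=.
by rewrite prefix_ray_act.
Qed.

Definition finitary w := exists k, forall i, k <= i -> w i = 0 :> nat.

(* Automorphisms changing only finitely many letters of each ray; these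
   preserve the finitary rays. *)
Definition tame : set (aut m) :=
  [set g | forall w, exists k, forall i, k <= i -> ray_act w g i = w i].

Lemma tame_closed : group_closed (mem tame).
Proof.
split; first by apply/mem_set => w; exists 0 => i _; rewrite ray_act1.
move=> g h /set_mem gT /set_mem hT; apply/mem_set => w.
have [k gk] := gT w; have [l hl] := hT (ray_act (ray_act w g) h^-1%g).
exists (maxn k l) => i; rewrite geq_max => /andP[ki li].
by rewrite ray_actM -(hl i li) -ray_actM mulVg ray_act1 gk.
Qed.

Lemma propagating_raw_nil m' (s : perms m') v :
  (forall i, nth 0 v i = 0) -> propagating_raw s v = v.
Proof.
elim: v m' s => [//|x v IH] m' s v0 /=.
have /= -> := v0 0; rewrite eqxx IH // => i; exact: (v0 i.+1).
Qed.

Lemma propagating_raw_nth m' (s : perms m') v j i :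
  nth 0 v j != 0 -> j.+1 < i -> nth 0 (propagating_raw s v) i = nth 0 v i.
Proof.
elim: v m' s j i => [//|x v IH] m' s j [//|i] /= vj ji.
case: (x =P 0) vj => [-> vj|x0 _].
  by case: j vj ji => [//|j] /= vj ji; exact: IH vj _.
by case: v {IH} => [//|y v]; case: i ji.
Qed.

Lemma propagating_tame (s : perms m) : tame (propagating s).
Proof.
move=> w; pose v i := mkseq (fun i => w i : nat) i.
have E i : ray_act w (propagating s) i = nth 0 (propagating_raw s (v i.+1)) i :> nat.
  by [].
have vE i j : j < i -> nth 0 (v i) j = w j by move=> ji; rewrite nth_mkseq.
have [[j wj]|w0] := pselect (exists j, w j != 0 :> nat).
  exists j.+2 => i ji; apply: ord_inj; rewrite E.
  have ji' : j < i.+1 by rewrite ltnW // ltnW.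
  by rewrite (@propagating_raw_nth _ _ _ j) ?(vE i.+1).
exists 0 => i _; apply: ord_inj; rewrite E propagating_raw_nil ?vE // => l.
have [li|il] := ltnP l i.+1; last by rewrite nth_default ?size_mkseq.
by rewrite vE //; apply/eqP/negPn/negP => wl; apply: w0; exists l.
Qed.

Lemma rooted_tame (s : 'S_(m 0)) : tame (rooted s).
Proof.
have E v i : nth 0 (node_raw (fun=> 1%g) s v) i.+1 = nth 0 v i.+1.
  case: v => [//|x v]; rewrite /node_raw; case: insubP => [u _ _|//] /=.
  by rewrite /word_act; case: insubP => [z _ <-|].
move=> w; exists 1 => -[//|i] _; apply: ord_inj.
rewrite -[LHS]/(nth 0 (node_raw (fun=> 1%g) s (mkseq (fun i => w i : nat) i.+2)) i.+1).
by rewrite E nth_mkseq.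
Qed.

Lemma mother_tame (g : mother m) : tame (val g).
Proof.
have /set_mem gM := valP g; apply: gM; split; first exact: tame_closed.
by move=> _ [[s _ <-]|[s _ <-]]; [exact: propagating_tame|exact: rooted_tame].
Qed.

Definition finitary_ray := {w : ray m | finitary w}.

Definition zero_ray : finitary_ray :=
  exist _ zero_letter (ex_intro _ 0 (fun i _ => erefl)).

Fact finitary_act (w : finitary_ray) (g : mother m) :
  finitary (ray_act (sval w) (val g)).
Proof.
case: w => w [k wk] /=; have [l gl] := mother_tame g w.
by exists (maxn k l) => i; rewrite geq_max => /andP[ki li]; rewrite gl ?wk.
Qed.

Definition mother_act (w : finitary_ray) (g : mother m) : finitary_ray :=
  exist _ _ (finitary_act w g).

End RayAction.

Record right_action (G : groupType) (S : Type) := RightAction {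
  ract :> S -> G -> S;
  ract1 : forall s, ract s 1%g = s;
  ractM : forall s g h, ract s (g * h)%g = ract (ract s g) h }.

Definition mother_action m : right_action (mother m) (finitary_ray m).
Proof.
apply: (@RightAction _ _ (@mother_act m)).
- by move=> [w wf]; apply: eq_exist; exact: ray_act1.
- by move=> [w wf] g h; apply: eq_exist; exact: ray_actM.
Defined.

Record config (L G : groupType) (S : Type) := Config { lamps : S -> L; cursor : G }.

(* L wr_S G, with all functions S -> L as lamp configurations; the group law
   depends on the action, so the action is a parameter of the type. *)
Definition wreath (L G : groupType) (S : Type) (a : right_action G S) : Type :=
  config L G S.

Section Wreath.
Variables (L G : groupType) (S : Type) (a : right_action G S).
Notation wr := (wreath L a).

HB.instance Definition _ := gen_eqMixin wr.
HB.instance Definition _ := gen_choiceMixin wr.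

Definition wreath_one : wr := Config (fun=> 1%g) 1%g.
Definition wreath_mul (x y : wr) : wr :=
  Config (fun s => lamps x s * lamps y (a s (cursor x)))%g (cursor x * cursor y)%g.
Definition wreath_inv (x : wr) : wr :=
  Config (fun s => (lamps x (a s (cursor x)^-1))^-1)%g (cursor x)^-1%g.

Lemma wreath_eqP (x y : wr) : lamps x =1 lamps y -> cursor x = cursor y -> x = y.
Proof. by case: x y => [l g] [l' g'] /= /funext -> ->. Qed.

Fact wreath_mulA : associative wreath_mul.
Proof.
by move=> x y z; apply: wreath_eqP => [s|]; rewrite /= ?ractM mulgA.
Qed.
Fact wreath_mul1 : left_id wreath_one wreath_mul.
Proof. by move=> x; apply: wreath_eqP => [s|]; rewrite /= ?ract1 mul1g. Qed.
Fact wreath_mulr1 : right_id wreath_one wreath_mul.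
Proof. by move=> x; apply: wreath_eqP => [s|]; rewrite /= mulg1. Qed.
Fact wreath_mulV : left_inverse wreath_one wreath_inv wreath_mul.
Proof. by move=> x; apply: wreath_eqP => [s|]; rewrite /= mulVg. Qed.
Fact wreath_mulrV : right_inverse wreath_one wreath_inv wreath_mul.
Proof.
by move=> x; apply: wreath_eqP => [s|]; rewrite /= -?ractM mulgV // ract1 mulgV.
Qed.

HB.instance Definition _ := isGroup.Build wr
  wreath_mulA wreath_mul1 wreath_mulr1 wreath_mulV wreath_mulrV.

Definition lamp_at (o : S) (l : L) : wr :=
  Config (fun s => if `[< s = o >] then l else 1%g) 1%g.

Definition move_by (g : G) : wr := Config (fun=> 1%g) g.

End Wreath.

Section Walk.
Variable R : realType.
Local Open Scope ring_scope.

(* Finitely supported measures are given by their mass functions; the sums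
   below range over the (finite) support of their summand. *)
Definition uniform (T : choiceType) (A : set T) (x : T) : R :=
  if x \in A then (#|` fset_set A|)%:R^-1 else 0.

Definition mixture (T : Type) (p q : T -> R) (x : T) : R := p x / 2 + q x / 2.

Definition support (T : Type) (p : T -> R) : set T := [set x | p x != 0].

Definition law (T U : choiceType) (p : T -> R) (X : T -> U) (y : U) : R :=
  \sum_(t \in X @^-1` [set y]) p t.

Definition expectation (T : choiceType) (p : T -> R) (X : T -> R) : R :=
  \sum_(t \in [set: T]) p t * X t.

Definition iid (T : Type) (p : T -> R) n (t : n.-tuple T) : R :=
  \prod_(x <- t) p x.

Definition cayley (G : groupType) (A : set G) : rel G :=
  fun x y => (x^-1 * y)%g \in A.

Definition walk_of_length (T : Type) (e : rel T) (x y : T) (n : nat) :=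
  exists p, [/\ path e x p, last x p = y & size p = n].

(* 0 if x and y are not connected; this does not occur for [walk_norm] on the
   values X_n of the walk, which are products of n generators. *)
Definition graph_dist (T : Type) (e : rel T) (x y : T) : nat :=
  if pselect (exists n, `[< walk_of_length e x y n >]) is left xy
  then ex_minn xy else 0%N.

Variables (L G : groupType) (S : Type) (a : right_action G S) (o : S).
Variables (pL : L -> R) (pG : G -> R).

(* A sample of the i-th step is the triple (L_i, G_i, L'_i). *)
Definition step_mass (t : L * G * L) : R := pL t.1.1 * pG t.1.2 * pL t.2.

Definition step (t : L * G * L) : wreath L a :=
  (lamp_at a o t.1.1 * move_by L a t.1.2 * lamp_at a o t.2)%g.

Definition step_law : wreath L a -> R := law step_mass step.

Definition walk_norm (x : wreath L a) : nat :=
  graph_dist (cayley (support step_law)) 1%g x.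

Definition expected_norm (n : nat) : R :=
  expectation (@iid _ step_mass n)
    (fun t => (walk_norm (\prod_(x <- t) step x)%g)%:R).

End Walk.

Section MotherWalk.
Variables (R : realType) (m : branching).

Definition mother_mass : mother m -> R :=
  mixture (uniform R [set g | rooted_group m (val g)])
          (uniform R [set g | propagating_group m (val g)]).

Definition sign_mass : int -> R := uniform R [set 1%R; (-1)%R].

Definition mother_expected_norm (n : nat) : R :=
  expected_norm (L := Algebra.to_multiplicative int) (mother_action m)
    (zero_ray m) sign_mass mother_mass n.

End MotherWalk.

(* Main.v *)
Require Import Defs.
From mathcomp Require Import all_boot all_order all_algebra all_fingroup finmap.
From mathcomp Require Import all_classical all_reals all_analysis.
From mathcomp Require Import zify ring lra.

Set Implicit Arguments.
Unset Strict Implicit.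
Unset Printing Implicit Defensive.

Import Order.TTheory GRing.Theory Num.Theory.
Local Open Scope ring_scope.

(** Write Y_t for the product of the first t factors G_i, and let the token of a
    site s sit at s.Y_t at time t. The lamp of s in X_n is the sum of the signs
    drawn when its token is at the origin o. Let G be the expected number of
    times t <= n with o.Y_t = o. Everything rests on two facts.

    First, E|X_n| is comparable with n / sqrt(G) ([expected_norm_bounds]).
    - Lower bound. A generator changes the sum of all |lamps| by at most 2, so
      |X_n| is at least half of this sum. The squares of the lamps add up to 2 n
      on average and their fourth powers to at most 24 n G, and
      |x| >= x^2 / a - x^4 / a^3 with a = 5 sqrt(G) gives n / (5 sqrt(G))
      ([lamp_mass_ge]).
    - Upper bound. By a renewal argument the expected number r of tokens that
      visit o is at most 4 n / G ([mean_range_green]). The sum of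
      all |lamps| is then at most n / sqrt(G) up to a constant ([lamp_mass_le]),
      and these lamps can be set while following any word which moves the sites
      as Y_n does and brings all visited tokens to o ([norm_cover_len]). So a
      word of length O(n / sqrt(G)) with these properties is needed. It is enough
      to light the visited lamps with independent uniform bits and to reach the
      lit ones, since two complementary colourings light them all
      ([cover_full_le]). The minimal length needed for that is a 1-Lipschitz
      function h of the state of a lamplighter walk with lamps in Z/2. Comparing
      the laws at times k and k + 1 in relative entropy gives
      E h <= c H_n + n / c + O(1) for every c > 0, with H_n the entropy of the
      state ([speed_le_entropy]). The state is coded by a tree whose inner nodes
      have at least two children below which there are visited sites, so that
      H_n = O(r) ([mval_code], [entropy_le_code]). The choice c = sqrt(G)
      concludes ([avg_cover_le]).

    Second, G is computed for all sequences m ([green_le], [green_ge]; leaving out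
    the time n changes it by a factor 2 at most). With V the product of the first k degrees and S that of m_i / (m_i - 1),
    1 / (1/S + 2 V / n) <= G <= 2 n / V + 32 S. This follows from the
    self-similarity of the Dirichlet form of the walk: one level multiplies
    volumes by m_i and resistances by m_i / (m_i - 1). At n = V S, this shows that
    G is comparable with S.

    It remains to have S comparable with N^2 / f(N)^2 along the scales N = V S
    ([scale_inv]). A degree 2 multiplies N by 4 and S by 2, while f(4N)^2 is at
    least 8 f(N)^2 = 4^(3/2) f(N)^2: this does not lower S f(N)^2 / N^2, and the exponent
    3/4 is the extreme case. A degree M multiplies N by about M and leaves S almost
    unchanged: this does not raise S f(N)^2 / N^2 as soon as M^(2 - 2 gamma) >= 2. Choosing
    at each scale the degree that corrects this ratio keeps it bounded. *)

(** * Uniform averages over words *)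

Section Average.
Variable R : realType.

Definition mean (T : finType) (F : T -> R) : R := (\sum_x F x) / #|T|%:R.

Fixpoint avg (T : finType) (n : nat) (F : seq T -> R) : R :=
  if n is n'.+1 then mean (fun x => avg n' (fun s => F (x :: s))) else F [::].

Section Mean.
Variable T : finType.
Implicit Types F G : T -> R.

Lemma eq_mean F G : F =1 G -> mean F = mean G.
Proof. by move=> FG; congr (_ / _); apply: eq_bigr. Qed.

Lemma meanD F G : mean (fun x => F x + G x) = mean F + mean G.
Proof. by rewrite /mean big_split mulrDl. Qed.

Lemma meanZ c F : mean (fun x => c * F x) = c * mean F.
Proof. by rewrite /mean -mulr_sumr mulrA. Qed.

Lemma le_mean F G : (forall x, F x <= G x) -> mean F <= mean G.
Proof. by move=> FG; rewrite ler_wpM2r ?invr_ge0 // ler_sum. Qed.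

Lemma mean_reindex (h : T -> T) F : injective h -> mean (F \o h) = mean F.
Proof. by move=> hI; congr (_ / _); rewrite [RHS](reindex_inj hI). Qed.

Lemma mean_sum (J : Type) (r : seq J) (F : J -> T -> R) :
  mean (fun x => \sum_(j <- r) F j x) = \sum_(j <- r) mean (F j).
Proof. by rewrite /mean exchange_big mulr_suml. Qed.

Hypothesis T_gt0 : (0 < #|T|)%N.

Lemma mean_cst c : mean (fun _ : T => c) = c.
Proof.
rewrite /mean sumr_const -[c *+ _]mulr_natr mulfK //.
by rewrite pnatr_eq0 -lt0n.
Qed.

Lemma le_mean_term F y : (forall x, 0 <= F x) -> F y <= #|T|%:R * mean F.
Proof.
move=> F0; rewrite /mean mulrCA mulfV ?mulr1 ?pnatr_eq0 -?lt0n //.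
by rewrite (bigD1 y) //= lerDl sumr_ge0.
Qed.

End Mean.

Lemma mean_pair (T U : finType) (F : T * U -> R) :
  mean F = mean (fun x => mean (fun y => F (x, y))).
Proof.
rewrite /mean -mulr_suml pair_bigA /= card_prod natrM invfM.
by rewrite [X in _ * X]mulrC mulrA; congr (_ / _ / _); apply: eq_bigr => -[].
Qed.

Lemma mean_exchange (T U : finType) (F : T -> U -> R) :
  mean (fun x => mean (F x)) = mean (fun y => mean (F^~ y)).
Proof.
rewrite /mean -!mulr_suml exchange_big /= -!mulrA; congr (_ * _).
exact: mulrC.
Qed.

Lemma mean_bool (F : bool -> R) : mean F = (F true + F false) / 2.
Proof. by rewrite /mean card_bool big_bool. Qed.

Section Avg.
Variable T : finType.
Implicit Types F G : seq T -> R.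

Lemma eq_avg n F G : (forall s, size s = n -> F s = G s) -> avg n F = avg n G.
Proof.
elim: n F G => [|n IH] F G FG /=; first exact: FG.
by apply: eq_mean => x; apply: IH => s sn; apply: FG; rewrite /= sn.
Qed.

Lemma avgD n F G : avg n (fun s => F s + G s) = avg n F + avg n G.
Proof.
elim: n F G => [//|n IH] F G /=.
by rewrite -meanD; apply: eq_mean => x; rewrite IH.
Qed.

Lemma avgZ n c F : avg n (fun s => c * F s) = c * avg n F.
Proof.
elim: n F => [//|n IH] F /=; rewrite -meanZ.
by apply: eq_mean => x; rewrite IH.
Qed.

Lemma avgZr n c F : avg n (fun s => F s * c) = avg n F * c.
Proof. by rewrite mulrC -avgZ; apply: eq_avg => s _; rewrite mulrC. Qed.

Lemma avgN n F : avg n (fun s => - F s) = - avg n F.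
Proof. by rewrite -mulN1r -avgZ; apply: eq_avg => s _; rewrite mulN1r. Qed.

Lemma avg_sub n F G : avg n (fun s => F s - G s) = avg n F - avg n G.
Proof. by rewrite avgD avgN. Qed.

Lemma le_avg n F G :
  (forall s, size s = n -> F s <= G s) -> avg n F <= avg n G.
Proof.
elim: n F G => [|n IH] F G FG /=; first exact: FG.
by apply: le_mean => x; apply: IH => s sn; apply: FG; rewrite /= sn.
Qed.

Lemma avg_rcons n F :
  avg n.+1 F = avg n (fun s => mean (fun x => F (rcons s x))).
Proof.
elim: n F => [|n IH] F; first by [].
exact: (eq_mean (fun x => IH (fun s => F (x :: s)))).
Qed.

Lemma avg_mean (U : finType) n (F : seq T -> U -> R) :
  avg n (fun s => mean (F s)) = mean (fun u => avg n (F^~ u)).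
Proof.
elim: n F => [//|n IH] F /=; rewrite -[RHS]mean_exchange.
by apply: eq_mean => x; rewrite IH.
Qed.

Lemma avg_sum (J : Type) (r : seq J) n (F : J -> seq T -> R) :
  avg n (fun s => \sum_(j <- r) F j s) = \sum_(j <- r) avg n (F j).
Proof.
elim: n F => [//|n IH] F /=; rewrite -mean_sum.
by apply: eq_mean => x; rewrite IH.
Qed.

Lemma avg_tuple n F : avg n F = mean (fun t : n.-tuple T => F t).
Proof.
elim: n F => [|n IH] F /=.
  rewrite /mean card_tuple expn0 divr1 (big_pred1 [tuple]) // => t.
  by apply/esym/eqP; rewrite [t]tuple0.
rewrite /mean card_tuple expnS natrM invfM.
under eq_bigr do rewrite IH /mean card_tuple.
rewrite -mulr_suml -mulrA [X in _ * X]mulrC; congr (_ * _).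
rewrite pair_bigA /=.
rewrite (reindex (fun p : T * n.-tuple T => [tuple of p.1 :: p.2])) /=.
  by apply: eq_bigr => -[].
exists (fun t => (thead t, [tuple of behead t])) => [[x t] _|t _] /=.
  by rewrite theadE; congr pair; apply: val_inj.
by rewrite [RHS]tuple_eta.
Qed.

Hypothesis T_gt0 : (0 < #|T|)%N.

Lemma avg_cst n c : avg n (fun _ : seq T => c) = c.
Proof.
elim: n => [//|n IH] /=; rewrite -[RHS](mean_cst T_gt0).
by apply: eq_mean => x; rewrite IH.
Qed.

Lemma avg_ge0 n F : (forall s, size s = n -> 0 <= F s) -> 0 <= avg n F.
Proof. by move=> F0; rewrite -(avg_cst n 0); apply: le_avg. Qed.

Lemma avg_take n k F : avg (n + k) (F \o take n) = avg n F.
Proof.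
elim: n F => [|n IH] F.
  by rewrite -[RHS](avg_cst k); apply: eq_avg => s _; rewrite /= take0.
by rewrite addSn /=; apply: eq_mean => x; rewrite -IH.
Qed.

(** The beginning and the end of a uniform word are independent. *)
Lemma avg_cat n k F G :
  avg (n + k) (fun s => F (take n s) * G (drop n s)) = avg n F * avg k G.
Proof.
elim: n F => [|n IH] F.
  by rewrite -[RHS]avgZ; apply: eq_avg => s _; rewrite take0 drop0.
rewrite addSn /= mulrC -meanZ; apply: eq_mean => x.
by rewrite [RHS]mulrC -IH.
Qed.

Lemma avg_cons_drop n F : avg n.+1 (F \o behead) = avg n F.
Proof. by rewrite /= mean_cst. Qed.

End Avg.

Lemma avg_zip (T U : finType) n (F : seq (T * U) -> R) :
  avg n F = avg n (fun s => avg n (fun t => F (zip s t))).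
Proof.
elim: n F => [//|n IH] F /=; rewrite mean_pair; apply: eq_mean => x.
by rewrite avg_mean; apply: eq_mean => y; rewrite IH.
Qed.

End Average.

(** * Speed and entropy *)

Section EntropySpeed.
Variables (R : realType) (I : finType) (X : eqType).
Variables (act : X -> I -> X) (inv : I -> I) (x0 : X).
Hypotheses (I_gt0 : (0 < #|I|)%N) (invK : involutive inv).
Hypothesis actK : forall x i, act (act x i) (inv i) = x.

Let run := foldl act x0.

Let run_rcons s i : run (rcons s i) = act (run s) i.
Proof. exact: foldl_rcons. Qed.

Let actKV x i : act (act x (inv i)) i = x.
Proof. by rewrite -{2}(invK i) actK. Qed.

Definition prob n x : R := avg n (fun s => (run s == x)%:R).

Definition entropy n : R := avg n (fun s => - ln (prob n (run s))).

Lemma probS n y : prob n.+1 y = mean (fun i => prob n (act y (inv i))).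
Proof.
rewrite /prob avg_rcons -avg_mean; apply: eq_avg => s _; apply: eq_mean => i.
rewrite /= run_rcons; congr (_%:R); congr nat_of_bool.
by apply/eqP/eqP => [<-|->]; rewrite (actK, actKV).
Qed.

Lemma prob_ge0 n y : 0 <= prob n y.
Proof. by apply: avg_ge0 => // s _; case: eqP. Qed.

Lemma prob_run_gt0 n s : size s = n -> 0 < prob n (run s).
Proof.
move=> sn; rewrite /prob avg_tuple.
have T_gt0 : (0 < #|{: n.-tuple I}|)%N by rewrite card_tuple expn_gt0 I_gt0.
rewrite -(@pmulr_rgt0 _ #|{: n.-tuple I}|%:R) ?ltr0n //.
apply: (lt_le_trans (@ltr01 R)).
have := @le_mean_term R _ T_gt0 (fun t : n.-tuple I => (run t == run s)%:R)
  (Tuple (introT eqP sn)).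
by rewrite /= eqxx; apply=> t; exact: ler0n.
Qed.

Lemma prob_act n y i : prob n (act y (inv i)) <= #|I|%:R * prob n.+1 y.
Proof.
rewrite probS; apply: (le_mean_term I_gt0) => // j; exact: prob_ge0.
Qed.

Definition states n : seq X := undup [seq run (val t) | t : n.-tuple I].

Lemma statesP n y : reflect (exists2 s, size s = n & y = run s) (y \in states n).
Proof.
rewrite mem_undup; apply: (iffP idP) => [/mapP[t _ ->]|[s sn ->]].
  by exists (val t); rewrite ?size_tuple.
by apply/mapP; exists (Tuple (introT eqP sn)); rewrite ?mem_enum.
Qed.

Lemma avg_act_run n i (F : X -> R) :
  avg n (fun s => F (act (run s) i)) =
  \sum_(y <- states n.+1) prob n (act y (inv i)) * F y.
Proof.
transitivity (avg n (fun s => \sum_(y <- states n.+1)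
    (run s == act y (inv i))%:R * F y)).
  apply: eq_avg => s sn.
  rewrite (bigD1_seq (act (run s) i)) ?undup_uniq //=; last first.
    by apply/statesP; exists (rcons s i); rewrite ?size_rcons ?sn // run_rcons.
  rewrite actK eqxx mul1r big1 ?addr0 // => y /eqP yi.
  by case: eqP => [E|]; rewrite ?mul0r //; case: yi; rewrite E actKV.
by rewrite avg_sum; apply: eq_bigr => y _; rewrite avgZr.
Qed.

Lemma avg_run n (F : X -> R) :
  avg n (F \o run) = \sum_(y <- states n) prob n y * F y.
Proof.
transitivity (avg n (fun s => \sum_(y <- states n) (run s == y)%:R * F y)).
  apply: eq_avg => s sn /=.
  rewrite (bigD1_seq (run s)) ?undup_uniq //=; last by apply/statesP; exists s.
  rewrite eqxx mul1r big1 ?addr0 // => y /eqP yi.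
  by case: eqP => [E|]; rewrite ?mul0r //; case: yi.
by rewrite avg_sum; apply: eq_bigr => y _; rewrite avgZr.
Qed.

(** The relative entropy dominates the squared Hellinger distance, and the
    latter controls differences of expectations of bounded functions. In the
    bracket, - p + q makes the bound pointwise and vanishes after summation. *)
Lemma relative_entropy_bound (c p q e : R) : 0 < c -> 0 <= p -> 0 <= q ->
  (0 < p -> 0 < q) -> `|e| <= 1 ->
  (p - q) * e <= c * (p * (ln p - ln q) - p + q) + (p + q) / (2 * c).
Proof.
move=> c0 p0 q0 pq e1.
pose a := Num.sqrt p; pose b := Num.sqrt q.
have a0 : 0 <= a by rewrite sqrtr_ge0.
have b0 : 0 <= b by rewrite sqrtr_ge0.
have pE : p = a ^+ 2 by rewrite sqr_sqrtr.
have qE : q = b ^+ 2 by rewrite sqr_sqrtr.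
have hellinger : (a - b) ^+ 2 <= p * (ln p - ln q) - p + q.
  have [p_gt0|] := ltP 0 p; last first.
    move=> p_le0; have -> : p = 0 by apply/eqP; rewrite eq_le p_le0.
    have -> : a = 0 by apply/eqP; rewrite sqrtr_eq0.
    by rewrite mul0r qE; lra.
  have a_gt0 : 0 < a by rewrite sqrtr_gt0.
  have b_gt0 : 0 < b by rewrite sqrtr_gt0 pq.
  have : ln (b / a) <= b / a - 1.
    have := @expR_ge1Dx R (ln (b / a)); rewrite lnK ?posrE ?divr_gt0 //; lra.
  rewrite ln_div ?posrE // => lnab.
  have H : a ^+ 2 * (ln b - ln a) <= a * b - a ^+ 2.
    have -> : a * b - a ^+ 2 = a ^+ 2 * (b / a - 1) by field; rewrite gt_eqF.
    by rewrite ler_pM2l ?exprn_gt0.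
  rewrite pE qE !lnXn //.
  have -> : a ^+ 2 * (ln a *+ 2 - ln b *+ 2) = - 2 * (a ^+ 2 * (ln b - ln a)) by ring.
  have -> : (a - b) ^+ 2 = a ^+ 2 - 2 * (a * b) + b ^+ 2 by ring.
  lra.
have dE : (p - q) * e <= `|a - b| * (a + b).
  have -> : (p - q) * e = (a - b) * (a + b) * e by rewrite pE qE; ring.
  rewrite (le_trans (ler_norm _)) // !normrM (ger0_norm (addr_ge0 a0 b0)).
  by rewrite ler_piMr // mulr_ge0 ?normr_ge0 // addr_ge0.
apply: (le_trans dE).
apply: (@le_trans _ _ (c * (a - b) ^+ 2 + (a + b) ^+ 2 / (4 * c))).
  rewrite -(@real_normK _ (a - b)) ?num_real //.
  set x := `|a - b|; set y := a + b.
  have -> : y ^+ 2 / (4 * c) = c * (y / (2 * c)) ^+ 2 by field; rewrite gt_eqF.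
  have {1}-> : y = 2 * c * (y / (2 * c)) by field; rewrite gt_eqF.
  by have := mulr_ge0 (ltW c0) (sqr_ge0 (x - y / (2 * c))); nra.
apply: lerD; first by rewrite ler_pM2l.
have -> : (p + q) / (2 * c) = (2 * (p + q)) / (4 * c) by field; rewrite gt_eqF.
rewrite ler_pM2r ?invr_gt0 ?mulr_gt0 // pE qE.
by have := sqr_ge0 (a - b); nra.
Qed.

Lemma sum_prob n : \sum_(y <- states n) prob n y = 1.
Proof.
have := avg_run n (fun=> 1); rewrite avg_cst // => E.
by rewrite [RHS]E; apply: eq_bigr => y _; rewrite mulr1.
Qed.

Lemma sum_prob_act n i : \sum_(y <- states n.+1) prob n (act y (inv i)) = 1.
Proof.
have := avg_act_run n i (fun=> 1); rewrite avg_cst // => E.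
by rewrite [RHS]E; apply: eq_bigr => y _; rewrite mulr1.
Qed.

Variable h : X -> R.
Hypothesis h_lip : forall s i, `|h (act (run s) i) - h (run s)| <= 1.

(** The expected increment of [h] at time n is an average of differences between
   the law of the walk at time n, translated, and the law at time n + 1; the
   symmetry of the step turns the increment at time n + 1 into the same kind of
   average with the opposite sign. *)
Lemma speed_le_entropy_step n c : 0 < c ->
  avg n.+2 (h \o run) - avg n (h \o run) <= c * (entropy n.+1 - entropy n) + c^-1.
Proof.
move=> c0.
pose P i y := prob n (act y (inv i)).
pose Q y := prob n.+1 y.
have E1 : avg n.+1 (h \o run) - avg n (h \o run) =
    mean (fun i => \sum_(y <- states n.+1) P i y * (h y - h (act y (inv i)))).
  rewrite avg_rcons -avg_sub.
  under [RHS]eq_mean => i do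
    rewrite -(avg_act_run n i (fun y => h y - h (act y (inv i)))).
  rewrite -avg_mean; apply: eq_avg => s _.
  rewrite -[X in _ - X](mean_cst I_gt0) -mulN1r -meanZ -meanD.
  by apply: eq_mean => i; rewrite /= run_rcons actK mulN1r.
have E2 : avg n.+2 (h \o run) - avg n.+1 (h \o run) =
    mean (fun i => \sum_(y <- states n.+1) Q y * (h (act y (inv i)) - h y)).
  rewrite avg_rcons -avg_sub.
  under [RHS]eq_mean => i do
    rewrite -(avg_run n.+1 (fun y => h (act y (inv i)) - h y)).
  rewrite -avg_mean; apply: eq_avg => s _ /=.
  rewrite -[X in _ - X](mean_cst I_gt0) -mulN1r -meanZ -meanD.
  rewrite -(mean_reindex _ (inv_inj invK)) /=.
  by apply: eq_mean => i; rewrite /= run_rcons mulN1r.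
have E3 : entropy n.+1 - entropy n = mean (fun i =>
    \sum_(y <- states n.+1) P i y * (ln (P i y) - ln (Q y))).
  rewrite /entropy avg_rcons -avg_sub.
  under [RHS]eq_mean => i do
    rewrite -(avg_act_run n i (fun y => ln (P i y) - ln (Q y))).
  rewrite -avg_mean; apply: eq_avg => s _ /=.
  rewrite -[X in _ - X](mean_cst I_gt0) -mulN1r -meanZ -meanD.
  apply: eq_mean => i; rewrite /= run_rcons /P actK; ring.
have -> : avg n.+2 (h \o run) - avg n (h \o run) =
    (avg n.+2 (h \o run) - avg n.+1 (h \o run)) +
    (avg n.+1 (h \o run) - avg n (h \o run)) by ring.
rewrite E1 E2 E3 -meanD -[c^-1](mean_cst I_gt0) -meanZ -meanD.
apply: le_mean => i; rewrite -big_split /=.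
have sumPQ : \sum_(y <- states n.+1) (P i y + Q y) = 2.
  by rewrite big_split /= sum_prob sum_prob_act; lra.
have sumPQ' : \sum_(y <- states n.+1) (Q y - P i y) = 0.
  by rewrite sumrB sum_prob sum_prob_act subrr.
have -> : c * (\sum_(y <- states n.+1) P i y * (ln (P i y) - ln (Q y))) + c^-1 =
    \sum_(y <- states n.+1)
      (c * (P i y * (ln (P i y) - ln (Q y)) - P i y + Q y)
       + (P i y + Q y) / (2 * c)).
  rewrite big_split /= -mulr_suml sumPQ -mulr_sumr.
  under [X in _ = c * X + _]eq_bigr => y do rewrite -addrA [- _ + _]addrC.
  rewrite big_split /= sumPQ' addr0; congr (_ + _); field.
  by rewrite gt_eqF.
rewrite big_seq [leRHS]big_seq; apply: ler_sum => y /statesP[s _ yE].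
apply: (@le_trans _ _ ((P i y - Q y) * (h y - h (act y (inv i))))).
  by rewrite le_eqVlt; apply/orP; left; apply/eqP; ring.
apply: relative_entropy_bound => //; [exact: prob_ge0|exact: prob_ge0| |].
  move=> P_gt0; have := lt_le_trans P_gt0 (prob_act n y i).
  by rewrite pmulr_rgt0 // ltr0n.
by rewrite -normrN opprB yE.
Qed.

Lemma speed_le_entropy n c : 0 < c ->
  2 * avg n (h \o run) <= 2 * h x0 + 2 + c * entropy n + n%:R / c.
Proof.
move=> c0.
have step k : `|avg k.+1 (h \o run) - avg k (h \o run)| <= 1.
  have incr : avg k.+1 (h \o run) - avg k (h \o run) =
      avg k (fun s => mean (fun i => h (act (run s) i) - h (run s))).
    rewrite avg_rcons -avg_sub; apply: eq_avg => s _ /=.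
    rewrite -[X in _ - X](mean_cst I_gt0) -mulN1r -meanZ -meanD.
    by apply: eq_mean => i; rewrite /= run_rcons mulN1r.
  rewrite ler_norml incr; apply/andP; split.
    rewrite -[leLHS](avg_cst I_gt0 k); apply: le_avg => s _.
    rewrite -[leLHS](mean_cst I_gt0); apply: le_mean => i.
    by have := h_lip s i; rewrite ler_norml => /andP[].
  rewrite -[leRHS](avg_cst I_gt0 k); apply: le_avg => s _.
  rewrite -[leRHS](mean_cst I_gt0); apply: le_mean => i.
  by have := h_lip s i; rewrite ler_norml => /andP[].
have : avg n.+1 (h \o run) + avg n (h \o run) <=
    avg 1 (h \o run) + avg 0 (h \o run) + c * entropy n + n%:R / c.
  elim: n => [|n IH].
    have -> : entropy 0 = 0 by rewrite /entropy /prob /= eqxx ln1 oppr0.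
    by rewrite mulr0 mul0r !addr0.
  by have := speed_le_entropy_step n c0; rewrite -(natr1 n) mulrDl mul1r; nra.
have := step n; have := step 0%N; rewrite !ler_norml /=; lra.
Qed.

End EntropySpeed.

Section Coding.
Variables (R : realType) (A : finType).
Hypothesis A_gt0 : (0 < #|A|)%N.

(** The words of length l have total weight 2^-l. *)
Definition code_weight (c : seq A) : R := ((2 * #|A|)%N%:R ^+ size c)^-1.

Lemma kraft (C : seq (seq A)) : uniq C -> \sum_(c <- C) code_weight c <= 2.
Proof.
move=> uC; pose N := (\max_(c <- C) size c).+1.
have ltN c : c \in C -> (size c < N)%N.
  by move=> cC; rewrite ltnS /N (big_rem c) //= leq_maxl.
have -> : \sum_(c <- C) code_weight c =
    \sum_(l < N) (count (fun c => size c == l) C)%:R * ((2 * #|A|)%N%:R ^+ l)^-1.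
  transitivity (\sum_(c <- C) \sum_(l < N) (size c == l)%:R * ((2 * #|A|)%N%:R ^+ l)^-1 : R).
    rewrite big_seq [RHS]big_seq; apply: eq_bigr => c cC.
    rewrite (bigD1 (Ordinal (ltN c cC))) //= eqxx mul1r big1 ?addr0 // => l.
    by case: (size c =P l) => [E /eqP[]|_]; rewrite ?mul0r //; apply: val_inj.
  rewrite exchange_big; apply: eq_bigr => l _; rewrite -mulr_suml; congr (_ * _).
  by rewrite -natr_sum -sum1_count [in RHS]big_mkcond /=; congr (_%:R); apply: eq_bigr => c _; case: eqP.
apply: (@le_trans _ _ (\sum_(l < N) 2^-1 ^+ l)).
  apply: ler_sum => l _; rewrite natrM exprMn invfM exprVn mulrCA.
  rewrite ler_piMr ?invr_ge0 ?exprn_ge0 // ler_pdivrMr ?exprn_gt0 ?ltr0n // mul1r.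
  rewrite -natrX ler_nat -card_tuple -size_filter cardE -(size_map val).
  apply: uniq_leq_size; first exact: filter_uniq.
  move=> c; rewrite mem_filter => /andP[cl _].
  by apply/mapP; exists (Tuple cl); rewrite ?mem_enum.
have -> : \sum_(l < N) 2^-1 ^+ l = 2 - 2 * 2^-1 ^+ N :> R.
  elim: N {ltN} => [|k IH]; first by rewrite big_ord0 expr0; lra.
  by rewrite big_ord_recr IH exprS /=; lra.
by rewrite gerBl mulr_ge0 ?exprn_ge0.
Qed.

End Coding.

Section EntropyCode.
Variables (R : realType) (I A : finType) (X : eqType).
Variables (act : X -> I -> X) (x0 : X) (dec : seq A -> X).
Hypotheses (I_gt0 : (0 < #|I|)%N) (A_gt0 : (0 < #|A|)%N).

(** Gibbs' inequality: the weights of the shortest descriptions of the states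
    add up to at most 2, so they can replace the law of the state in the
    logarithm. *)
Lemma entropy_le_code n (k : seq I -> R) :
  (forall s, size s = n ->
     exists2 c, dec c = foldl act x0 s & (size c)%:R <= k s) ->
  entropy R act x0 n <= 1 + ln (2 * #|A|)%N%:R * avg n k.
Proof.
move=> short.
pose p := prob R act x0 n; pose L := states act x0 n.
have minimal y : exists c, (y \in L ->
    dec c = y /\ forall c', dec c' = y -> (size c <= size c')%N).
  case: (boolP (y \in L)) => [/statesP[s sn yE]|]; last by exists [::].
  have ex : exists k, `[< exists2 c, dec c = y & size c = k >].
    by have [c cE _] := short s sn; exists (size c); apply/asboolP; exists c; rewrite ?yE.
  case: (ex_minnP ex) => k0 /asboolP[c cE <-] kmin; exists c => _; split=> // c' c'E.
  by apply: kmin; apply/asboolP; exists c'.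
have [code codeP] := choice minimal.
pose q y : R := code_weight R (code y).
have q_gt0 y : 0 < q y.
  by rewrite invr_gt0 exprn_gt0 // ltr0n muln_gt0.
have sum_q : \sum_(y <- L) q y <= 2.
  rewrite -(big_map code xpredT (fun c => code_weight R c)); apply: kraft => //.
  rewrite map_inj_in_uniq ?undup_uniq // => y z yL zL E.
  by have [<- _] := codeP y yL; have [<- _] := codeP z zL; rewrite E.
have p_gt0 s : size s = n -> 0 < p (foldl act x0 s) by exact: prob_run_gt0.
have gibbs : entropy R act x0 n <= avg n (fun s =>
    - ln (q (foldl act x0 s)) + (q (foldl act x0 s) / p (foldl act x0 s) - 1)).
  apply: le_avg => s /p_gt0; rewrite -/p; set x := foldl act x0 s => px.
  have := @expR_ge1Dx R (ln (q x / p x)).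
  rewrite lnK ?posrE ?divr_gt0 // ln_div ?posrE //; lra.
apply: (le_trans gibbs).
have -> : avg n (fun s =>
    - ln (q (foldl act x0 s)) + (q (foldl act x0 s) / p (foldl act x0 s) - 1)) =
    avg n (fun s => - ln (q (foldl act x0 s))) +
    (\sum_(y <- L) q y - 1).
  rewrite avgD avg_sub avg_cst //; congr (_ + (_ - _)).
  rewrite (avg_run (I := I) act x0 n (fun y => q y / p y)).
  rewrite big_seq [RHS]big_seq; apply: eq_bigr => y /statesP[s sn ->].
  by rewrite mulrCA divff ?mulr1 // gt_eqF // p_gt0.
rewrite addrC; apply: lerD; first by lra.
rewrite -avgZ; apply: le_avg => s sn.
have [c cE cs] := short s sn.
have yL : foldl act x0 s \in L by apply/statesP; exists s.
have [_ /(_ c cE) cmin] := codeP _ yL.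
have A1 : 1 <= (2 * #|A|)%N%:R :> R by rewrite ler1n muln_gt0.
rewrite /q /code_weight lnV ?posrE ?exprn_gt0 ?ltr0n ?muln_gt0 // opprK.
rewrite lnXn ?ltr0n ?muln_gt0 // -[ln _ *+ _]mulr_natr ler_wpM2l ?ln_ge0 //.
by apply: le_trans cs; rewrite ler_nat.
Qed.

End EntropyCode.

(** * Letters and their action on rays *)

Section Rules.
Variable B : nat.

(** A uniform rule yields a uniform permutation of {0, ..., c - 1} for each c at
    the same time; so, whatever the degrees bounded by B are, it yields uniform
    elements both of the group of rooted permutations and of the group of
    propagating actions. *)
Definition rules := {dffun forall c : 'I_B.+1, 'S_c}.

Definition rule_act (f : rules) (c y : nat) : nat :=
  if insub c is Some c' then letter_act (f c') y else y.

Definition rule1 : rules := [ffun c => 1%g].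
Definition ruleM (f g : rules) : rules := [ffun c => (f c * g c)%g].
Definition ruleV (f : rules) : rules := [ffun c => (f c)^-1%g].

Lemma letter_act_out n (s : 'S_n) x : (n <= x)%N -> letter_act s x = x.
Proof. by move=> nx; rewrite /letter_act insubN // -leqNgt. Qed.

Lemma rule_act_lt f c y : (y < c)%N -> (rule_act f c y < c)%N.
Proof.
rewrite /rule_act => yc; case: insubP => [c' _ c'E|//].
by move: yc; rewrite -c'E => yc; exact: letter_act_lt.
Qed.

Lemma rule_act_out f c y : (c <= y)%N -> rule_act f c y = y.
Proof.
rewrite /rule_act => cy; case: insubP => [c' _ c'E|//].
by rewrite letter_act_out // c'E.
Qed.

Lemma rule_act1 c y : rule_act rule1 c y = y.
Proof.
rewrite /rule_act; case: insubP => [c' _ _|//]; rewrite ffunE /letter_act.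
by case: insubP => // i _ <-; rewrite perm1.
Qed.

Lemma rule_actM f g c y : rule_act (ruleM f g) c y = rule_act g c (rule_act f c y).
Proof.
rewrite /rule_act; case: insubP => [c' _ _|//]; rewrite ffunE.
have [yc|cy] := ltnP y c'; last by rewrite !letter_act_out.
rewrite -[y]/(val (Ordinal yc)) !letter_actE.
by rewrite permM.
Qed.

Lemma rule_actK f c y : rule_act (ruleV f) c (rule_act f c y) = y.
Proof.
rewrite /rule_act; case: insubP => [c' _ _|//]; rewrite ffunE.
exact: letter_actK.
Qed.

Lemma ruleVK : involutive ruleV.
Proof. by move=> f; apply/ffunP => c; rewrite !ffunE invgK. Qed.

Lemma rule_actKV f c y : rule_act f c (rule_act (ruleV f) c y) = y.
Proof. by rewrite -{1}(ruleVK f) rule_actK. Qed.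

Lemma rule_act_inj f c : injective (rule_act f c).
Proof. exact: can_inj (rule_actK f c). Qed.

Lemma ruleM_injr g : injective (ruleM^~ g).
Proof.
move=> f f' /ffunP E; apply/ffunP => c.
by have := E c; rewrite !ffunE => /mulIg.
Qed.

Lemma card_rules_gt0 : (0 < #|{: rules}|)%N.
Proof. by apply/card_gt0P; exists rule1. Qed.

(** Composing with the transposition of z and z' exchanges the events that y goes
    to z and to z'. *)
Lemma mean_rule_act (R : realType) c (u : nat -> R) y : (c <= B)%N -> (y < c)%N ->
  mean (fun f : rules => u (rule_act f c y)) = (\sum_(z < c) u z) / c%:R.
Proof.
move=> cB yc; pose n (z : nat) := \sum_(f : rules) ((rule_act f c y == z)%:R : R).
have nE z z' : (z < c)%N -> (z' < c)%N -> n z = n z'.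
  move=> zc z'c; pose g : rules := finfun (fun k : 'I_B.+1 =>
    (if (insub z, insub z') is (Some i, Some j) then tperm i j else 1%g) : 'S_k).
  have gz : rule_act g c z = z'.
    rewrite /rule_act insubT //= ffunE /= !insubT /=.
    by rewrite (letter_actE _ (Sub z zc)) tpermL.
  rewrite /n [RHS](reindex_inj (@ruleM_injr g)); apply: eq_bigr => f _.
  by rewrite rule_actM -gz (inj_eq (@rule_act_inj g c)).
have c_gt0 : c%:R != 0 :> R by rewrite pnatr_eq0 -lt0n (leq_ltn_trans _ yc).
have nc : n y * c%:R = #|{: rules}|%:R.
  transitivity (\sum_(z < c) n z).
    rewrite -[in c%:R](card_ord c) mulr_natr -sumr_const; apply: eq_bigr => z _.
    by apply: nE; rewrite ?ltn_ord.
  rewrite /n exchange_big -sum1_card natr_sum; apply: eq_bigr => f _.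
  rewrite (bigD1 (Ordinal (rule_act_lt f yc))) //= eqxx big1 ?addr0 // => z /eqP zn.
  by case: eqP => // E; case: zn; apply: val_inj.
have f0 : #|{: rules}|%:R != 0 :> R by rewrite pnatr_eq0 -lt0n card_rules_gt0.
rewrite /mean -nc.
have n0 : n y != 0 by apply: contra_neq f0 => n0; rewrite -nc n0 mul0r.
have -> : \sum_f u (rule_act f c y) = n y * \sum_(z < c) u z.
  rewrite mulr_sumr; transitivity (\sum_(f : rules) \sum_(z < c) (rule_act f c y == z)%:R * u z).
    apply: eq_bigr => f _.
    rewrite (bigD1 (Ordinal (rule_act_lt f yc))) //= eqxx mul1r big1 ?addr0 // => z /eqP zn.
    by case: eqP => [E|]; rewrite ?mul0r //; case: zn; apply: val_inj.
  by rewrite exchange_big; apply: eq_bigr => z _; rewrite -mulr_suml (nE y z).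
by rewrite invfM mulrACA divff // mul1r.
Qed.

(** The left-infinite word ... w_3 w_2 w_1 is i |-> w_(i+1). *)
Definition site := nat -> nat.
Definition zero : site := fun=> 0%N.
Definition pcons x (r : site) : site := fun i => if i is j.+1 then r j else x.
Definition tail (r : site) : site := fun i => r i.+1.
Definition degrees := nat -> nat.
Definition sub_degrees (d : degrees) : degrees := fun i => d i.+1.

Lemma pconsE r : r = pcons (r 0%N) (tail r).
Proof. by apply/funext => -[]. Qed.

Lemma pcons_eq x r y s : (pcons x r == pcons y s) = (x == y) && (r == s).
Proof.
apply/eqP/andP => [E|[/eqP-> /eqP->]//]; split; apply/eqP.
  by have := congr1 (fun r => r 0%N) E.
exact: (congr1 tail E).
Qed.

Lemma zeroE : zero = pcons 0 zero.
Proof. by apply/funext => -[]. Qed.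

Lemma pcons_eq0 x r : (pcons x r == zero) = (x == 0)%N && (r == zero).
Proof. by rewrite zeroE pcons_eq -zeroE. Qed.

Definition act_root (d : degrees) (f : rules) (r : site) : site :=
  fun i => if i is j.+1 then r j.+1 else rule_act f (d 0%N) (r 0%N).

Definition leading (r : site) j := (r j != 0%N) && all (fun k => r k == 0%N) (iota 0 j).

Definition act_prop (d : degrees) (f : rules) (r : site) : site :=
  fun i => if i is j.+1 then
    if leading r j then rule_act f (d j.+1) (r j.+1) else r j.+1 else r 0%N.

(** The letter (true, f) stands for the rooted permutation given by f, and
    (false, f) for the propagating action given by f. *)
Definition letter := (bool * rules)%type.

Lemma card_letter_gt0 : (0 < #|{: letter}|)%N.
Proof. by rewrite card_prod card_bool muln_gt0 card_rules_gt0. Qed.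

Definition act d (l : letter) : site -> site :=
  if l.1 then act_root d l.2 else act_prop d l.2.

Definition actw d (t : seq letter) (r : site) : site :=
  foldl (fun r l => act d l r) r t.

Lemma act_root_pcons d f x r :
  act_root d f (pcons x r) = pcons (rule_act f (d 0%N) x) r.
Proof. by apply/funext => -[]. Qed.

(** Both kinds of letters act on the subtree of x through letters of the same
    two kinds: this self-similarity drives every induction below. *)
Lemma act_prop_pcons d f x r : act_prop d f (pcons x r) =
  pcons x ((if x == 0%N then act_prop else act_root) (sub_degrees d) f r).
Proof.
apply/funext => -[//|[|j]] /=; first by rewrite /leading /= andbT; case: eqP.
rewrite /leading /= -(addn0 1%N) iotaDl all_map /=.
by case: (x == 0%N); rewrite /= ?andbF.
Qed.

Lemma act_prop0 d f : act_prop d f zero = zero.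
Proof. by apply/funext => -[|i]. Qed.

Lemma act_rootM d f g r :
  act_root d g (act_root d f r) = act_root d (ruleM f g) r.
Proof. by apply/funext => -[|i] //=; rewrite rule_actM. Qed.

Lemma act_root1 d r : act_root d rule1 r = r.
Proof. by apply/funext => -[|i] //=; rewrite rule_act1. Qed.

Lemma act_propM d f g r :
  act_prop d g (act_prop d f r) = act_prop d (ruleM f g) r.
Proof.
apply/funext => i; elim: i d r => [//|i IH] d r.
rewrite (pconsE r) !act_prop_pcons; case: eqP => _ /=; last by rewrite act_rootM.
by rewrite -IH.
Qed.

Lemma act_prop1 d r : act_prop d rule1 r = r.
Proof. by apply/funext => -[|i] //=; rewrite rule_act1 if_same. Qed.

Lemma ruleVM f : ruleM f (ruleV f) = rule1.
Proof. by apply/ffunP => c; rewrite !ffunE mulgV. Qed.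

Definition letterV (l : letter) : letter := (l.1, ruleV l.2).

Lemma letterVK : involutive letterV.
Proof. by case=> b f; rewrite /letterV /= ruleVK. Qed.

Lemma actK d l r : act d (letterV l) (act d l r) = r.
Proof.
by case: l => -[] f; rewrite /act /= ?act_rootM ?act_propM ruleVM ?act_root1 ?act_prop1.
Qed.

Lemma actKV d l r : act d l (act d (letterV l) r) = r.
Proof. by rewrite -{1}(letterVK l) actK. Qed.

Lemma act_inj d l : injective (act d l).
Proof. exact: can_inj (actK d l). Qed.

Lemma actw_cat d t u r : actw d (t ++ u) r = actw d u (actw d t r).
Proof. exact: foldl_cat. Qed.

Lemma actw_rcons d t l r : actw d (rcons t l) r = act d l (actw d t r).
Proof. exact: foldl_rcons. Qed.

Definition wordV (t : seq letter) := rev (map letterV t).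

Lemma actwK d t r : actw d (wordV t) (actw d t r) = r.
Proof.
elim: t r => [//|l t IH] r.
by rewrite /wordV /= rev_cons actw_rcons IH actK.
Qed.

Lemma actw_inj d t : injective (actw d t).
Proof. exact: can_inj (actwK d t). Qed.

(** The only letter changed by a propagating action comes right after a nonzero
    one, so each step makes the support of a site longer by at most one. *)
Lemma act_finitary d l k r : (forall j, (k <= j)%N -> r j = 0%N) ->
  forall j, (k < j)%N -> act d l r j = 0%N.
Proof.
move=> r0 [//|j]; rewrite ltnS => kj; have kj1 := leqW kj.
by case: l => -[] f; rewrite /act /= ?r0 // /leading r0 // eqxx.
Qed.

End Rules.
Arguments zero : simpl never.

(** * Short descriptions of lamplighter states *)

Section Coding.
Variable B : nat.
Notation rules := (rules B).

(** [None] marks a rooted letter; [Some b] marks a propagating one, and b is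
    added to the lamp of the token at the origin, which this letter does not move.
    Unlike steps of the walk, marked words restrict to marked words on subtrees. *)
Definition mletter := (rules * option bool)%type.

Definition mact1 d (l : mletter) : site -> site :=
  if l.2 is Some _ then act_prop d l.1 else act_root d l.1.

Definition mact d (w : seq mletter) (r : site) : site :=
  foldl (fun r l => mact1 d l r) r w.

Fixpoint mlamp d (w : seq mletter) (r : site) : bool :=
  if w is l :: w' then
    (if l.2 is Some b then b && (r == zero) else false) (+) mlamp d w' (mact1 d l r)
  else false.

Fixpoint mvis d (w : seq mletter) (r : site) : bool :=
  if w is l :: w' then isSome l.2 && (r == zero) || mvis d w' (mact1 d l r)
  else false.

Definition mval d w : (site -> bool) * (site -> site) := (mlamp d w, mact d w).

Definition mact1V d (l : mletter) : site -> site := mact1 d (ruleV l.1, l.2).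

Lemma mact1K d l r : mact1V d l (mact1 d l r) = r.
Proof.
case: l => f [b|]; first exact: (@actK B d (false, f)).
exact: (@actK B d (true, f)).
Qed.

Lemma mact1KV d l r : mact1 d l (mact1V d l r) = r.
Proof.
case: l => f [b|]; first exact: (@actKV B d (false, f)).
exact: (@actKV B d (true, f)).
Qed.

Lemma mact1_inj d l : injective (mact1 d l).
Proof. exact: can_inj (mact1K d l). Qed.

Lemma mact_cat d w v r : mact d (w ++ v) r = mact d v (mact d w r).
Proof. exact: foldl_cat. Qed.

Lemma mlamp_cat d w v r :
  mlamp d (w ++ v) r = mlamp d w r (+) mlamp d v (mact d w r).
Proof. by elim: w r => [//|l w IH] r /=; rewrite IH addbA. Qed.

Lemma mval_cat d w w' v v' :
  mval d w = mval d w' -> mval d v = mval d v' -> mval d (w ++ v) = mval d (w' ++ v').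
Proof.
case=> E1 E2 [E3 E4]; congr pair; apply/funext => r.
  by rewrite !mlamp_cat E1 E2 E3.
by rewrite !mact_cat E2 E4.
Qed.

Fixpoint visited d (w : seq mletter) : seq site :=
  if w is l :: w' then
    if l.2 is Some _ then zero :: map (mact1V d l) (visited d w')
    else map (mact1V d l) (visited d w')
  else [::].

Lemma mem_visited d w r : (r \in visited d w) = mvis d w r.
Proof.
elim: w r => [//|l w IH] r /=.
have E : (r \in map (mact1V d l) (visited d w)) = mvis d w (mact1 d l r).
  rewrite -IH -{1}(mact1K d l r) mem_map //.
  by move=> x y E; rewrite -(mact1KV d l x) E mact1KV.
by case: l.2 => [b|] /=; rewrite ?inE E.
Qed.

Definition nvisited d w := size (undup (visited d w)).

Lemma leq_nvisited d w (L : seq site) : uniq L -> {in L, forall r, mvis d w r} ->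
  (size L <= nvisited d w)%N.
Proof.
move=> uL LP; apply: uniq_leq_size => // r rL.
by rewrite mem_undup mem_visited LP.
Qed.

Lemma nvisited_gt0 d w r : mvis d w r -> (0 < nvisited d w)%N.
Proof.
move=> wr; apply: (@leq_nvisited d w [:: r]) => // s.
by rewrite inE => /eqP->.
Qed.

(** The word read by the subtree of the first-level vertex x: propagating letters
    are seen as propagating when x has been carried to 0, and as rooted
    otherwise. *)
Fixpoint section d (x : nat) (w : seq mletter) : seq mletter :=
  if w is l :: w' then
    if l.2 is Some b then
      (l.1, if x == 0%N then Some b else None) :: section d x w'
    else section d (rule_act l.1 (d 0%N) x) w'
  else [::].

Fixpoint top (w : seq mletter) : rules :=
  if w is l :: w' then
    if l.2 is Some _ then top w' else ruleM l.1 (top w')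
  else rule1 B.

Lemma section_val d w x r :
  [/\ mact d w (pcons x r) =
        pcons (rule_act (top w) (d 0%N) x) (mact (sub_degrees d) (section d x w) r),
      mlamp d w (pcons x r) = mlamp (sub_degrees d) (section d x w) r &
      mvis d w (pcons x r) = mvis (sub_degrees d) (section d x w) r].
Proof.
elim: w x r => [|[f [b|]] w IH] x r /=; first by rewrite rule_act1.
  rewrite [mact1 d (f, Some b) _]act_prop_pcons pcons_eq0.
  have [E1 E2 E3] := IH x ((if x == 0%N then @act_prop B else @act_root B) (sub_degrees d) f r).
  rewrite E1 E2 E3; case: (x == 0%N) => //=.
  by rewrite andbF.
rewrite [mact1 d (f, None) _]act_root_pcons.
by have [-> -> ->] := IH (rule_act f (d 0%N) x) r; rewrite rule_actM.
Qed.

(** The letters that do not occur at the first level all have the same section,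
    so that finitely many sections describe the whole word. *)
Lemma section_out d w x : (0 < d 0%N)%N -> (d 0%N <= x)%N ->
  section d x w = section d (d 0%N) w.
Proof.
move=> d0 dx; elim: w => [//|[f [b|]] w IH] /=; last by rewrite !rule_act_out.
by rewrite IH !gtn_eqF // (leq_trans d0).
Qed.

Lemma mvis_lt d w r : (0 < d 0%N)%N -> mvis d w r -> (r 0%N < d 0%N)%N.
Proof.
move=> d0; elim: w r => [//|[f [b|]] w IH] r /= => [/orP[/eqP->//|/IH//]|].
move/IH => /= /(rule_act_lt (ruleV f)).
by rewrite rule_actK.
Qed.

Lemma sum_nvisited_section d w : (0 < d 0%N)%N ->
  (\sum_(x < (d 0%N).+1) nvisited (sub_degrees d) (section d x w) <= nvisited d w)%N.
Proof.
move=> d0; pose L x := map (pcons x) (undup (visited (sub_degrees d) (section d x w))).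
have -> : (\sum_(x < (d 0%N).+1) nvisited (sub_degrees d) (section d x w) =
    size (flatten [seq L (val x) | x : 'I_(d 0%N).+1]))%N.
  rewrite size_flatten /shape -map_comp sumnE big_map big_enum /=.
  by apply: eq_bigr => x _; rewrite /= size_map.
apply: leq_nvisited; last first.
  move=> _ /flatten_mapP[x _ /mapP[r rv ->]].
  have [_ _ ->] := section_val d w x r.
  by move: rv; rewrite mem_undup mem_visited.
have LI (y : 'I_(d 0%N).+1) r : r \in L y -> r 0%N = y by case/mapP => s _ ->.
rewrite /image_mem; elim: (enum _) (enum_uniq 'I_(d 0%N).+1) => [//|x s IH] /=.
case/andP=> xs us; rewrite cat_uniq IH // andbT map_inj_uniq ?undup_uniq //=; last first.
  by move=> r1 r2 /(congr1 tail).
apply/hasPn => r /flatten_mapP[y ys ry]; apply/negP => rx.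
have yx : y = x by apply: ord_inj; rewrite -(LI y r ry) (LI x r rx).
by move: xs; rewrite -yx ys.
Qed.

Lemma mval_none d w : (forall r, ~~ mvis d w r) ->
  exists h, mval d w = mval d [:: (h, None)].
Proof.
elim: w => [|[f [b|]] w IH] nv.
- exists (rule1 B); congr pair; apply/funext => r //=.
  by rewrite /mact1 /= act_root1.
- by have := nv zero; rewrite /= eqxx.
have [h E] : exists h, mval d w = mval d [:: (h, None)].
  apply: IH => r; apply/negP => wr; have /negP := nv (mact1V d (f, None) r).
  by rewrite /= mact1KV.
exists (ruleM f h); have := mval_cat (erefl (mval d [:: (f, None)])) E.
rewrite /= => ->; congr pair; apply/funext => r //=.
by rewrite /mact1 /= act_rootM.
Qed.

(** A rooted letter fixing 0 commutes with propagating letters; so if only one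
    token ever visits the origin, all propagating letters can be merged. *)
Lemma act_root_propC d (f g : rules) r : rule_act f (d 0%N) 0 = 0%N ->
  act_prop d g (act_root d f r) = act_root d f (act_prop d g r).
Proof.
move=> f0; rewrite (pconsE r) act_root_pcons !act_prop_pcons act_root_pcons.
have -> : (rule_act f (d 0%N) (r 0%N) == 0%N) = (r 0%N == 0%N).
  by rewrite -[X in _ == X]f0 (inj_eq (@rule_act_inj _ f _)).
by case: (_ == _).
Qed.

Lemma act_prop_eq0 d (g : rules) r : (act_prop d g r == zero :> site) = (r == zero).
Proof. by rewrite -[X in _ == X](act_prop0 d g) (inj_eq (@act_inj _ d (false, g))). Qed.

Lemma act_root_zero d (f : rules) :
  (act_root d f zero == zero) = (rule_act f (d 0%N) 0 == 0%N).
Proof. by rewrite [X in act_root d f X]zeroE act_root_pcons pcons_eq0 eqxx andbT. Qed.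

Definition leaf_word (c : rules * rules * bool * rules) : seq mletter :=
  let: (f, g, b, h) := c in [:: (f, None); (g, Some b); (h, None)].

Lemma mval_single d w : (forall r s, mvis d w r -> mvis d w s -> r = s) ->
  exists f g b h, mval d w = mval d (leaf_word (f, g, b, h)) /\
    forall r, mvis d w r -> act_root d f r = zero.
Proof.
have none v : (forall r, ~~ mvis d v r) -> exists f g b h,
    mval d v = mval d (leaf_word (f, g, b, h)) /\
    forall r, mvis d v r -> act_root d f r = zero.
  move=> nv; have [h E] := mval_none nv.
  exists (rule1 B), (rule1 B), false, h; split; last first.
    by move=> r vr; have := nv r; rewrite vr.
  rewrite E; congr pair; apply/funext => r //=.
  by rewrite /mact1 /= act_root1 act_prop1.
elim: w => [|[f0 [b0|]] w IH] uni; first exact: none.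
- have wzero r : mvis d w r -> r = zero.
    move=> wr; have : mact1V d (f0, Some b0) r = zero.
      by apply: uni; rewrite /= ?mact1KV ?wr ?orbT ?eqxx.
    move/(congr1 (mact1 d (f0, Some b0))); rewrite mact1KV => ->.
    exact: act_prop0.
  have wuni r s : mvis d w r -> mvis d w s -> r = s by move=> /wzero-> /wzero->.
  have [f [g [b [h [E fz]]]]] := IH wuni.
  have [nv|/existsNP[r /negP/negPn wr]] := pselect (forall r, ~~ mvis d w r).
    have [h' Eh] := mval_none nv.
    exists (rule1 B), f0, b0, h'; split=> [|r].
      have := mval_cat (erefl (mval d [:: (f0, Some b0)])) Eh.
      rewrite /= => ->; congr pair; apply/funext => r //=.
        by rewrite /mact1 /= act_root1.
      by rewrite /mact1 /= act_root1.
    rewrite /= (negPf (nv _)) orbF => /eqP->.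
    by rewrite act_root1.
  have f_zero : act_root d f zero = zero by rewrite -(wzero r wr) (fz r wr) (wzero r wr).
  have f0' : rule_act f (d 0%N) 0 = 0%N by apply/eqP; rewrite -act_root_zero f_zero.
  exists f, (ruleM f0 g), (b0 (+) b), h; split=> [|s].
    have := mval_cat (erefl (mval d [:: (f0, Some b0)])) E.
    rewrite /= => ->; congr pair; apply/funext => s /=; rewrite /mact1 /=; last first.
      by rewrite -act_propM -(act_root_propC _ _ f0').
    have fs : (act_root d f s == zero) = (s == zero).
      by rewrite -[X in _ == X]f_zero (inj_eq (@act_inj _ d (true, f))).
    rewrite -(act_root_propC _ _ f0') act_prop_eq0 fs.
    by case: (s == zero); case: (b0); case: (b).
  by case/orP => [/eqP->//|/wzero E']; rewrite -f_zero; congr act_root;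
     apply: (@mact1_inj d (f0, Some b0)); rewrite E' /mact1 /= act_prop0.
have wuni r s : mvis d w r -> mvis d w s -> r = s.
  move=> wr ws; rewrite -(mact1KV d (f0, None) r) -(mact1KV d (f0, None) s).
  by congr mact1; apply: uni; rewrite /= mact1KV.
have [f [g [b [h [E fz]]]]] := IH wuni.
exists (ruleM f0 f), g, b, h; split=> [|s /= /fz]; last first.
  by rewrite -act_rootM.
have := mval_cat (erefl (mval d [:: (f0, None)])) E.
rewrite /= => ->; congr pair; apply/funext => s /=.
  by rewrite /mact1 /= act_rootM.
by rewrite /mact1 /= act_rootM.
Qed.

(** Each propagating letter finds some token at the origin. If these tokens all
    lie below x, then x is carried to 0 at each of these times, so its subtree
    reads propagating letters only; and these fix the origin. *)
Lemma mvis_one_child d w x : (forall r, mvis d w r -> r 0%N = x) ->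
  forall r s, mvis d w r -> mvis d w s -> r = s.
Proof.
move=> wx.
have sx r : mvis (sub_degrees d) (section d x w) r -> r = zero.
  have allprop : all (fun l => isSome l.2) (section d x w).
    elim: w x wx => [//|[f [b|]] w IH] x wx /=.
      have x0 : x = 0%N by rewrite -(wx zero) //= eqxx.
      rewrite x0 eqxx /=; apply: IH => r' wr'.
      have := wx (mact1V d (f, Some b) r'); rewrite /= mact1KV wr' orbT x0.
      by apply.
    apply: IH => r' wr'; rewrite -(wx (mact1V d (f, None) r')) /= ?mact1KV //.
    by rewrite rule_actKV.
  elim: (section d x w) r allprop => [//|[f [b|//]] v IH] r /= allv.
  case/orP => [/eqP//|/(IH _ allv) /eqP].
  by rewrite /mact1 /= act_prop_eq0 => /eqP.
move=> r s wr ws; rewrite (pconsE r) (pconsE s) (wx r wr) (wx s ws); congr pcons.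
have [_ _ Er] := section_val d w x (tail r).
have [_ _ Es] := section_val d w x (tail s).
rewrite [LHS]sx -?Er -1?{1}(wx r wr) -?pconsE //.
by rewrite [RHS]sx -?Es -1?{1}(wx s ws) -?pconsE.
Qed.

Definition label := (rules + rules * rules * bool * rules)%type.

(** A tree describes a state: the leaves carry the states of subtrees with at
    most one visited token, and the inner nodes carry a permutation of the
    children (as the rank of a rule). Letters x >= d 0, which do not occur in
    sites of the tree, share the child number d 0. *)
Fixpoint decode (t : GenTree.tree label) (d : degrees) :
    (site -> bool) * (site -> site) :=
  match t with
  | GenTree.Leaf (inl h) => mval d [:: (h, None)]
  | GenTree.Leaf (inr c) => mval d (leaf_word c)
  | GenTree.Node n ts =>
      let vs := map (fun t' => decode t' (sub_degrees d)) ts in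
      let child x := nth (fun=> false, id) vs (minn x (d 0%N)) in
      (fun r => (child (r 0%N)).1 (tail r),
       fun r => pcons (rule_act (nth (rule1 B) (enum {: rules}) n) (d 0%N) (r 0%N))
                      ((child (r 0%N)).2 (tail r)))
  end.

Definition symbol_ok (l : nat + label) : bool :=
  if l is inl k then (k <= #|{: rules}|)%N else true.

(** Each inner node has at least two children with visited tokens, so the number
    of nodes is linear in the number of visited tokens. The term with (B + 2) on
    the left is the gain which makes the induction pass through inner nodes. *)
Lemma tree_code d w : (forall i, 1 < d i <= B)%N ->
  exists t, [/\ decode t d = mval d w, all symbol_ok (GenTree.encode t) &
    (size (GenTree.encode t) + (B + 2) * (0 < nvisited d w)
       <= (B + 2) * nvisited d w + 1)%N].
Proof.
have [N] := ubnP (nvisited d w); elim: N d w => // N IH d w.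
rewrite ltnS => wN dB; have d0 : (0 < d 0%N)%N by have /andP[/ltnW] := dB 0%N.
have [nv|/existsNP[r0 /negP/negPn wr0]] := pselect (forall r, ~~ mvis d w r).
  have [h E] := mval_none nv; exists (GenTree.Leaf (inl h)); split=> //=.
  have -> : nvisited d w = 0%N.
    rewrite /nvisited; case E' : (visited d w) => [//|r s].
    by have := nv r; rewrite -mem_visited E' inE eqxx.
  by rewrite !muln0.
have w_gt0 := nvisited_gt0 wr0.
have [uni|/existsNP[r wr]] := pselect (forall r, mvis d w r -> r 0%N = r0 0%N).
  have [f [g [b [h [E _]]]]] := mval_single (mvis_one_child uni).
  exists (GenTree.Leaf (inr (f, g, b, h))); split=> //=.
  by rewrite w_gt0 muln1 addnC leq_add2r leq_pmulr.
have {wr}[wr r_neq] : mvis d w r /\ r 0%N <> r0 0%N by apply/not_implyP.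
pose W x := section d x w; pose n x := nvisited (sub_degrees d) (W x).
have sum_n := sum_nvisited_section w d0.
pose o : 'I_(d 0%N).+1 := inord (r 0%N); pose o0 : 'I_(d 0%N).+1 := inord (r0 0%N).
have oE : o = r 0%N :> nat by rewrite inordK // ltnS ltnW // (mvis_lt d0 wr).
have o0E : o0 = r0 0%N :> nat by rewrite inordK // ltnS ltnW // (mvis_lt d0 wr0).
have n_gt0 s : mvis d w s -> (0 < n (s 0%N))%N.
  move=> ws; apply: (@nvisited_gt0 _ _ (tail s)).
  by have [_ _ <-] := section_val d w (s 0%N) (tail s); rewrite -pconsE.
have n_o : (0 < n o)%N by rewrite oE n_gt0.
have n_o0 : (0 < n o0)%N by rewrite o0E n_gt0.
have oo0 : o != o0 by apply/eqP => /(congr1 val) /=; rewrite oE o0E.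
have n_lt (x : 'I_(d 0%N).+1) : (n x < N)%N.
  apply: leq_trans wN; apply: leq_trans sum_n.
  have [y yx n_y] : exists2 y, y != x & (0 < n (val y))%N.
    by have [xo|xo] := eqVneq o x; [exists o0; rewrite // -xo eq_sym|exists o].
  rewrite (bigD1 x) //= (bigD1 y) //= -/(n x) -/(n y).
  by rewrite -addn1 leq_add2l (leq_trans n_y) // leq_addr.
have subB i : (1 < sub_degrees d i <= B)%N by exact: dB.
have [t tP] := choice (fun x : 'I_(d 0%N).+1 => IH _ (W x) (n_lt x) subB).
exists (GenTree.Node (enum_rank (top w)) [seq t x | x <- enum 'I_(d 0%N).+1]); split.
- rewrite /= -map_comp; congr pair; apply/funext => s; set x := s 0%N.
    have xd : (minn x (d 0%N) < (d 0%N).+1)%N by rewrite ltnS geq_minr.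
    rewrite (nth_map ord0) ?size_enum_ord //= (pconsE s).
    have [_ -> _] := section_val d w x (tail s).
    have [-> _ _] := tP (nth ord0 (enum 'I_(d 0%N).+1) (minn x (d 0%N))).
    rewrite /= /W nth_enum_ord //; congr (mlamp _ _ _).
    by have [xl|lx] := leqP x (d 0%N); rewrite // (section_out _ d0 (ltnW lx)).
  have xd : (minn x (d 0%N) < (d 0%N).+1)%N by rewrite ltnS geq_minr.
  rewrite (nth_map ord0) ?size_enum_ord //= [RHS](congr1 (mact d w) (pconsE s)).
  have [-> _ _] := section_val d w x (tail s).
  have [-> _ _] := tP (nth ord0 (enum 'I_(d 0%N).+1) (minn x (d 0%N))).
  rewrite nth_enum_rank /= /W nth_enum_ord //; congr (pcons _ (mact _ _ _)).
  by have [xl|lx] := leqP x (d 0%N); rewrite // (section_out _ d0 (ltnW lx)).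
- rewrite /= ltn_ord /= all_rcons /=.
  apply/allP => l /flattenP[_ /mapP[_ /mapP[x _ ->] ->]].
  by have [_ /allP tok _] := tP x; exact: tok.
rewrite /= size_rcons size_flatten /shape sumnE !big_map -enumT big_enum /=.
have : (\sum_x (size (GenTree.encode (t x)) + (B + 2) * (0 < n x)) <=
    \sum_(x < (d 0%N).+1) ((B + 2) * n x + 1))%N.
  by apply: leq_sum => x _; have [] := tP x.
rewrite !big_split /= -!big_distrr /= sum1_card card_ord.
have : (2 <= \sum_(x < (d 0%N).+1) (0 < n x))%N.
  by rewrite (bigD1 o) //= (bigD1 o0) 1?eq_sym //= n_o n_o0.
have /andP[_ dB0] := dB 0%N; rewrite w_gt0 muln1.
move: sum_n; rewrite -/n => sum_n two.
set S := (\sum_x size _)%N; set Q := (\sum_(x < _) (0 < _))%N in two *.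
have : ((B + 2) * 2 <= (B + 2) * Q)%N by rewrite leq_mul2l two orbT.
have : ((B + 2) * (\sum_(x < (d 0%N).+1) n x) <= (B + 2) * nvisited d w)%N.
  by rewrite leq_mul2l sum_n orbT.
set T := (\sum_(x < _) n x)%N; move: dB0; rewrite !mulnDl.
by clearbody S Q T; move: (nvisited d w) (d 0%N); clear => *; lia.
Qed.

Definition alphabet := ('I_(#|{: rules}|).+1 + label)%type.

Lemma mval_code d w : (forall i, 1 < d i <= B)%N ->
  exists2 c : seq alphabet,
    (if GenTree.decode (map (fun a => match a with inl k => inl (val k) | inr l => inr l end) c)
       is Some t then decode t d else (fun=> false, id)) = mval d w &
    (size c <= (B + 2) * nvisited d w + 1)%N.
Proof.
move=> dB; have [t [tE tok tsize]] := tree_code w dB.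
exists (map (fun a : nat + label => match a with inl k => inl (inord k) | inr l => inr l end)
  (GenTree.encode t)); last by rewrite size_map (leq_trans _ tsize) ?leq_addr.
rewrite -map_comp map_id_in ?GenTree.codeK // => -[k|l] //= kt.
by rewrite inordK //; have /allP/(_ _ kt) := tok.
Qed.

End Coding.

(** * Visited sites and returns to the origin *)

Section Visits.
Variables (B : nat) (d : degrees).
Notation letter := (letter B).

(** The token of r is moved by the letters of t; [vis] tells whether it is at the
    origin at some time, and [hits] counts these times. *)
Fixpoint vis (t : seq letter) (r : site) : bool :=
  (r == zero) || (if t is l :: t' then vis t' (act d l r) else false).

Fixpoint hits (t : seq letter) (r : site) : nat :=
  (r == zero) + (if t is l :: t' then hits t' (act d l r) else 0).

Definition escapes (t : seq letter) : bool :=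
  if t is l :: t' then ~~ vis t' (act d l zero) else true.

(** A visited token is counted at its last visit to the origin. *)
Fixpoint nvis (t : seq letter) : nat :=
  if t is l :: t' then escapes t + nvis t' else 1.

Lemma vis0 t : vis t zero. Proof. by case: t => [|l t] /=; rewrite eqxx. Qed.

Lemma vis_cat t u r : vis (t ++ u) r = vis t r || vis u (actw d t r).
Proof.
elim: t r => [|l t IH] r /=; last by rewrite IH orbA.
by case: u => [|l u] /=; case: (r == zero).
Qed.

(** If the token which starts at the origin does not escape, then all visited
    tokens are visited after the first step; otherwise it is the only one that
    may be lost. *)
Lemma size_vis_le_nvis t (L : seq site) : uniq L -> {in L, forall r, vis t r} ->
  (size L <= nvis t)%N.
Proof.
elim: t L => [|l t IH] L uL LP /=.
  by apply: (@uniq_leq_size _ _ [:: zero]) => // r /LP /=; rewrite inE orbF.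
have mapL (M : seq site) : uniq M -> {in M, forall r, vis t (act d l r)} ->
    (size M <= nvis t)%N.
  move=> uM MP; rewrite -(size_map (act d l)); apply: IH.
    by rewrite map_inj_uniq //; exact: act_inj.
  by move=> _ /mapP[r rM ->]; exact: MP.
have [v0|nv0] := boolP (vis t (act d l zero)).
  apply: mapL => // r /LP /=; case/orP => // /eqP->; exact: v0.
have zL : (size L <= 1 + size (rem zero L))%N.
  have [zL|zL] := boolP (zero \in L); last by rewrite rem_id.
  by rewrite size_rem // add1n prednK //; case: (L) zL.
apply: leq_trans zL _; rewrite leq_add2l; apply: mapL; first exact: rem_uniq.
move=> r; rewrite mem_rem_uniq // inE => /andP[/negPf r0 /LP] /=.
by rewrite r0.
Qed.

Fixpoint trace (t : seq letter) : seq site :=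
  zero :: (if t is l :: t' then map (act d (letterV l)) (trace t') else [::]).

Lemma mem_trace t r : (r \in trace t) = vis t r.
Proof.
elim: t r => [|l t IH] r /=; first by rewrite inE orbF.
rewrite inE; congr orb; rewrite -IH -[r in LHS](actK d l) mem_map //.
exact: act_inj.
Qed.

Lemma hitsE t r :
  hits t r = (\sum_(k < (size t).+1) (actw d (take k t) r == zero))%N.
Proof.
elim: t r => [|l t IH] r /=; first by rewrite big_ord1 addn0.
by rewrite big_ord_recl /= IH.
Qed.

(** Decomposition over the last visit to the origin. *)
Lemma last_visit t r :
  (\sum_(k < (size t).+1) (actw d (take k t) r == zero) * escapes (drop k t) = vis t r)%N.
Proof.
elim: t r => [|l t IH] r /=; first by rewrite big_ord1 /= muln1 orbF.
rewrite big_ord_recl /= IH; case: eqP => [->|_] /=; last by rewrite mul0n.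
by rewrite mul1n; case: (vis _ _).
Qed.

Variable R : realType.

Definition return_prob n : R := avg n (fun t : seq letter => (actw d t zero == zero)%:R).
Definition escape_prob n : R := avg n (fun t : seq letter => (escapes t)%:R).
Definition green n : R := \sum_(k < n) return_prob k.
Definition mean_range n : R := avg n (fun t : seq letter => (nvis t)%:R).

Let L_gt0 : (0 < #|{: letter}|)%N := card_letter_gt0 B.

Lemma return_prob_ge0 n : 0 <= return_prob n.
Proof. by apply: avg_ge0. Qed.

Lemma escape_prob_ge0 n : 0 <= escape_prob n.
Proof. by apply: avg_ge0. Qed.

Lemma avg_hits n : avg n (fun t => (hits t zero)%:R : R) = green n.+1.
Proof.
transitivity (avg n (fun t : seq letter =>
    \sum_(k < n.+1) ((actw d (take k t) zero == zero)%:R : R))).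
  by apply: eq_avg => t tn; rewrite hitsE natr_sum tn.
rewrite avg_sum; apply: eq_bigr => k _.
have kn : (k <= n)%N by rewrite -ltnS.
by rewrite -{1}(subnKC kn) (avg_take L_gt0 k (n - k)%N
  (fun t : seq letter => (actw d t zero == zero)%:R : R)).
Qed.

Lemma renewal n : \sum_(k < n.+1) return_prob k * escape_prob (n - k) = 1.
Proof.
transitivity (avg n (fun t : seq letter => \sum_(k < n.+1)
    ((actw d (take k t) zero == zero)%:R * (escapes (drop k t))%:R : R))).
  rewrite avg_sum; apply: eq_bigr => k _.
  have kn : (k <= n)%N by rewrite -ltnS.
  have := avg_cat k (n - k) (fun t => (actw d t zero == zero)%:R : R)
    (fun t => (escapes t)%:R).
  by rewrite subnKC // => ->.
rewrite -[RHS](avg_cst L_gt0 n); apply: eq_avg => t tn.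
under eq_bigr do rewrite -natrM.
by rewrite -natr_sum -tn last_visit vis0.
Qed.

Lemma mean_rangeE n : mean_range n = \sum_(k < n.+1) escape_prob k.
Proof.
elim: n => [|n IH]; first by rewrite big_ord1.
rewrite big_ord_recr /= -IH /mean_range -(avg_cons_drop L_gt0 n).
rewrite -avgD; apply: eq_avg => -[|l t] //= _.
by rewrite natrD addrC.
Qed.

(** Summing the renewal identity over the times i < 2 n + 2 covers all pairs
    (k, i - k) in the square of side n + 1. *)
Lemma mean_range_green n : mean_range n * green n.+1 <= 2 * n.+1%:R.
Proof.
rewrite mean_rangeE /green; set N := n.+1.
pose F k l : R := return_prob k * escape_prob l.
have F0 k l : 0 <= F k l by rewrite mulr_ge0 ?return_prob_ge0 ?escape_prob_ge0.
have -> : 2 * N%:R = \sum_(i < 2 * N) \sum_(k < i.+1) F k (i - k)%N.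
  under eq_bigr do rewrite renewal.
  by rewrite sumr_const card_ord natrM.
have -> : (\sum_(k < N) escape_prob k) * (\sum_(k < N) return_prob k) =
    \sum_(k < N) \sum_(l < N) \sum_(i < 2 * N) (i == k + l :> nat)%N%:R * F k l.
  rewrite mulrC mulr_suml; apply: eq_bigr => k _; rewrite mulr_sumr.
  apply: eq_bigr => l _.
  have kl : (k + l < 2 * N)%N by rewrite mul2n -addnn -addSn leq_add // ltnW.
  rewrite (bigD1 (Ordinal kl)) //= eqxx mul1r big1 ?addr0 // => i /eqP ikl.
  by case: (_ =P (_ + _)%N) => [E|_]; rewrite ?mul0r //; case: ikl; apply: val_inj.
under eq_bigr do rewrite exchange_big /=.
rewrite exchange_big /=; apply: ler_sum => i _.
apply: (@le_trans _ _ (\sum_(k < N) (k <= i)%N%:R * F k (i - k)%N)).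
  apply: ler_sum => k _; have [ki|ik] := leqP k i; last first.
    rewrite mul0r big1 // => l _; rewrite ltn_eqF ?mul0r //.
    by rewrite (leq_trans ik) ?leq_addr.
  rewrite mul1r; have [ikN|Nik] := ltnP (i - k) N; last first.
    rewrite big1 // => l _; case: eqP => [E|]; last by rewrite mul0r.
    by have := ltn_ord l; rewrite E addKn in Nik; rewrite ltnNge Nik.
  rewrite (bigD1 (Ordinal ikN)) //= subnKC // eqxx mul1r big1 ?addr0 // => l /eqP li.
  case: eqP => [E|]; rewrite ?mul0r //; case: li; apply: val_inj.
  by rewrite /= E addKn.
rewrite (big_ord_widen _ (fun k => (k <= i)%N%:R * F k (i - k)%N)
  (leq_addr i.+1 N)) [leRHS](big_ord_widen _ (fun k => F k (i - k)%N) (leq_addl N i.+1)).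
rewrite big_mkcond [leRHS]big_mkcond; apply: ler_sum => k _ /=.
by rewrite ltnS; case: ifP => _; case: ifP => _; rewrite ?mul0r ?mul1r ?F0.
Qed.

Lemma nvis_ge1 t : (1 <= nvis t)%N.
Proof. by elim: t => [//|l t IH] /=; rewrite (leq_trans IH) ?leq_addl. Qed.

Lemma green_homo n m : (n <= m)%N -> green n <= green m.
Proof.
move=> nm; rewrite /green (big_ord_widen _ return_prob nm) big_mkcond.
by apply: ler_sum => k _; case: ifP => // _; exact: return_prob_ge0.
Qed.

End Visits.

(** * Dirichlet forms on the levels of the tree *)

Section Levels.
Variable R : realType.
Implicit Types (d : degrees) (K : nat) (u v : seq nat -> R) (w : seq nat).

Fixpoint wsum d K u : R :=
  if K is K'.+1 then \sum_(x < d 0%N) wsum (sub_degrees d) K' (fun w => u (val x :: w))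
  else u [::].

Lemma eq_wsum d K u v : u =1 v -> wsum d K u = wsum d K v.
Proof.
elim: K d u v => [|K IH] d u v uv /=; first exact: uv.
by apply: eq_bigr => x _; apply: IH => w.
Qed.

Lemma wsumD d K u v : wsum d K (fun w => u w + v w) = wsum d K u + wsum d K v.
Proof.
elim: K d u v => [//|K IH] d u v /=; rewrite -big_split /=.
by apply: eq_bigr => x _; rewrite IH.
Qed.

Lemma wsumZ d K c u : wsum d K (fun w => c * u w) = c * wsum d K u.
Proof.
elim: K d u => [//|K IH] d u /=; rewrite mulr_sumr.
by apply: eq_bigr => x _; rewrite IH.
Qed.

Lemma wsum_sum d K (J : finType) (P : pred J) (F : J -> seq nat -> R) :
  wsum d K (fun w => \sum_(j | P j) F j w) = \sum_(j | P j) wsum d K (F j).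
Proof.
elim: K d F => [//|K IH] d F /=; rewrite exchange_big /=.
by apply: eq_bigr => x _; rewrite IH.
Qed.

Lemma le_wsum d K u v : (forall w, u w <= v w) -> wsum d K u <= wsum d K v.
Proof.
elim: K d u v => [|K IH] d u v uv /=; first exact: uv.
by apply: ler_sum => x _; apply: IH => w.
Qed.

Lemma wsum_ge0 d K u : (forall w, 0 <= u w) -> 0 <= wsum d K u.
Proof.
elim: K d u => [|K IH] d u u0 /=; first exact: u0.
by apply: sumr_ge0 => x _; apply: IH => w.
Qed.

Definition ip d K u v : R := wsum d K (fun w => u w * v w).

Lemma ipC d K u v : ip d K u v = ip d K v u.
Proof. by apply: eq_wsum => w; rewrite mulrC. Qed.

Lemma ip_lin d K c u v z :
  ip d K (fun w => c * u w + v w) z = c * ip d K u z + ip d K v z.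
Proof. by rewrite -wsumZ -wsumD; apply: eq_wsum => w; rewrite mulrDl mulrA. Qed.

Lemma ip_ge0 d K u : 0 <= ip d K u u.
Proof. by apply: wsum_ge0 => w; rewrite -expr2 sqr_ge0. Qed.

Lemma eq_ip d K u u' v v' : u =1 u' -> v =1 v' -> ip d K u v = ip d K u' v'.
Proof. by move=> uE vE; apply: eq_wsum => w; rewrite uE vE. Qed.

Lemma ipS d K u v : ip d K.+1 u v =
  \sum_(x < d 0%N) ip (sub_degrees d) K (fun w => u (val x :: w)) (fun w => v (val x :: w)).
Proof. by []. Qed.

(** The averages over the first letter, and over the letter after the first
    nonzero one, are the effects of uniform rooted and propagating letters. *)
Definition avgA d u w : R :=
  if w is x :: w' then (\sum_(y < d 0%N) u (val y :: w')) / (d 0%N)%:R else u [::].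

Fixpoint avgB d u w : R :=
  if w is x :: w' then
    (if x == 0%N then avgB else avgA) (sub_degrees d) (fun z => u (x :: z)) w'
  else u [::].

Lemma avgA_lin d c u v w :
  avgA d (fun w => c * u w + v w) w = c * avgA d u w + avgA d v w.
Proof. by case: w => [//|x w] /=; rewrite big_split /= -mulr_sumr mulrDl mulrA. Qed.

Lemma avgB_lin d c u v w :
  avgB d (fun w => c * u w + v w) w = c * avgB d u w + avgB d v w.
Proof.
elim: w d u v => [//|x w IH] d u v /=.
by case: (x == 0%N); [exact: IH|exact: avgA_lin].
Qed.

Definition regular d := forall i, (1 < d i)%N.

Lemma regular_sub d : regular d -> regular (sub_degrees d).
Proof. by move=> dr i; exact: dr. Qed.

Lemma regular_neq0 d : regular d -> (d 0%N)%:R != 0 :> R.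
Proof. by move=> dr; rewrite pnatr_eq0 -lt0n ltnW. Qed.

Lemma avgA_sym d K u v : ip d K (avgA d u) v = ip d K u (avgA d v).
Proof.
case: K => [//|K]; rewrite !ipS /ip -!wsum_sum; apply: eq_wsum => w /=.
by rewrite -mulr_sumr -mulr_suml mulrAC mulrA.
Qed.

Lemma avgAK d u w : regular d -> avgA d (avgA d u) w = avgA d u w.
Proof.
case: w => [//|x w] /regular_neq0 d0 /=.
by rewrite sumr_const card_ord; set S := \sum_(y < _) _; rewrite -[(S / _) *+ _]mulr_natr mulfK.
Qed.

Lemma avgB_sym d K u v : ip d K (avgB d u) v = ip d K u (avgB d v).
Proof.
elim: K d u v => [//|K IH] d u v; rewrite !ipS; apply: eq_bigr => -[x xd] _ /=.
by case: (x == 0%N); [exact: IH|exact: avgA_sym].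
Qed.

Lemma avgBK d u w : regular d -> avgB d (avgB d u) w = avgB d u w.
Proof.
elim: w d u => [//|x w IH] d u dr /=.
by case: (x == 0%N); [apply: IH|apply: avgAK]; exact: regular_sub.
Qed.

Lemma avgB0 d u K : avgB d u (nseq K 0%N) = u (nseq K 0%N).
Proof. by elim: K d u => [//|K IH] d u /=; rewrite IH. Qed.

Definition projection d K (T : (seq nat -> R) -> seq nat -> R) :=
  [/\ forall c u v w, T (fun z => c * u z + v z) w = c * T u w + T v w,
      forall u v, ip d K (T u) v = ip d K u (T v) & forall u w, T (T u) w = T u w].

Lemma projA d K : regular d -> projection d K (avgA d).
Proof.
by move=> dr; split=> [c u v w|u v|u w]; [exact: avgA_lin|exact: avgA_sym|exact: avgAK].
Qed.

Lemma projB d K : regular d -> projection d K (avgB d).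
Proof.
by move=> dr; split=> [c u v w|u v|u w]; [exact: avgB_lin|exact: avgB_sym|exact: avgBK].
Qed.

Lemma ip_subl d K u v z : ip d K (fun w => u w - v w) z = ip d K u z - ip d K v z.
Proof.
rewrite -[RHS]addrC -mulN1r -ip_lin.
by apply: eq_ip => // w; rewrite mulN1r addrC.
Qed.

Lemma ip_subr d K u v z : ip d K z (fun w => u w - v w) = ip d K z u - ip d K z v.
Proof. by rewrite (ipC _ _ z) ip_subl (ipC _ _ u) (ipC _ _ v). Qed.

Section Projection.
Variables (d : degrees) (K : nat) (T : (seq nat -> R) -> seq nat -> R).
Hypothesis TP : projection d K T.

Lemma proj_ip u : ip d K (T u) u = ip d K (T u) (T u).
Proof. by case: TP => _ Ts TK; rewrite Ts [RHS]Ts; apply: eq_ip => // w; rewrite TK. Qed.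

Lemma coproj_ip u : ip d K (fun w => u w - T u w) u =
  ip d K (fun w => u w - T u w) (fun w => u w - T u w).
Proof.
rewrite ip_subr [X in _ = _ - X]ip_subl (ipC d K u (T u)) proj_ip.
by rewrite subrr subr0.
Qed.

Lemma pythagoras u : ip d K u u = ip d K (T u) (T u) +
  ip d K (fun w => u w - T u w) (fun w => u w - T u w).
Proof. by rewrite -coproj_ip ip_subl proj_ip addrC subrK. Qed.

Lemma proj_ge0 u : 0 <= ip d K (T u) u.
Proof. by rewrite proj_ip ip_ge0. Qed.

Lemma coproj_ge0 u : 0 <= ip d K (fun w => u w - T u w) u.
Proof. by rewrite coproj_ip ip_ge0. Qed.

End Projection.

(** ** Passing to the next level *)

(** Conductances a of the rooted moves and b of the propagating ones. The killing
    rate l only acts on the average over the first letter: this is the shape that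
    is preserved from one level to the next. *)
Definition form d K (a b l : R) u : R :=
  a * ip d K (fun w => u w - avgA d u w) u + b * ip d K (fun w => u w - avgB d u w) u
  + l * ip d K (avgA d u) u.

Lemma form_ge0 d K a b l u : regular d -> 0 <= a -> 0 <= b -> 0 <= l ->
  0 <= form d K a b l u.
Proof.
move=> dr a0 b0 l0; rewrite !addr_ge0 ?mulr_ge0 //.
- exact/coproj_ge0/projA.
- exact/coproj_ge0/projB.
- exact/proj_ge0/projA.
Qed.

Definition favg n (c : 'I_n -> R) : R := (\sum_x c x) / n%:R.

Section FormSucc.
Variables (d : degrees) (K : nat) (u : seq nat -> R).
Hypothesis dr : regular d.
Let m := d 0%N.
Let d' := sub_degrees d.
Let ux (x : 'I_m) w := u (val x :: w).
Let ax (x : 'I_m) := avgA d' (ux x).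
Let cx (x : 'I_m) w := ux x w - ax x w.

Let ubar w := favg (ux^~ w).

Let m0 : m%:R != 0 :> R. Proof. exact: regular_neq0. Qed.

Let avgA_ubar w : avgA d' ubar w = favg (ax^~ w).
Proof.
rewrite /favg; case: w => [//|y w] /=.
by rewrite -!mulr_suml exchange_big /= -!mulrA [X in _ * X]mulrC.
Qed.

Let avgA_dev x w : avgA d' (fun w => ux x w - ubar w) w = ax x w - favg (ax^~ w).
Proof.
rewrite -avgA_ubar.
have -> : (fun w => ux x w - ubar w) = (fun w => -1 * ubar w + ux x w).
  by apply/funext => z; rewrite mulN1r addrC.
by rewrite avgA_lin mulN1r addrC.
Qed.

Let dev_sum : ip d K.+1 (fun w => u w - avgA d u w) u =
  \sum_x ip d' K (fun w => ux x w - ubar w) (fun w => ux x w - ubar w).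
Proof.
rewrite ipS -[RHS]wsum_sum -wsum_sum; apply: eq_wsum => w /=.
rewrite -/m -/(favg _) -/(ubar w).
have E : \sum_(x < m) (ux x w - ubar w) * ubar w = 0.
  rewrite -mulr_suml sumrB sumr_const card_ord -[_ *+ m]mulr_natr.
  by rewrite /ubar /favg divfK // subrr mul0r.
rewrite -[LHS]subr0 -[X in _ - X]E -sumrB; apply: eq_bigr => x _.
by rewrite -mulrBr.
Qed.

(** On the subtree of x, u splits into its average over the next letter and the
    rest. Below a nonzero x the propagating moves are averages over that letter
    and see the rest only; below 0 they are the propagating moves of the subtree. *)
Lemma formS a b l : form d K.+1 a b l u =
  wsum d' K (fun w =>
    a * (\sum_x (ax x w - favg (ax^~ w)) ^+ 2) + a * (\sum_x (cx x w - favg (cx^~ w)) ^+ 2)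
    + l * (m%:R * (favg (ax^~ w) ^+ 2 + favg (cx^~ w) ^+ 2))
    + b * (\sum_(x | val x != 0%N) cx x w ^+ 2))
  + b * ip d' K (fun w => u (0%N :: w) - avgB d' (fun z => u (0%N :: z)) w)
               (fun w => u (0%N :: w)).
Proof.
have PA := @projA d' K (regular_sub dr).
have cbar w : favg (cx^~ w) = ubar w - favg (ax^~ w).
  by rewrite /favg /cx sumrB mulrBl.
rewrite !wsumD !wsumZ !wsumD !wsum_sum /form dev_sum.
have E1 : \sum_x ip d' K (fun w => ux x w - ubar w) (fun w => ux x w - ubar w) =
    \sum_x wsum d' K (fun w => (ax x w - favg (ax^~ w)) ^+ 2) +
    \sum_x wsum d' K (fun w => (cx x w - favg (cx^~ w)) ^+ 2).
  rewrite -big_split; apply: eq_bigr => x _ /=; rewrite (pythagoras PA) /ip.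
  congr (_ + _); apply: eq_wsum => w; rewrite avgA_dev expr2 // cbar.
  by rewrite /cx; ring.
have E2 : ip d K.+1 (avgA d u) u =
    m%:R * (wsum d' K (fun w => favg (ax^~ w) ^+ 2) + wsum d' K (fun w => favg (cx^~ w) ^+ 2)).
  transitivity (m%:R * ip d' K ubar ubar).
    rewrite ipS -wsumZ -wsum_sum; apply: eq_wsum => w /=.
    rewrite -/m -/(favg _) -/(ubar w) -mulr_sumr mulrCA; congr (_ * _).
    by rewrite /ubar /favg mulrC divfK.
  congr (_ * _); rewrite (pythagoras PA) /ip.
  by congr (_ + _); apply: eq_wsum => w; rewrite avgA_ubar expr2 // cbar.
have E3 : ip d K.+1 (fun w => u w - avgB d u w) u =
    ip d' K (fun w => u (0%N :: w) - avgB d' (fun z => u (0%N :: z)) w)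
               (fun w => u (0%N :: w)) +
    \sum_(x < m | val x != 0%N) wsum d' K (fun w => cx x w ^+ 2).
  have mgt0 : (0 < m)%N by rewrite ltnW // dr.
  rewrite ipS (bigD1 (Ordinal mgt0)) //=; congr (_ + _).
  rewrite -/m; apply: congr_big => // x x0.
  have {}x0 : (val x == 0%N) = false by exact: negbTE x0.
  rewrite x0 -[LHS]/(ip d' K (fun w => ux x w - ax x w) (ux x)).
  by rewrite (coproj_ip PA).
by rewrite E1 E2 E3; ring.
Qed.

End FormSucc.
End Levels.

Section Estimates.
Variable R : realType.
Implicit Types (d : degrees) (K : nat) (u v : seq nat -> R) (w : seq nat).

Lemma titu (r s x y : R) : 0 < r -> 0 < s ->
  (x + y) ^+ 2 / (r + s) <= x ^+ 2 / r + y ^+ 2 / s.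
Proof.
move=> r0 s0; have rs0 : 0 < r + s by rewrite addr_gt0.
rewrite -subr_ge0.
have -> : x ^+ 2 / r + y ^+ 2 / s - (x + y) ^+ 2 / (r + s) =
    (s * x - r * y) ^+ 2 / (r * s * (r + s)).
  by field; rewrite !gt_eqF.
by rewrite divr_ge0 ?sqr_ge0 // !mulr_ge0 // ltW.
Qed.

Lemma sqr_sum_le (I : finType) (P : pred I) (y : I -> R) :
  (\sum_(i | P i) y i) ^+ 2 <= #|P|%:R * \sum_(i | P i) y i ^+ 2.
Proof.
have [P0|P0] := posnP #|P|.
  by rewrite P0 mul0r big_pred0 ?expr0n //; exact/card0_eq.
have n0 : 0 < #|P|%:R :> R by rewrite ltr0n.
set S := \sum_(i | P i) y i; pose a := S / #|P|%:R.
have : 0 <= \sum_(i | P i) (y i - a) ^+ 2 by apply: sumr_ge0 => i _; rewrite sqr_ge0.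
have -> : \sum_(i | P i) (y i - a) ^+ 2 =
    \sum_(i | P i) y i ^+ 2 - S ^+ 2 / #|P|%:R.
  transitivity (\sum_(i | P i) (y i ^+ 2 - 2 * a * y i + a ^+ 2)).
    by apply: eq_bigr => i _; ring.
  rewrite big_split sumrB /= -mulr_sumr -/S sumr_const -[_ *+ _]mulr_natr.
  by rewrite /a; field; rewrite gt_eqF.
by rewrite subr_ge0 ler_pdivrMr // mulrC.
Qed.

(** By the Cauchy-Schwarz inequality, since the deviations of the other numbers add
    up to minus that of c i0. *)
Lemma dev_ge n (c : 'I_n -> R) (i0 : 'I_n) :
  \sum_(x | x != i0) (c i0 - c x) ^+ 2 <= n%:R * \sum_x (c x - favg c) ^+ 2.
Proof.
have n_gt0 : (0 < n)%N by apply: leq_ltn_trans (ltn_ord i0).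
have n0 : n%:R != 0 :> R by rewrite pnatr_eq0 -lt0n.
pose y x := c x - favg c.
have sy : \sum_x y x = 0.
  rewrite sumrB sumr_const card_ord -[_ *+ n]mulr_natr /favg divfK //.
  exact: subrr.
have y0 : n%:R * y i0 ^+ 2 <= (n%:R - 1) * \sum_x y x ^+ 2.
  have yE : y i0 = - \sum_(x | x != i0) y x.
    by apply/eqP; rewrite -addr_eq0 -(bigD1 i0 (P := xpredT)) //= sy.
  have := sqr_sum_le (fun x => x != i0) y; rewrite -sqrrN -yE.
  have -> : #|(fun x : 'I_n => x != i0)|%:R = n%:R - 1 :> R.
    have -> : #|(fun x : 'I_n => x != i0)| = n.-1.
      transitivity #|predC1 i0|; first exact: eq_card.
      by rewrite cardC1 card_ord.
    by rewrite -subn1 natrB.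
  have -> : \sum_x y x ^+ 2 = y i0 ^+ 2 + \sum_(x | x != i0) y x ^+ 2.
    by rewrite (bigD1 i0).
  lra.
have -> : \sum_(x | x != i0) (c i0 - c x) ^+ 2 =
    \sum_x y x ^+ 2 + n%:R * y i0 ^+ 2.
  transitivity (\sum_x (c i0 - c x) ^+ 2).
    by rewrite [RHS](bigD1 i0) //= subrr expr0n add0r.
  transitivity (\sum_x (y x ^+ 2 - 2 * y i0 * y x + y i0 ^+ 2)).
    by apply: eq_bigr => x _; rewrite /y; ring.
  rewrite big_split sumrB /= -mulr_sumr sy sumr_const card_ord.
  by rewrite -[_ *+ n]mulr_natr; ring.
by rewrite -/y; nra.
Qed.

(** Resistances r of the rooted moves, 2 of the propagating ones, and q of the
    killing. Seen from the subtree of 0, the average over the second letter is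
    killed through r and q / m in series. The rest is damped through m - 1
    parallel branches, one for each x <> 0, made of m r (the rooted move from 0 to
    x) and 2 (the propagating moves below x) in series. *)
Lemma formS_ge d K u (r q : R) : regular d -> 0 < r -> 0 < q ->
  form (sub_degrees d) K (((d 0%N)%:R * r + 2) / ((d 0%N)%:R - 1))^-1 2^-1
    (r + q / (d 0%N)%:R)^-1 (fun w => u (0%N :: w))
  <= form d K.+1 r^-1 2^-1 q^-1 u.
Proof.
move=> dr r0 q0; set m := d 0%N; set d' := sub_degrees d.
have m2 : 2 <= m%:R :> R by rewrite ler_nat dr.
have m_gt0 : (0 < m)%N by rewrite ltnW // dr.
have m0 : 0 < m%:R :> R by rewrite ltr0n.
have m10 : 0 < m%:R - 1 :> R by lra.
have qm : 0 < q / m%:R by rewrite divr_gt0.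
pose i0 : 'I_m := Ordinal m_gt0.
rewrite (formS K u dr) -/m -/d'.
set u0 := fun w => u (0%N :: w).
pose a (x : 'I_m) := avgA d' (fun w => u (val x :: w)).
pose c (x : 'I_m) w := u (val x :: w) - a x w.
have dr' := regular_sub dr; have PA := @projA R d' K dr'.
have -> : form d' K ((m%:R * r + 2) / (m%:R - 1))^-1 2^-1 (r + q / m%:R)^-1 u0 =
    wsum d' K (fun w => c i0 w ^+ 2 / ((m%:R * r + 2) / (m%:R - 1))
                        + a i0 w ^+ 2 / (r + q / m%:R))
    + 2^-1 * ip d' K (fun w => u0 w - avgB d' u0 w) u0.
  rewrite /form (coproj_ip PA) (proj_ip PA) wsumD /ip.
  rewrite -(wsumZ _ _ ((m%:R * r + 2) / (m%:R - 1))^-1) -(wsumZ _ _ (r + _)^-1).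
  rewrite -/(ip _ _ _ _) addrAC; congr (_ + _ + _); apply: eq_wsum => w.
    by rewrite mulrC -expr2.
  by rewrite mulrC -expr2.
rewrite lerD2r; apply: le_wsum => w.
rewrite -/(a _) -/(c _ _).
have Ha : a i0 w ^+ 2 / (r + q / m%:R) <=
    r^-1 * (\sum_x (a x w - favg (a^~ w)) ^+ 2) + q^-1 * (m%:R * favg (a^~ w) ^+ 2).
  have -> : a i0 w = (a i0 w - favg (a^~ w)) + favg (a^~ w) by rewrite subrK.
  apply: (le_trans (titu _ _ r0 qm)); rewrite invfM invrK; apply: lerD.
    rewrite mulrC ler_wpM2l ?invr_ge0 ?(ltW r0) // (bigD1 i0) //= lerDl.
    by apply: sumr_ge0 => x _; rewrite sqr_ge0.
  by rewrite mulrC -mulrA.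
have Hc : c i0 w ^+ 2 / ((m%:R * r + 2) / (m%:R - 1)) <=
    r^-1 * (\sum_x (c x w - favg (c^~ w)) ^+ 2)
    + 2^-1 * (\sum_(x | val x != 0%N) c x w ^+ 2).
  have mr : 0 < m%:R * r by rewrite mulr_gt0.
  have -> : c i0 w ^+ 2 / ((m%:R * r + 2) / (m%:R - 1)) =
      \sum_(x : 'I_m | x != i0) c i0 w ^+ 2 / (m%:R * r + 2).
    have -> : \sum_(x : 'I_m | x != i0) c i0 w ^+ 2 / (m%:R * r + 2) =
        (c i0 w ^+ 2 / (m%:R * r + 2)) *+ m.-1.
      by rewrite sumr_const cardC1 card_ord.
    have m1 : m.-1%:R = m%:R - 1 :> R by rewrite -subn1 natrB.
    rewrite -[(_ / _) *+ m.-1]mulr_natr m1; field.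
    by rewrite !gt_eqF // addr_gt0.
  apply: (@le_trans _ _ (\sum_(x : 'I_m | x != i0)
      ((c i0 w - c x w) ^+ 2 / (m%:R * r) + c x w ^+ 2 / 2))).
    apply: ler_sum => x _.
    by have := @titu (m%:R * r) 2 (c i0 w - c x w) (c x w) mr ltac:(lra); rewrite subrK.
  rewrite big_split /= -!mulr_suml; apply: lerD; last first.
    by rewrite mulrC.
  rewrite ler_pdivrMr // mulrAC (mulrC m%:R) mulrA mulVf ?gt_eqF // mul1r.
  exact: dev_ge.
have Fc : 0 <= q^-1 * (m%:R * favg (c^~ w) ^+ 2).
  by rewrite mulr_ge0 ?invr_ge0 ?(ltW q0) // mulr_ge0 ?sqr_ge0.
suff : c i0 w ^+ 2 / ((m%:R * r + 2) / (m%:R - 1)) + a i0 w ^+ 2 / (r + q / m%:R) <=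
    r^-1 * (\sum_x (a x w - favg (a^~ w)) ^+ 2) +
    r^-1 * (\sum_x (c x w - favg (c^~ w)) ^+ 2) +
    q^-1 * (m%:R * (favg (a^~ w) ^+ 2 + favg (c^~ w) ^+ 2)) +
    2^-1 * (\sum_(x | val x != 0%N) c x w ^+ 2) by [].
by rewrite !mulrDr; move: Ha Hc Fc; lra.
Qed.

(** The number of vertices at depth k, and the growth of the resistance. *)
Definition vol d k : R := \prod_(i < k) (d i)%:R.
Definition res d k : R := \prod_(i < k) ((d i)%:R / ((d i)%:R - 1)).

Lemma degree_ge1 d i : regular d -> 1 <= (d i)%:R - 1 :> R.
Proof. by move=> dr; have : 2 <= (d i)%:R :> R by [rewrite ler_nat dr]; lra. Qed.

Lemma res_ge1 d k : regular d -> 1 <= res d k.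
Proof.
move=> dr; rewrite /res; elim/big_rec: _ => // i x _ x1.
have := degree_ge1 i dr => d1.
rewrite -[1]mulr1; apply: ler_pM => //.
by rewrite ler_pdivlMr; lra.
Qed.

Lemma vol_ge1 d k : regular d -> 1 <= vol d k.
Proof.
move=> dr; rewrite /vol; elim/big_rec: _ => // i x _ x1.
rewrite -[1]mulr1; apply: ler_pM => //.
by have := degree_ge1 i dr; lra.
Qed.

Lemma volS d k : vol d k.+1 = (d 0%N)%:R * vol (sub_degrees d) k.
Proof. exact: big_ord_recl. Qed.

Lemma resS d k : res d k.+1 =
  (d 0%N)%:R / ((d 0%N)%:R - 1) * res (sub_degrees d) k.
Proof. exact: big_ord_recl. Qed.

Lemma ip_ge_root d K u : regular d -> u (nseq K 0%N) ^+ 2 <= ip d K u u.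
Proof.
elim: K d u => [|K IH] d u dr; first by rewrite expr2.
rewrite ipS (bigD1 (Ordinal (ltnW (dr 0%N)))) //=.
apply: le_trans (IH _ (fun w => u (0%N :: w)) (regular_sub dr)) _.
by rewrite lerDl; apply: sumr_ge0 => x _; exact: ip_ge0.
Qed.

(** With r = 4 a - 2, one level turns a into a times m / (m - 1). *)
Lemma form_ge_root k d K u (a q : R) : regular d -> (k <= K)%N -> 1 <= a -> 0 < q ->
  u (nseq K 0%N) ^+ 2 <=
  ((q - 8 * a) / vol d k + 16 * a * res d k) * form d K (4 * a - 2)^-1 2^-1 q^-1 u.
Proof.
elim: k d K u a q => [|k IH] d K u a q dr kK a1 q0.
  rewrite /vol /res !big_ord0 divr1 mulr1.
  have -> : q - 8 * a + 16 * a = q + 8 * a by ring.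
  have PA := projA R K dr; have PB := projB R K dr.
  have A1 := coproj_ge0 PA u; have A2 := coproj_ge0 PB u; have A3 := proj_ge0 PA u.
  apply: (le_trans (ip_ge_root K u dr)).
  have -> : ip d K u u = ip d K (fun w => u w - avgA d u w) u + ip d K (avgA d u) u.
    by rewrite ip_subl subrK.
  rewrite /form !mulrDr addrAC; apply: ler_wpDr.
    by rewrite !mulr_ge0 // ?addr_ge0 ?mulr_ge0 //; lra.
  apply: lerD; rewrite mulrA; apply: ler_peMl => //.
    by rewrite ler_pdivlMr; lra.
  by rewrite ler_pdivlMr; lra.
case: K kK => // K; rewrite ltnS => kK.
have m2 : 2 <= (d 0%N)%:R :> R by rewrite ler_nat dr.
set m : R := (d 0%N)%:R in m2 *; pose a' := a * (m / (m - 1)); pose q' := 4 * a - 2 + q / m.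
have m0 : 0 < m by lra.
have m10 : 0 < m - 1 by lra.
have qm : 0 < q / m by rewrite divr_gt0.
have aa' : a <= a' by rewrite /a' ler_peMr ?ler_pdivlMr; lra.
have a'1 : 1 <= a' by lra.
have q'0 : 0 < q' by rewrite /q'; lra.
have dr' := regular_sub dr.
have := IH _ K (fun w => u (0%N :: w)) a' q' dr' kK a'1 q'0.
have -> : 4 * a' - 2 = (m * (4 * a - 2) + 2) / (m - 1).
  by rewrite /a'; field; rewrite gt_eqF.
move/le_trans; apply.
have r0 : 0 < 4 * a - 2 by lra.
have := formS_ge K u dr r0 q0; rewrite -/m -/q' => le_form.
set f' := form _ K _ _ _ _ in le_form *; set f := form _ K.+1 _ _ _ _ in le_form *.
have f'0 : 0 <= f'.
  apply: form_ge0 => //; rewrite invr_ge0 ?(ltW q'0) //.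
  by rewrite divr_ge0 // ?(ltW m10) // addr_ge0 // mulr_ge0 // ltW.
rewrite volS resS -/m; set V := vol _ k; set S := res _ k.
have V1 : 1 <= V by exact: vol_ge1.
have S1 : 1 <= S by exact: res_ge1.
have aS : 16 * a * (m / (m - 1) * S) = 16 * a' * S by rewrite /a'; ring.
rewrite aS.
have le_coef : (q' - 8 * a') / V + 16 * a' * S <= (q - 8 * a) / (m * V) + 16 * a' * S.
  have -> : (q - 8 * a) / (m * V) = (q - 8 * a) / m / V by rewrite invfM mulrA.
  rewrite lerD2r; apply: ler_wpM2r; first by rewrite invr_ge0; lra.
  rewrite mulrBl.
  have : 8 * a / m <= 4 * a by rewrite ler_pdivrMr //; nra.
  by rewrite /q'; lra.
have coef0 : 0 <= (q' - 8 * a') / V + 16 * a' * S.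
  have : 8 * a' / V <= 8 * a' by rewrite ler_pdivrMr; nra.
  have : 0 <= q' / V by rewrite divr_ge0; lra.
  have : 16 * a' <= 16 * a' * S by rewrite ler_peMr; lra.
  by rewrite mulrBl; lra.
by apply: ler_pM.
Qed.

(** A test function on the next level: the harmonic interpolation of [v]. *)
Lemma test_functionS d K v (r : R) : regular d -> 0 < r ->
  exists u, [/\ forall w, u (0%N :: w) = v w,
    ip d K.+1 u u <= (d 0%N)%:R * ip (sub_degrees d) K v v &
    form d K.+1 r^-1 2^-1 0 u =
    form (sub_degrees d) K (((d 0%N)%:R * r + 2) / ((d 0%N)%:R - 1))^-1 2^-1 0 v].
Proof.
move=> dr r0; set m := d 0%N; set d' := sub_degrees d.
have m2 : 2 <= m%:R :> R by rewrite ler_nat dr.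
have m_gt0 : (0 < m)%N by rewrite ltnW // dr.
have m0 : 0 < m%:R :> R by rewrite ltr0n.
have m10 : 0 < m%:R - 1 :> R by lra.
have mr : 0 < m%:R * r by rewrite mulr_gt0.
pose i0 : 'I_m := Ordinal m_gt0.
pose t := 2 / (2 + m%:R * r); have t01 : 0 <= t <= 1.
  by rewrite /t divr_ge0 ?ler_pdivrMr; lra.
pose z w := t * (v w - avgA d' v w) + avgA d' v w.
pose u w := if w is x :: w' then if x == 0%N then v w' else z w' else 0.
have dr' := regular_sub dr; have PA := @projA R d' K dr'.
have Az w : avgA d' z w = avgA d' v w.
  rewrite /z avgA_lin avgAK //.
  have -> : (fun w => v w - avgA d' v w) = (fun w => -1 * avgA d' v w + v w).
    by apply/funext => w'; rewrite mulN1r addrC.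
  by rewrite avgA_lin avgAK // mulN1r addNr mulr0 add0r.
have zz : ip d' K z z <= ip d' K v v.
  rewrite (pythagoras PA z) (pythagoras PA v).
  have -> : ip d' K (avgA d' z) (avgA d' z) = ip d' K (avgA d' v) (avgA d' v).
    exact: eq_ip.
  rewrite lerD2l; apply: le_wsum => w; rewrite Az /z addrK -!expr2 exprMn.
  rewrite ler_piMl ?sqr_ge0 //; move: t01; rewrite expr2 => /andP[t0 t1].
  by rewrite mulr_ile1.
exists u; split=> //.
  rewrite ipS (bigD1 i0) //=.
  apply: (@le_trans _ _ (ip d' K v v + \sum_(x : 'I_m | x != i0) ip d' K v v)).
    rewrite lerD2l; apply: ler_sum => x x0.
    have {}x0 : (val x == 0%N) = false by exact: negbTE x0.
    apply: le_trans zz; rewrite le_eqVlt; apply/orP; left; apply/eqP.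
    by apply: eq_ip => w /=; rewrite x0.
  rewrite sumr_const cardC1 card_ord -[_ *+ _]mulr_natr -subn1 natrB //.
  by rewrite mulrC; lra.
rewrite (formS K u dr) -/m -/d' /form mul0r addr0 (coproj_ip PA) /ip.
rewrite -(wsumZ _ _ (((m%:R * r + 2) / (m%:R - 1))^-1)); congr (_ + _); apply: eq_wsum => w; rewrite mul0r addr0.
set c0 := v w - avgA d' v w.
have aE (x : 'I_m) : avgA d' (fun w => u (val x :: w)) w = avgA d' v w.
  by rewrite /u; case: (val x == 0%N); rewrite // Az.
have cE (x : 'I_m) : u (val x :: w) - avgA d' (fun w => u (val x :: w)) w =
    if x == i0 then c0 else t * c0.
  rewrite aE /u -[x == i0]/(val x == 0%N); case: (val x == 0%N) => //.
  by rewrite /z addrK.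
have favgE (c : R) : favg (fun _ : 'I_m => c) = c.
  by rewrite /favg sumr_const card_ord -[_ *+ _]mulr_natr mulfK // gt_eqF.
under eq_bigr do rewrite aE.
have -> : favg (fun x : 'I_m => avgA d' (fun w => u (val x :: w)) w) = avgA d' v w.
  by rewrite -[RHS]favgE; congr (_ / _); apply: eq_bigr => x _; exact: aE.
rewrite [X in _ * X + _]big1 => [|x _]; last by rewrite subrr expr0n.
rewrite mulr0 add0r.
have m1 : m.-1%:R = m%:R - 1 :> R by rewrite -subn1 natrB.
have sumE (p q : R) : \sum_(x : 'I_m) (if x == i0 then p else q) = p + (m%:R - 1) * q.
  rewrite (bigD1 i0) //=; congr (_ + _).
  transitivity (\sum_(x : 'I_m | x != i0) q).
    by apply: eq_bigr => x /negPf->.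
  by rewrite sumr_const cardC1 card_ord -m1 mulrC mulr_natr.
have cbar : favg (fun x : 'I_m => u (val x :: w) - avgA d' (fun w => u (val x :: w)) w) =
    (c0 + (m%:R - 1) * (t * c0)) / m%:R.
  by rewrite /favg -sumE; congr (_ / _); apply: eq_bigr => x _; exact: cE.
rewrite cbar; set cb := _ / m%:R.
have -> : \sum_(x < m) (u (val x :: w) - avgA d' (fun w => u (val x :: w)) w - cb) ^+ 2 =
    (c0 - cb) ^+ 2 + (m%:R - 1) * (t * c0 - cb) ^+ 2.
  by rewrite -sumE; apply: eq_bigr => x _; rewrite cE; case: ifP.
have -> : \sum_(x < m | val x != 0%N)
    (u (val x :: w) - avgA d' (fun w => u (val x :: w)) w) ^+ 2 =
    (m%:R - 1) * (t * c0) ^+ 2.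
  transitivity (\sum_(x : 'I_m | x != i0) (t * c0) ^+ 2).
    by apply: eq_big => x // x0; rewrite cE (_ : (x == i0) = false) //; exact: negbTE x0.
  by rewrite sumr_const cardC1 card_ord -m1 [RHS]mulrC mulr_natr.
rewrite /cb /t; field.
by rewrite !gt_eqF //; lra.
Qed.

Definition origin K w : R := (w == nseq K 0%N)%:R.

Lemma ip_origin d K v : regular d -> ip d K v (origin K) = v (nseq K 0%N).
Proof.
elim: K d v => [|K IH] d v dr; first by rewrite /ip /= /origin eqxx mulr1.
rewrite ipS (bigD1 (Ordinal (ltnW (dr 0%N)))) //= big1 ?addr0 => [|x x0].
  by rewrite -[RHS](IH (sub_degrees d) (fun w => v (0%N :: w)) (regular_sub dr)).
have {}x0 : (val x == 0%N) = false by exact: negbTE x0.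
rewrite -(mul0r (wsum (sub_degrees d) K (fun=> 0))) -wsumZ; apply: eq_wsum => w.
by rewrite /origin eqseq_cons x0 !mulr0.
Qed.

(** The delta function at depth k, extended level by level to the root; this is
    the reverse of [form_ge_root] without killing. *)
Lemma test_function k d K (a : R) : regular d -> (k <= K)%N -> 1 <= a ->
  exists u, [/\ u (nseq K 0%N) = 1, ip d K u u <= vol d k &
    form d K (4 * a - 2)^-1 2^-1 0 u <= (2 * a * res d k)^-1].
Proof.
elim: k d K a => [|k IH] d K a dr kK a1.
  pose delta := origin K.
  exists delta; rewrite /vol /res !big_ord0 mulr1.
  have ipd v : ip d K v delta = v (nseq K 0%N) by exact: ip_origin.
  split; [by rewrite /delta /origin eqxx|by rewrite ipd /delta /origin eqxx|].
  have PA := projA R K dr; rewrite /form mul0r addr0.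
  have -> : ip d K (fun w => delta w - avgB d delta w) delta = 0.
    by rewrite ipd avgB0 subrr.
  rewrite mulr0 addr0 ip_subl ipd {1}/delta /origin eqxx mulr1n.
  have := proj_ge0 PA delta; set x := ip _ _ _ _ => x0.
  apply: (@le_trans _ _ (4 * a - 2)^-1).
    by rewrite ler_piMr ?invr_ge0; lra.
  by rewrite lef_pV2 ?posrE; lra.
case: K kK => // K; rewrite ltnS => kK.
have m2 : 2 <= (d 0%N)%:R :> R by rewrite ler_nat dr.
have aa' : 1 <= a * ((d 0%N)%:R / ((d 0%N)%:R - 1)).
  rewrite -[1]mulr1; apply: ler_pM => //.
  by rewrite ler_pdivlMr; lra.
have [v [v0 vv fv]] := IH _ K _ (regular_sub dr) kK aa'.
have r0 : 0 < 4 * a - 2 by lra.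
have [u [uv uu fu]] := test_functionS K v dr r0.
exists u; split; first by rewrite /= uv.
  by apply: (le_trans uu); rewrite volS ler_wpM2l.
rewrite fu resS; move: fv; rewrite -!mulrA.
have -> : 4 * (a * ((d 0%N)%:R / ((d 0%N)%:R - 1))) - 2 =
    ((d 0%N)%:R * (4 * a - 2) + 2) / ((d 0%N)%:R - 1).
  by field; rewrite gt_eqF; lra.
by [].
Qed.

End Estimates.

(** * Return probabilities *)

Section Iterates.
Variables (R : realType) (d : degrees) (K : nat).
Hypothesis dr : regular d.
Implicit Types (u v : seq nat -> R).

Definition avgP u : seq nat -> R := fun w => (avgA d u w + avgB d u w) / 2.

Local Notation Ip := (@ip R d K).
Let PA := projA R K dr.
Let PB := projB R K dr.

Lemma avgP_lin c u v w :
  avgP (fun z => c * u z + v z) w = c * avgP u w + avgP v w.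
Proof. by rewrite /avgP avgA_lin avgB_lin; field. Qed.

Lemma ip_avgP u v : Ip (avgP u) v = (ip d K (avgA d u) v + ip d K (avgB d u) v) / 2.
Proof.
rewrite [RHS]mulrC -[X in _ * (_ + X)]mul1r /ip -wsumZ -wsumD -wsumZ.
by apply: eq_wsum => w; rewrite /avgP; field.
Qed.

Lemma avgP_sym u v : Ip (avgP u) v = Ip u (avgP v).
Proof.
by rewrite ip_avgP [RHS]ipC ip_avgP avgA_sym avgB_sym !(ipC _ _ u).
Qed.

Definition energy u v : R := Ip (fun w => u w - avgP u w) v.

Lemma energyE u : energy u u = form d K 2^-1 2^-1 0 u.
Proof.
by rewrite /energy /form mul0r addr0 !ip_subl ip_avgP; field.
Qed.

Lemma energy_ge0 u : 0 <= energy u u.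
Proof. by rewrite energyE form_ge0. Qed.

Lemma energy_lin c u v z :
  energy (fun w => c * u w + v w) z = c * energy u z + energy v z.
Proof.
rewrite /energy -ip_lin; apply: eq_ip => // w; rewrite avgP_lin; ring.
Qed.

Lemma energy_sym u v : energy u v = energy v u.
Proof.
rewrite /energy !ip_subl (ipC d K u v); congr (_ - _).
by rewrite avgP_sym ipC.
Qed.

Lemma cauchy_schwarz (b : (seq nat -> R) -> (seq nat -> R) -> R) :
  (forall c u v z, b (fun w => c * u w + v w) z = c * b u z + b v z) ->
  (forall u v, b u v = b v u) -> (forall u, 0 <= b u u) ->
  forall u v, b u v ^+ 2 <= b u u * b v v.
Proof.
move=> lin sym pos u v.
have quad c : 0 <= c ^+ 2 * b u u + 2 * c * b u v + b v v.
  have := pos (fun w => c * u w + v w); rewrite lin (sym u) (sym v) !lin (sym v u).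
  by have -> : c * (c * b u u + b u v) + (c * b u v + b v v) =
    c ^+ 2 * b u u + 2 * c * b u v + b v v by ring.
have [b0|b0] := ltP 0 (b u u).
  have := quad (- b u v / b u u).
  have -> : (- b u v / b u u) ^+ 2 * b u u + 2 * (- b u v / b u u) * b u v + b v v =
      (b u u * b v v - b u v ^+ 2) / b u u by field; rewrite gt_eqF.
  by rewrite pmulr_lge0 ?invr_gt0 // subr_ge0.
have uu0 : b u u = 0 by apply/eqP; rewrite eq_le b0 pos.
rewrite uu0 mul0r; have [->|uv0] := eqVneq (b u v) 0; first by rewrite expr0n.
have := quad (- (b v v + 1) / b u v); rewrite uu0 mulr0 add0r.
have -> : 2 * (- (b v v + 1) / b u v) * b u v = - 2 * (b v v + 1) by field.
by have := pos v; lra.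
Qed.

Let x0 := @origin R K.
Definition heat n := iter n avgP x0.
Definition heat_return n := heat n (nseq K 0%N).
Definition level_green n := \sum_(k < n) heat_return k.

Lemma heat_returnE n : heat_return n = Ip (heat n) x0.
Proof. by rewrite ip_origin. Qed.

Lemma ip_heat m n : Ip (heat m) (heat n) = heat_return (m + n).
Proof.
elim: n m => [|n IH] m; first by rewrite addn0 heat_returnE.
by rewrite -avgP_sym addnS -addSn -IH.
Qed.

(** At even times the difference is an energy; at odd times one uses that a step
    is the mean of two projections. *)
Lemma heat_return_decr n : heat_return n.+1 <= heat_return n.
Proof.
rewrite -(odd_double_half n); set h := n./2; rewrite -addnn.
case: (odd n); rewrite /= ?add1n ?add0n; last first.
  rewrite -addSn -!ip_heat; have := energy_ge0 (heat h).
  by rewrite /energy ip_subl subr_ge0.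
rewrite -addnS -addSn -!ip_heat [leRHS]ipC; set y := heat h.
(* the step is the mean of two projections, whose values at y are averaged *)
have -> : Ip (heat h.+1) y = (ip d K (avgA d y) (avgA d y) + ip d K (avgB d y) (avgB d y)) / 2.
  by rewrite [LHS]ip_avgP (proj_ip PA) (proj_ip PB).
rewrite mulrC -[X in _ * (_ + X)]mul1r /ip -wsumZ -wsumD -wsumZ.
apply: le_wsum => w; rewrite -[heat h.+1 w]/((avgA d y w + avgB d y w) / 2).
set x := avgA d y w; set z := avgB d y w.
by have := sqr_ge0 (x - z); rewrite expr2; lra.
Qed.

Lemma heat_return_ge0 n : 0 <= heat_return n.
Proof.
rewrite heat_returnE; rewrite -(odd_double_half n); set h := n./2; rewrite -addnn.
rewrite -heat_returnE; case: (odd n); rewrite /= ?add1n ?add0n; last first.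
  by rewrite -ip_heat ip_ge0.
rewrite -addSn -ip_heat [Ip _ _]ip_avgP divr_ge0 // addr_ge0 //.
  exact: (proj_ge0 PA).
exact: (proj_ge0 PB).
Qed.

Lemma heat_return_le m n : (m <= n)%N -> heat_return n <= heat_return m.
Proof.
move=> /subnK <-; elim: (n - m)%N => [//|k IH].
by rewrite addSn (le_trans (heat_return_decr _)).
Qed.

Lemma heat_return_le_green n k : (n <= k)%N -> n%:R * heat_return k <= level_green n.
Proof.
move=> nk; rewrite mulr_natl -[X in _ *+ X]card_ord -sumr_const.
by apply: ler_sum => i _; rewrite heat_return_le // (leq_trans _ nk) // ltnW.
Qed.

Let heat_sum n : seq nat -> R := fun w => \sum_(k < n) heat k w.

Let ip_heat_sum n v : Ip (heat_sum n) v = \sum_(k < n) Ip (heat k) v.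
Proof.
rewrite /ip -wsum_sum; apply: eq_wsum => w.
by rewrite /heat_sum mulr_suml.
Qed.

Let heat_sum_telescope n w : heat_sum n w - avgP (heat_sum n) w = x0 w - heat n w.
Proof.
elim: n => [|n IH].
  have E : heat_sum 0 = fun w => -1 * x0 w + x0 w.
    by apply/funext => z; rewrite /heat_sum big_ord0 mulN1r addNr.
  by rewrite E avgP_lin /heat /=; ring.
have E : heat_sum n.+1 = fun w => 1 * heat n w + heat_sum n w.
  by apply/funext => z; rewrite /heat_sum big_ord_recr /= mul1r addrC.
rewrite E avgP_lin !mul1r -[avgP (heat n) w]/(heat n.+1 w).
by move: IH; lra.
Qed.

Let energy_heat_sum n v : energy (heat_sum n) v = v (nseq K 0%N) - Ip (heat n) v.
Proof.
rewrite /energy (_ : (fun w => _) = fun w => x0 w - heat n w); last first.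
  by apply/funext => w; exact: heat_sum_telescope.
by rewrite ip_subl ipC ip_origin.
Qed.

Let heat_sum_origin n : heat_sum n (nseq K 0%N) = level_green n.
Proof. by []. Qed.

Let ip_heat_heat_sum_ge0 n : 0 <= Ip (heat n) (heat_sum n).
Proof.
rewrite ipC ip_heat_sum; apply: sumr_ge0 => k _.
by rewrite ip_heat heat_return_ge0.
Qed.

Lemma level_green_ge0 n : 0 <= level_green n.
Proof. by apply: sumr_ge0 => k _; exact: heat_return_ge0. Qed.

(** The function u = sum of the heat kernels up to time n has energy and
    squared norm / n at most u(o); comparing with the form seen from depth k
    bounds u(o). *)
Lemma level_green_le n k : (0 < n)%N -> (k <= K)%N ->
  level_green n <= 2 * n%:R / vol R d k + 32 * res R d k.
Proof.
move=> n0 kK; have n0' : 0 < n%:R :> R by rewrite ltr0n.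
have := form_ge_root (heat_sum n) dr kK (lexx 1) n0'.
rewrite !mulr1 (_ : 4 - 2 = 2 :> R); last by lra.
rewrite heat_sum_origin.
set V := vol R d k; set S := res R d k; set G := level_green n.
have V1 : 1 <= V by exact: vol_ge1.
have S1 : 1 <= S by exact: res_ge1.
have G0 : 0 <= G by exact: level_green_ge0.
have -> : form d K 2^-1 2^-1 n%:R^-1 (heat_sum n) =
    energy (heat_sum n) (heat_sum n) + n%:R^-1 * ip d K (avgA d (heat_sum n)) (heat_sum n).
  by rewrite energyE /form mul0r addr0.
have E1 : energy (heat_sum n) (heat_sum n) <= G.
  by rewrite energy_heat_sum heat_sum_origin gerBl ip_heat_heat_sum_ge0.
have E2 : n%:R^-1 * ip d K (avgA d (heat_sum n)) (heat_sum n) <= G.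
  rewrite mulrC ler_pdivrMr //.
  apply: (@le_trans _ _ (Ip (heat_sum n) (heat_sum n))).
    by have := coproj_ge0 PA (heat_sum n); rewrite ip_subl subr_ge0.
  rewrite ip_heat_sum mulr_natr -[X in _ *+ X]card_ord -sumr_const.
  apply: ler_sum => i _; rewrite ipC ip_heat_sum.
  by apply: ler_sum => j _; rewrite ip_heat heat_return_le // leq_addr.
move=> H.
have [->|Gneq0] := eqVneq G 0.
  have : 0 <= 2 * n%:R / V by rewrite divr_ge0; lra.
  by lra.
have Gpos : 0 < G by rewrite lt_def Gneq0.
rewrite -(ler_pM2l Gpos) -expr2; apply: (le_trans H).
have C0 : 0 <= (n%:R - 8) / V + 16 * S <= n%:R / V + 16 * S.
  have : 8 / V <= 8 by rewrite ler_pdivrMr; lra.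
  have : 0 <= 8 / V by rewrite divr_ge0; lra.
  have : 0 <= n%:R / V by rewrite divr_ge0; lra.
  by rewrite mulrBl; lra.
have /andP[C1 C2] := C0.
apply: (@le_trans _ _ ((n%:R / V + 16 * S) * (2 * G))).
  by apply: ler_pM => //; [rewrite addr_ge0 ?energy_ge0 // mulr_ge0 ?invr_ge0 ?(ltW n0') ?(proj_ge0 PA)|lra].
by rewrite le_eqVlt; apply/orP; left; apply/eqP; ring.
Qed.

(** Thomson's principle: test functions of small energy force many returns. *)
Lemma level_green_ge n k : (0 < n)%N -> (k <= K)%N ->
  1 <= level_green n * ((res R d k)^-1 + 2 * vol R d k / n%:R).
Proof.
move=> n0 kK; have n0' : 0 < n%:R :> R by rewrite ltr0n.
have [v [v0 vv fv]] := test_function dr kK (lexx 1 : 1 <= 1 :> R).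
rewrite !mulr1 (_ : 4 - 2 = 2 :> R) in fv; last by lra.
rewrite -energyE in fv.
set V := vol R d k in vv *; set S := res R d k in fv *; set G := level_green n.
have S1 : 1 <= S by exact: res_ge1.
have G0 : 0 <= G by exact: level_green_ge0.
have E : 1 = energy (heat_sum n) v + Ip (heat n) v.
  by rewrite energy_heat_sum v0 subrK.
have A : energy (heat_sum n) v ^+ 2 <= G * (2 * S)^-1.
  apply: (le_trans (cauchy_schwarz energy_lin energy_sym energy_ge0 _ _)).
  apply: ler_pM => //; [exact: energy_ge0|exact: energy_ge0|].
  by rewrite energy_heat_sum heat_sum_origin gerBl ip_heat_heat_sum_ge0.
have B : Ip (heat n) v ^+ 2 <= G / n%:R * V.
  apply: (le_trans (@cauchy_schwarz Ip _ _ _ _ _)).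
  - by move=> c a b z; exact: ip_lin.
  - by move=> a b; exact: ipC.
  - by move=> a; exact: ip_ge0.
  apply: ler_pM => //; [exact: ip_ge0|exact: ip_ge0|].
  rewrite ip_heat ler_pdivlMr // mulrC.
  by apply: heat_return_le_green; rewrite leq_addr.
have : 1 <= 2 * (energy (heat_sum n) v ^+ 2) + 2 * (Ip (heat n) v ^+ 2).
  have -> : Ip (heat n) v = 1 - energy (heat_sum n) v by rewrite {1}E; ring.
  by have := sqr_ge0 (2 * energy (heat_sum n) v - 1); lra.
rewrite invfM in A.
have -> : G * (S^-1 + 2 * V / n%:R) = 2 * (G * (2^-1 / S)) + 2 * (G / n%:R * V).
  by field; rewrite !gt_eqF //; lra.
by move: A B; lra.
Qed.

End Iterates.

Section GreenBounds.
Variables (R : realType) (B : nat).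
Implicit Types (d : degrees) (u : seq nat -> R).
Notation letter := (letter B).

Definition root_word d (f : rules B) (w : seq nat) : seq nat :=
  if w is x :: w' then rule_act f (d 0%N) x :: w' else [::].

Fixpoint prop_word d (f : rules B) (w : seq nat) : seq nat :=
  if w is x :: w' then
    x :: (if x == 0%N then prop_word else root_word) (sub_degrees d) f w'
  else [::].

Definition act_word d (l : letter) w := (if l.1 then root_word else prop_word) d l.2 w.

Lemma mkseq_pcons x (r : site) K : mkseq (pcons x r) K.+1 = x :: mkseq r K.
Proof. by rewrite /mkseq /= -(addn0 1%N) iotaDl -map_comp. Qed.

Lemma mkseq_act_root d f r K : mkseq (act_root d f r) K = root_word d f (mkseq r K).
Proof.
case: K => [//|K]; rewrite (pconsE r) act_root_pcons !mkseq_pcons.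
by [].
Qed.

Lemma mkseq_act d l r K : mkseq (act d l r) K = act_word d l (mkseq r K).
Proof.
case: l => -[] f; rewrite /act /act_word /=; first exact: mkseq_act_root.
elim: K d r => [//|K IH] d r; rewrite (pconsE r) act_prop_pcons !mkseq_pcons /=.
by case: (r 0%N == 0%N); rewrite ?IH ?mkseq_act_root.
Qed.

Fixpoint valid d (w : seq nat) : bool :=
  if w is x :: w' then (x < d 0%N)%N && valid (sub_degrees d) w' else true.

Lemma valid_root d f w : valid d w -> valid d (root_word d f w).
Proof. by case: w => [//|x w] /= /andP[xd ->]; rewrite rule_act_lt. Qed.

Lemma valid_act d l w : valid d w -> valid d (act_word d l w).
Proof.
case: l => -[] f; rewrite /act_word /=; first exact: valid_root.
elim: w d => [//|x w IH] d /= /andP[-> wv] /=.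
by case: (x == 0%N); [exact: IH|exact: valid_root].
Qed.

Definition bounded d := forall i, (1 < d i <= B)%N.

Lemma bounded_sub d : bounded d -> bounded (sub_degrees d).
Proof. by move=> db i; exact: db. Qed.

Lemma bounded_regular d : bounded d -> regular d.
Proof. by move=> db i; case/andP: (db i). Qed.

Lemma mean_root_word d u w : bounded d -> valid d w ->
  mean (fun f => u (root_word d f w)) = avgA d u w.
Proof.
case: w => [|x w] db /=; first by rewrite mean_cst ?card_rules_gt0.
case/andP => xd _; have /andP[_ dB] := db 0%N.
exact: (mean_rule_act (fun y => u (y :: w)) dB xd).
Qed.

Lemma mean_prop_word d u w : bounded d -> valid d w ->
  mean (fun f => u (prop_word d f w)) = avgB d u w.
Proof.
elim: w d u => [|x w IH] d u db /=; first by rewrite mean_cst ?card_rules_gt0.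
case/andP => _ wv; case: (x == 0%N).
  exact: (IH _ (fun w => u (x :: w)) (bounded_sub db) wv).
exact: (mean_root_word (fun w => u (x :: w)) (bounded_sub db) wv).
Qed.

Lemma mean_act_word d u w : bounded d -> valid d w ->
  mean (fun l => u (act_word d l w)) = avgP d u w.
Proof.
by move=> db wv; rewrite mean_pair mean_bool mean_root_word ?mean_prop_word.
Qed.

Lemma avg_act_word d u w n : bounded d -> valid d w ->
  avg n (fun t : seq letter => u (foldl (fun w l => act_word d l w) w t)) =
  iter n (avgP d) u w.
Proof.
move=> db; elim: n w => [//|n IH] w wv /=.
rewrite -mean_act_word //; apply: eq_mean => l.
by rewrite -IH ?valid_act.
Qed.

Lemma mkseq_actw d t r K :
  mkseq (actw d t r) K = foldl (fun w l => act_word d l w) (mkseq r K) t.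
Proof. by elim: t r => [//|l t IH] r /=; rewrite -mkseq_act -IH. Qed.

Lemma actw_finitary d (t : seq letter) j : (size t <= j)%N -> actw d t zero j = 0%N.
Proof.
have gen k r : (forall j, (k <= j)%N -> r j = 0%N) ->
    forall j, (k + size t <= j)%N -> actw d t r j = 0%N.
  elim: t k r => [|l t IH] k r r0 i /=; first by rewrite addn0; exact: r0.
  by rewrite -addSnnS; apply: IH => i' /(act_finitary d l r0).
by move=> tj; apply: (gen 0%N zero).
Qed.

Lemma mkseq_zero K : mkseq zero K = nseq K 0%N.
Proof.
apply: (@eq_from_nth _ 0%N); rewrite size_mkseq ?size_nseq // => i iK.
by rewrite nth_mkseq // nth_nseq iK.
Qed.

(** In n steps the walk started at the origin does not leave depth n, so that return
    probabilities can be computed on a finite level. *)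
Lemma return_prob_level d K n : bounded d -> (n <= K)%N ->
  return_prob B d R n = heat_return R d K n.
Proof.
move=> db nK; rewrite /heat_return /heat -(avg_act_word _ _ db); last first.
  elim: K d db {nK} => [//|K IH] d db /=; apply/andP; split.
    exact/ltnW/(bounded_regular db).
  exact/IH/bounded_sub.
apply: eq_avg => t tn; rewrite -mkseq_zero -mkseq_actw /origin.
congr (_%:R); congr nat_of_bool; apply/eqP/eqP => [->|E]; first exact: mkseq_zero.
apply/funext => i; have [iK|Ki] := ltnP i K; last by rewrite actw_finitary // tn (leq_trans nK).
by have := congr1 (fun w => nth 0%N w i) E; rewrite nth_mkseq // nth_nseq iK.
Qed.

Lemma green_level d K n : bounded d -> (n <= K)%N ->
  green B d R n = level_green R d K n.
Proof.
move=> db nK; apply: eq_bigr => k _; apply: return_prob_level => //.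
exact: leq_trans (ltnW (ltn_ord k)) nK.
Qed.

Lemma green_le d n k : bounded d -> (0 < n)%N ->
  green B d R n <= 2 * n%:R / vol R d k + 32 * res R d k.
Proof.
move=> db n0; rewrite (@green_level _ (n + k)) ?leq_addr //.
by apply: level_green_le; rewrite ?leq_addl //; exact: bounded_regular.
Qed.

Lemma green_ge d n k : bounded d -> (0 < n)%N ->
  1 <= green B d R n * ((res R d k)^-1 + 2 * vol R d k / n%:R).
Proof.
move=> db n0; rewrite (@green_level _ (n + k)) ?leq_addr //.
by apply: level_green_ge; rewrite ?leq_addl //; exact: bounded_regular.
Qed.

(** The last return probability is at most the average of the previous ones. *)
Lemma greenS_le d n : bounded d -> (0 < n)%N ->
  green B d R n.+1 <= 2 * green B d R n.
Proof.
move=> db n0; rewrite !(@green_level _ n.+1) ?leqnSn //; set K := n.+1.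
have dr := bounded_regular db; rewrite {1}/level_green big_ord_recr /=.
rewrite -/(level_green _ _ _ _) mulrDl mul1r lerD2l.
apply: (le_trans _ (heat_return_le_green R K dr (leqnn n))).
by rewrite ler_peMl ?heat_return_ge0 // ler1n.
Qed.

Lemma green_ge1 d n : (0 < n)%N -> 1 <= green B d R n.
Proof.
case: n => // n _; rewrite /green big_ord_recl {1}/return_prob /= eqxx lerDl.
by apply: sumr_ge0 => k _; exact: return_prob_ge0.
Qed.

End GreenBounds.

(** * Moments of the lamps *)

Section Lamps.
Variables (R : realType) (B : nat) (d : degrees).
Notation letter := (letter B).
Notation bits := (seq (bool * bool)).

Definition sgn (b : bool) : int := if b then 1 else -1.

(** The lamp of r, computed along the path of its token; the two signs of a step
    are used before and after the move. *)
Fixpoint lamp (t : seq letter) (b : bits) (r : site) : int :=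
  if (t, b) is (l :: t', c :: b') then
    sgn c.1 *+ (r == zero) + sgn c.2 *+ (act d l r == zero) + lamp t' b' (act d l r)
  else 0.

Definition lampR t b r : R := (lamp t b r)%:~R.

Fixpoint switches (t : seq letter) (r : site) : nat :=
  if t is l :: t' then
    (r == zero) + (act d l r == zero) + switches t' (act d l r) else 0.

(** A time at the origin contributes at most two switches, and only one if it is
    the initial time. *)
Lemma switches_hits t r : (switches t r + (r == zero) <= 2 * hits d t r)%N.
Proof.
elim: t r => [|l t IH] r /=; first by rewrite addn0; case: (r == zero).
by have := IH (act d l r); lia.
Qed.

Lemma lampR_cons l t (c : bool * bool) b r : lampR (l :: t) (c :: b) r =
  (sgn c.1)%:~R *+ (r == zero) + ((sgn c.2)%:~R *+ (act d l r == zero) + lampR t b (act d l r)).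
Proof. by rewrite /lampR /= !rmorphD !rmorphMn addrA. Qed.

Lemma mean_sgn1 (x : R) : mean (fun s => (((sgn s)%:~R + x) ^+ 2 : R)) = x ^+ 2 + 1.
Proof. by rewrite mean_bool /sgn /=; field. Qed.

Lemma mean_sgn2 (x : R) : mean (fun s => (((sgn s)%:~R + x) ^+ 4 : R)) = x ^+ 4 + 6 * x ^+ 2 + 1.
Proof. by rewrite mean_bool /sgn /=; field. Qed.

Let b_gt0 : (0 < #|{: bool}|)%N. Proof. by rewrite card_bool. Qed.
Let bb_gt0 : (0 < #|{: bool * bool}|)%N. Proof. by rewrite card_prod card_bool. Qed.

Lemma sum_flip (V : seq site) p k (x : site -> R) : uniq V -> p \in V ->
  mean (fun s => \sum_(r <- V) ((sgn s)%:~R *+ (r == p) + x r) ^+ k) =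
  \sum_(r <- V) x r ^+ k + (mean (fun s => ((sgn s)%:~R + x p) ^+ k) - x p ^+ k).
Proof.
move=> uV pV; rewrite mean_sum !(bigD1_seq p) //= eqxx addrC [RHS]addrC addrA subrK.
rewrite addrC; congr (_ + _); apply: eq_bigr => r /negPf rp.
by rewrite rp /= -[RHS](mean_cst b_gt0); apply: eq_mean => s; rewrite mulr0n add0r.
Qed.

Lemma sum_flip2 (V : seq site) p (x : site -> R) : uniq V -> p \in V ->
  mean (fun s => \sum_(r <- V) ((sgn s)%:~R *+ (r == p) + x r) ^+ 2) =
  \sum_(r <- V) x r ^+ 2 + 1.
Proof. by move=> uV pV; rewrite sum_flip // mean_sgn1; congr (_ + _); ring. Qed.

Lemma sum_flip4 (V : seq site) p (x : site -> R) : uniq V -> p \in V ->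
  mean (fun s => \sum_(r <- V) ((sgn s)%:~R *+ (r == p) + x r) ^+ 4) =
  \sum_(r <- V) x r ^+ 4 + (6 * x p ^+ 2 + 1).
Proof. by move=> uV pV; rewrite sum_flip // mean_sgn2; congr (_ + _); ring. Qed.

Lemma avg_lamp_sqr t r : avg (size t) (fun b => lampR t b r ^+ 2) = (switches t r)%:R.
Proof.
elim: t r => [|l t IH] r /=; first by rewrite /lampR expr0n.
rewrite -avg_mean.
have flip (e : bool) (y : R) :
    mean (fun s => ((sgn s)%:~R *+ e + y) ^+ 2) = y ^+ 2 + e%:R.
  case: e; first exact: mean_sgn1.
  rewrite -[RHS](mean_cst b_gt0); apply: eq_mean => s.
  by rewrite mulr0n add0r addr0.
transitivity (avg (size t) (fun b => lampR t b (act d l r) ^+ 2 +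
    ((act d l r == zero)%:R + (r == zero)%:R))).
  apply: eq_avg => b _; rewrite mean_pair.
  under eq_mean => c1 do under eq_mean => c2 do rewrite lampR_cons /=.
  rewrite mean_exchange.
  under eq_mean => c2 do rewrite flip.
  rewrite meanD mean_cst // flip; ring.
by rewrite avgD avg_cst // IH !natrD; ring.
Qed.

Lemma sum_lamp_sqr t (V : seq site) : uniq V -> (forall r, vis d t r -> r \in V) ->
  avg (size t) (fun b => \sum_(r <- V) lampR t b r ^+ 2) = (2 * size t)%:R.
Proof.
elim: t V => [|l t IH] V uV VP.
  by rewrite /= big1 // => r _; rewrite /lampR expr0n.
rewrite /= -avg_mean.
have uV' : uniq (map (act d l) V) by rewrite map_inj_uniq //; exact: act_inj.
have V'P r : vis d t r -> r \in map (act d l) V.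
  move=> tr; rewrite -(actKV d l r) map_f // VP //= actKV.
  by rewrite tr orbT.
have zV : zero \in V by rewrite VP ?vis0.
pose p := act d (letterV l) zero.
have actp r : (act d l r == zero) = (r == p).
  by rewrite /p -[X in _ == X](actKV d l) (inj_eq (@act_inj _ d l)).
have pV : p \in V by rewrite VP //= /p actKV vis0 orbT.
transitivity (avg (size t) (fun b => \sum_(r <- map (act d l) V) lampR t b r ^+ 2 + 2)).
  apply: eq_avg => b _; rewrite mean_pair mean_exchange.
  under eq_mean => c2.
    under eq_mean => c1 do under eq_bigr => r _ do rewrite lampR_cons /= actp.
    rewrite (sum_flip2 _ uV zV).
    over.
  rewrite meanD mean_cst // (sum_flip2 _ uV pV) big_map.
  by ring.
by rewrite avgD avg_cst // IH // mulnS addnC natrD.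
Qed.

(** A switch of a lamp in the state x adds 6 x^2 + 1 to its fourth power on
    average, and the mean of x^2 is the number of later switches of that lamp,
    which is at most twice its number of visits. *)
Fixpoint quartic (t : seq letter) : nat :=
  if t is l :: t' then 12 * hits d t' zero + 12 * hits d t zero + quartic t' else 0.

Lemma sum_lamp_quartic t (V : seq site) : uniq V -> (forall r, vis d t r -> r \in V) ->
  avg (size t) (fun b => \sum_(r <- V) lampR t b r ^+ 4) <= (quartic t)%:R.
Proof.
elim: t V => [|l t IH] V uV VP.
  by rewrite /= big1 // => r _; rewrite /lampR expr0n.
rewrite [avg _ _]/= -avg_mean.
have uV' : uniq (map (act d l) V) by rewrite map_inj_uniq //; exact: act_inj.
have V'P r : vis d t r -> r \in map (act d l) V.
  move=> tr; rewrite -(actKV d l r) map_f // VP //= actKV.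
  by rewrite tr orbT.
have zV : zero \in V by rewrite VP ?vis0.
pose p := act d (letterV l) zero.
have actp r : (act d l r == zero) = (r == p).
  by rewrite /p -[X in _ == X](actKV d l) (inj_eq (@act_inj _ d l)).
have pV : p \in V by rewrite VP //= /p actKV vis0 orbT.
pose q := act d l zero.
have -> : avg (size t) (fun b => mean (fun c =>
      \sum_(r <- V) lampR (l :: t) (c :: b) r ^+ 4)) =
    avg (size t) (fun b => \sum_(r <- map (act d l) V) lampR t b r ^+ 4 +
      (6 * lampR t b zero ^+ 2 + 6 * (lampR t b q ^+ 2 + (zero == p)%:R) + 2)).
  apply: eq_avg => b _; rewrite mean_pair mean_exchange.
  under eq_mean => c2.
    under eq_mean => c1 do under eq_bigr => r _ do rewrite lampR_cons /= actp.
    rewrite (sum_flip4 _ uV zV).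
    over.
  rewrite !meanD mean_cst // meanZ (sum_flip4 _ uV pV) big_map.
  have -> : mean (fun s => ((sgn s)%:~R *+ (zero == p) + lampR t b (act d l zero)) ^+ 2) =
      lampR t b q ^+ 2 + (zero == p)%:R :> R.
    case: (zero == p); first exact: mean_sgn1.
    rewrite -[RHS](mean_cst b_gt0); apply: eq_mean => s.
    by rewrite mulr0n add0r addr0.
  rewrite {1 2}/p actKV; ring.
rewrite !avgD !avgZ !avgD avg_cst // avg_cst // !avg_lamp_sqr.
have H0 := switches_hits t zero; have Hq := switches_hits t q.
have -> : (quartic (l :: t))%:R = (quartic t)%:R + (12 * hits d t zero + 12 * hits d (l :: t) zero)%:R :> R.
  by rewrite -natrD addnC.
apply: lerD; first exact: IH.
have -> : (zero == p) = (q == zero) by rewrite -actp.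
have : (6 * switches t zero + (6 * (switches t q + (q == zero)) + 2) <=
    12 * hits d t zero + 12 * hits d (l :: t) zero)%N.
  by move: H0 Hq; rewrite /= !eqxx -/q; lia.
by rewrite -(ler_nat R) !(natrD _ (_ * _)%N) !natrM (natrD _ (switches t q)); lra.
Qed.

Definition visits (t : seq letter) : seq site := undup (trace d t).

Lemma visits_uniq t : uniq (visits t). Proof. exact: undup_uniq. Qed.

Lemma mem_visits t r : (r \in visits t) = vis d t r.
Proof. by rewrite mem_undup mem_trace. Qed.

Lemma size_visits t : (size (visits t) <= nvis d t)%N.
Proof. by apply: size_vis_le_nvis (visits_uniq t) _ => r; rewrite mem_visits. Qed.

Definition lamp_mass (t : seq letter) (b : bits) : nat :=
  (\sum_(r <- visits t) `|lamp t b r|)%N.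

Lemma lamp_massE t b : (lamp_mass t b)%:R = \sum_(r <- visits t) `|lampR t b r|.
Proof.
rewrite natr_sum; apply: eq_bigr => r _.
by rewrite /lampR -intr_norm natr_absz.
Qed.

Let L_gt0 : (0 < #|{: letter}|)%N := card_letter_gt0 B.

Lemma avg_quartic n :
  avg n (fun t => (quartic t)%:R : R) <= 24 * n%:R * green B d R n.+1.
Proof.
elim: n => [|n IH]; first by rewrite /= mulr0 mul0r.
have -> : avg n.+1 (fun t => (quartic t)%:R : R) =
    12 * green B d R n.+1 + 12 * green B d R n.+2 + avg n (fun t => (quartic t)%:R).
  rewrite -!avg_hits -!avgZ -(avg_cons_drop L_gt0 n (fun t => 12 * (hits d t zero)%:R)).
  rewrite -(avg_cons_drop L_gt0 n (fun t => (quartic t)%:R)) -!avgD.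
  apply: eq_avg => -[//|l t] _ /=.
  by rewrite (natrD _ (_ + _)%N) (natrD _ (_ * _)%N) !natrM; ring.
have G1 : 0 <= green B d R n.+1 by apply: sumr_ge0 => k _; exact: return_prob_ge0.
have G12 : green B d R n.+1 <= green B d R n.+2 by exact: green_homo.
have G12n : n%:R * green B d R n.+1 <= n%:R * green B d R n.+2 by rewrite ler_wpM2l.
rewrite -(natr1 n); lra.
Qed.

(** Second against fourth moments: |x| >= x^2 / a - x^4 / a^3. *)
Lemma lamp_mass_ge n (g : R) : (0 < n)%N -> 0 < g -> green B d R n.+1 <= g ^+ 2 ->
  n%:R / (5 * g) <= avg n (fun t => avg n (fun b => (lamp_mass t b)%:R)).
Proof.
move=> n0 g0 Gg; pose a := 5 * g.
have a0 : 0 < a by rewrite mulr_gt0.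
have low x : x ^+ 2 / a - x ^+ 4 / a ^+ 3 <= `|x| :> R.
  set y := `|x| / a; have y0 : 0 <= y by rewrite divr_ge0 // ltW.
  have xE : `|x| = a * y by rewrite /y mulrCA divff ?mulr1 // gt_eqF.
  have -> : x ^+ 2 / a - x ^+ 4 / a ^+ 3 = a * (y ^+ 2 - y ^+ 4).
    rewrite -(real_normK (num_real x)) (_ : x ^+ 4 = (x ^+ 2) ^+ 2) -?exprM //.
    rewrite [x ^+ (2 * 2)]exprM -(real_normK (num_real x)) xE.
    by field; rewrite gt_eqF.
  rewrite xE ler_pM2l //; have [y1|y1] := leP y 1.
    have : y ^+ 2 <= y by rewrite expr2 ler_piMr.
    by have : 0 <= y ^+ 4 by [rewrite exprn_ge0]; lra.
  have : y ^+ 2 <= y ^+ 4 by rewrite ler_eXn2l.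
  by lra.
have avg_low : avg n (fun t => (2 * n)%:R / a - (quartic t)%:R / a ^+ 3) <=
    avg n (fun t => avg n (fun b => (lamp_mass t b)%:R)).
  apply: le_avg => t tn.
  have sE := sum_lamp_sqr (visits_uniq t) (fun r tr => etrans (mem_visits t r) tr).
  have qE := sum_lamp_quartic (visits_uniq t) (fun r tr => etrans (mem_visits t r) tr).
  rewrite tn in sE qE.
  apply: (@le_trans _ _ (avg n (fun b => (\sum_(r <- visits t) lampR t b r ^+ 2) / a -
      (\sum_(r <- visits t) lampR t b r ^+ 4) / a ^+ 3))).
    rewrite avg_sub !avgZr sE lerD2l lerN2.
    by rewrite ler_wpM2r // invr_ge0 exprn_ge0 // ltW.
  apply: le_avg => b _; rewrite lamp_massE !mulr_suml -sumrB.
  by apply: ler_sum => r _; exact: low.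
apply: le_trans avg_low; rewrite avg_sub avg_cst // avgZr.
have Q := avg_quartic n; set q := avg n _ in Q *.
have qg : q / a ^+ 3 <= 24 * n%:R * g ^+ 2 / a ^+ 3.
  rewrite ler_wpM2r ?invr_ge0 ?exprn_ge0 ?(ltW a0) //.
  by apply: (le_trans Q); rewrite ler_wpM2l // mulr_ge0.
have -> : n%:R / (5 * g) = (2 * n)%:R / a - 25 * n%:R * g ^+ 2 / a ^+ 3.
  by rewrite natrM /a; field; rewrite gt_eqF.
rewrite lerD2l lerN2; apply: (le_trans qg).
rewrite ler_wpM2r ?invr_ge0 ?exprn_ge0 ?(ltW a0) //.
rewrite ler_wpM2r ?exprn_ge0 ?(ltW g0) // ler_wpM2r //; lra.
Qed.

(** Here |x| <= (x^2 / g + g) / 2 for each visited lamp. *)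
Lemma lamp_mass_le n (g : R) : 0 < g ->
  avg n (fun t => avg n (fun b => (lamp_mass t b)%:R)) <=
  n%:R / g + g * mean_range B d R n / 2.
Proof.
move=> g0.
have -> : n%:R / g + g * mean_range B d R n / 2 =
    avg n (fun t : seq letter => (2 * n)%:R / (2 * g) + g / 2 * (nvis d t)%:R).
  rewrite avgD avgZ avg_cst // natrM /mean_range; field.
  by rewrite gt_eqF.
apply: le_avg => t tn.
have sE := sum_lamp_sqr (visits_uniq t) (fun r tr => etrans (mem_visits t r) tr).
rewrite tn in sE; rewrite -sE.
apply: (@le_trans _ _ (avg n (fun b => (\sum_(r <- visits t) lampR t b r ^+ 2) / (2 * g)
    + g / 2 * (size (visits t))%:R))).
  apply: le_avg => b _; rewrite lamp_massE mulr_suml.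
  have -> : g / 2 * (size (visits t))%:R = \sum_(r <- visits t) g / 2.
    by rewrite big_const_seq count_predT iter_addr_0 mulr_natr.
  rewrite -big_split /=; apply: ler_sum => r _.
  rewrite -(real_normK (num_real (lampR t b r))); set x := `|_|.
  have -> : x ^+ 2 / (2 * g) + g / 2 = x + (x - g) ^+ 2 / (2 * g).
    by field; rewrite gt_eqF.
  by rewrite lerDl divr_ge0 ?sqr_ge0 // mulr_ge0 // ltW.
rewrite avgD avgZr avg_cst //.
by rewrite lerD2l ler_pM2l ?divr_gt0 // ler_nat size_visits.
Qed.

End Lamps.

(** * Short words visiting prescribed tokens *)

Section ShortWords.
Variables (R : realType) (B : nat) (d : degrees).
Notation letter := (letter B).
Notation bits := (seq (bool * bool)).

(** The lamps are in Z/2, and the second component records where the tokens are. *)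
Definition state := ((site -> bool) * (site -> site))%type.
Definition lstep := (letter * (bool * bool))%type.

Definition add_step (x : state) (i : lstep) : state :=
  (fun r => x.1 r (+) (i.2.1 && (x.2 r == zero)) (+) (i.2.2 && (act d i.1 (x.2 r) == zero)),
   fun r => act d i.1 (x.2 r)).

Definition state0 : state := (fun=> false, id).

Definition stepV (i : lstep) : lstep := (letterV i.1, (i.2.2, i.2.1)).

Lemma stepVK : involutive stepV.
Proof. by case=> l [b1 b2]; rewrite /stepV /= letterVK. Qed.

Lemma add_stepK x i : add_step (add_step x i) (stepV i) = x.
Proof.
case: x i => A g [l [b1 b2]]; congr pair; apply/funext => r /=; rewrite actK //.
by case: (A r); case: (b1 && _); case: (b2 && _).
Qed.

Fixpoint lamp2 (t : seq letter) (b : bits) (r : site) : bool :=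
  if (t, b) is (l :: t', c :: b') then
    (c.1 && (r == zero)) (+) (c.2 && (act d l r == zero)) (+) lamp2 t' b' (act d l r)
  else false.

Lemma foldl_add_step t b x : size b = size t ->
  foldl add_step x (zip t b) = (fun r => x.1 r (+) lamp2 t b (x.2 r), fun r => actw d t (x.2 r)).
Proof.
elim: t b x => [|l t IH] [|c b] x //=; first by case: x => A g _; congr pair; apply/funext => r; rewrite addbF.
by move=> [bt]; rewrite IH //; congr pair; apply/funext => r /=; rewrite !addbA.
Qed.

Lemma foldl_state0 t b : size b = size t ->
  foldl add_step state0 (zip t b) = (lamp2 t b, actw d t).
Proof. by move=> bt; rewrite foldl_add_step. Qed.

Lemma lamp2_vis t b r : lamp2 t b r -> vis d t r.
Proof.
elim: t b r => [//|l t IH] [//|c b] r /=.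
case: (r == zero) => //=; rewrite andbF addFb.
case E : (act d l r == zero); last by rewrite andbF addFb => /IH.
by rewrite (eqP E) vis0.
Qed.

(** ** A 1-Lipschitz length *)

Definition covers (x : state) (u : seq letter) : Prop :=
  actw d u = x.2 /\ forall r, x.1 r -> vis d u r.

Definition short (x : state) (k : nat) : Prop := exists2 u, size u = k & covers x u.

Definition cover_len (x : state) : nat :=
  if pselect (exists k, `[< short x k >]) is left ex then ex_minn ex else 0.

Lemma cover_len_le x u : covers x u -> (cover_len x <= size u)%N.
Proof.
move=> xu; rewrite /cover_len; case: pselect => // ex; case: ex_minnP => k _; apply.
by apply/asboolP; exists u.
Qed.

Lemma cover_lenP x u : covers x u -> exists2 v, size v = cover_len x & covers x v.
Proof.
move=> xu; rewrite /cover_len; case: pselect => [ex|[]]; last first.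
  by exists (size u); apply/asboolP; exists u.
by case: ex_minnP => k /asboolP[v vk xv] _; exists v.
Qed.

Lemma covers_run s : covers (foldl add_step state0 s) (unzip1 s).
Proof.
have -> : s = zip (unzip1 s) (unzip2 s) by rewrite zip_unzip.
rewrite foldl_state0 ?size_map // unzip1_zip ?size_map //.
by split=> // r; exact: lamp2_vis.
Qed.

Lemma covers_step x u i : covers x u -> covers (add_step x i) (rcons u i.1).
Proof.
case=> ux xv; split; first by apply/funext => r; rewrite actw_rcons ux.
move=> r; rewrite -cats1 vis_cat ux /=.
case: (x.1 r) (xv r) => [->//|_] /=.
by case: (x.2 r == zero); case: (act d _ _ == zero); rewrite ?orbT // !andbF.
Qed.

Lemma cover_len_lip s i :
  `|(cover_len (add_step (foldl add_step state0 s) i))%:R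
    - (cover_len (foldl add_step state0 s))%:R| <= 1 :> R.
Proof.
set x := foldl _ _ _; have xu := covers_run s; rewrite -/x in xu.
have [v vx xv] := cover_lenP xu; have [w wy yw] := cover_lenP (covers_step i xu).
have H1 := cover_len_le (covers_step i xv).
have H2 := cover_len_le (covers_step (stepV i) yw); rewrite add_stepK in H2.
rewrite !size_rcons vx in H1; rewrite !size_rcons wy in H2.
rewrite ler_norml; move: H1 H2; rewrite -!(ler_nat R) -!natr1; lra.
Qed.

(** ** Entropy of the lamplighter with lamps in Z/2 *)

(** The two switches are carried by propagating letters with the trivial rule,
    which move no token. *)
Definition mark1 (i : lstep) : seq (mletter B) :=
  [:: (rule1 B, Some i.2.1); (i.1.2, if i.1.1 then None else Some false);
      (rule1 B, Some i.2.2)].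

Definition mark (s : seq lstep) := flatten (map mark1 s).

Lemma mark_val s : mval d (mark s) = foldl add_step state0 s.
Proof.
have -> : s = zip (unzip1 s) (unzip2 s) by rewrite zip_unzip.
rewrite foldl_state0 ?size_map //; congr pair; apply/funext => r.
  elim: s r => [//|[[b f] [b1 b2]] s IH] r; rewrite /mark /= -/(mark s) /mact1 /=.
  rewrite !act_prop1 -IH /act /=.
  by case: b => /=; rewrite -?addbA ?addFb.
elim: s r => [//|[[b f] [b1 b2]] s IH] r; rewrite /mark /= -/(mark s) /mact1 /=.
by rewrite !act_prop1 -IH /act /=; case: b.
Qed.

Lemma mark_vis s r : mvis d (mark s) r -> vis d (unzip1 s) r.
Proof.
elim: s r => [//|[[b f] [b1 b2]] s IH] r; rewrite /mark /= -/(mark s) /mact1 /=.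
rewrite !act_prop1 /act /=; case: (r == zero) => //=; rewrite andbF /=.
case: b => /=; case/orP => [/eqP->|/IH//]; exact: vis0.
Qed.

Lemma nvisited_mark s : (nvisited d (mark s) <= nvis d (unzip1 s))%N.
Proof.
apply: size_vis_le_nvis; first exact: undup_uniq.
by move=> r; rewrite mem_undup mem_visited => /mark_vis.
Qed.

Hypothesis db : bounded B d.

Let L_gt0 : (0 < #|{: letter}|)%N := card_letter_gt0 B.
Let bb_gt0 : (0 < #|{: bool * bool}|)%N. Proof. by rewrite card_prod card_bool. Qed.
Let I_gt0 : (0 < #|{: lstep}|)%N.
Proof. by rewrite card_prod muln_gt0 L_gt0 bb_gt0. Qed.

Definition entropy_cst : R := 1 + ln (2 * #|{: alphabet B}|)%N%:R * (B + 3)%:R.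

Lemma mean_range_ge1 n : 1 <= mean_range B d R n.
Proof.
rewrite -[leLHS](avg_cst L_gt0 n); apply: le_avg => t _.
by rewrite ler1n nvis_ge1.
Qed.

Lemma entropy_le_range n :
  entropy R add_step state0 n <= entropy_cst * mean_range B d R n.
Proof.
have A_gt0 : (0 < #|{: alphabet B}|)%N.
  by apply/card_gt0P; exists (inr (inl (rule1 B))).
have A1 : 1 <= (2 * #|{: alphabet B}|)%N%:R :> R by rewrite ler1n muln_gt0.
pose k (s : seq lstep) : R := (B + 2)%:R * (nvis d (unzip1 s))%:R + 1.
have := @entropy_le_code R lstep (alphabet B) state add_step state0 _ I_gt0 A_gt0 n k.
move/(_ (fun c => if GenTree.decode (map (fun a : alphabet B =>
    match a with inl k => inl (val k) | inr l => inr l end) c)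
  is Some t then decode t d else (fun=> false, id))) => H.
apply: le_trans (H _) _ => {H} [s _|].
  have [c cE cs] := mval_code (mark s) db.
  exists c; first by rewrite cE mark_val.
  rewrite /k -natrM natr1 ler_nat (leq_trans cs) // addn1 ltnS leq_mul2l.
  by rewrite nvisited_mark orbT.
have -> : avg n k = (B + 2)%:R * mean_range B d R n + 1.
  rewrite /k avgD avg_cst // avgZ; congr (_ * _ + _).
  rewrite avg_zip /mean_range; apply: eq_avg => t tn.
  rewrite -[RHS](avg_cst bb_gt0 n); apply: eq_avg => b bn.
  by rewrite unzip1_zip // tn bn.
have r1 := mean_range_ge1 n; set r := mean_range _ _ _ _ in r1 *.
have ln0 := ln_ge0 A1; set L := ln _ in ln0 *.
rewrite /entropy_cst -/L mulrDl mul1r -mulrA; apply: lerD => //.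
rewrite ler_wpM2l // !natrD; lra.
Qed.

(** ** Covering all visited tokens *)

Definition add_bits (b c : bits) : bits :=
  [seq (p.1.1 (+) p.2.1, p.1.2 (+) p.2.2) | p <- zip b c].

Lemma lamp2_add t b c r : size b = size t -> size c = size t ->
  lamp2 t (add_bits b c) r = lamp2 t b r (+) lamp2 t c r.
Proof.
elim: t b c r => [//|l t IH] [//|[b1 b2] b] [//|[c1 c2] c] r /= [bt] [ct].
rewrite /add_bits /= -/(add_bits b c) IH //.
by case: (r == zero); case: (act d l r == zero); case: b1; case: b2; case: c1; case: c2;
   case: (lamp2 t b _); case: (lamp2 t c _).
Qed.

Lemma avg_add_bits n (F : bits -> R) c : size c = n ->
  avg n (fun b => F (add_bits b c)) = avg n F.
Proof.
elim: n F c => [|n IH] F [//|[c1 c2] c]; first by [].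
move=> [cn] /=; pose h (p : bool * bool) := (p.1 (+) c1, p.2 (+) c2).
have hI : injective h.
  by move=> [a b] [a' b'] [] /addIb-> /addIb->.
rewrite -(mean_reindex (fun x => avg n (fun s => F (x :: s))) hI); apply: eq_mean => p /=.
by rewrite -(IH (fun s => F (h p :: s)) c cn).
Qed.

(** The lamp of each visited token is switched at its last visit, and only then. *)
Lemma full_bits l t : exists2 c, size c = size (l :: t) & lamp2 (l :: t) c =1 vis d (l :: t).
Proof.
have vE (s : seq letter) k r : vis d (k :: s) r =
    (~~ vis d s (act d k zero) && (r == zero)) (+) vis d s (act d k r).
  by rewrite /=; case: eqP => [->|_] /=; rewrite ?andbF // andbT; case: (vis _ _ _).
elim: t l => [|k t IH] l.
  exists [:: (~~ vis d ([::] : seq letter) (act d l zero), true)] => // r.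
  by rewrite vE /= !orbF addbF.
have [c cs cE] := IH k; exists ((~~ vis d (k :: t) (act d l zero), false) :: c).
  by rewrite /= cs.
by move=> r; rewrite [RHS]vE -[LHS]/((_ && _) (+) false (+) lamp2 (k :: t) c _) cE addbF.
Qed.

Definition full (t : seq letter) : state := (vis d t, actw d t).

Lemma covers_full t : covers (full t) t. Proof. by []. Qed.

(** Each visited token is lit by exactly one of the bits b and b + c. Following a
    short word for b, its inverse, and a short word for b + c reaches them all. *)
Lemma cover_full_le t b c : size b = size t -> size c = size t ->
  lamp2 t c =1 vis d t ->
  (cover_len (full t) <= 2 * cover_len (lamp2 t b, actw d t)
     + cover_len (lamp2 t (add_bits b c), actw d t))%N.
Proof.
move=> bt ct cE.
have cov b' : covers (lamp2 t b', actw d t) t by split=> // r; exact: lamp2_vis.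
have [u us [uE uv]] := cover_lenP (cov b).
have [v vs [vE vv]] := cover_lenP (cov (add_bits b c)).
rewrite -us -vs; apply: leq_trans (cover_len_le _ : _ <= size (u ++ wordV u ++ v))%N _.
  split=> [|r /= tr].
    by apply/funext => r; rewrite !actw_cat actwK vE.
  rewrite !vis_cat actwK; case ur : (lamp2 t b r); first by rewrite uv.
  by rewrite vv ?orbT //= lamp2_add // ur cE.
by rewrite !size_cat /wordV size_rev size_map addnA mul2n addnn.
Qed.

(** Uniform bits b and b + c have the same law. *)
Lemma avg_cover_full n : (0 < n)%N ->
  avg n (fun t => (cover_len (full t))%:R : R) <=
  3 * avg n (fun s => (cover_len (foldl add_step state0 s))%:R).
Proof.
move=> n0; rewrite [X in _ * X]avg_zip -avgZ; apply: le_avg => t tn.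
have [c ct cE] : exists2 c, size c = size t & lamp2 t c =1 vis d t.
  by case: t tn => [|l t] tn; [rewrite -tn in n0|exact: full_bits].
pose F b : R := (cover_len (lamp2 t b, actw d t))%:R.
have -> : avg n (fun b => (cover_len (foldl add_step state0 (zip t b)))%:R : R) = avg n F.
  by apply: eq_avg => b bn; rewrite foldl_state0 // tn.
have -> : 3 * avg n F = avg n (fun b => 2 * F b + F (add_bits b c)).
  by rewrite avgD avgZ avg_add_bits ?ct //; ring.
rewrite -[leLHS](avg_cst bb_gt0 n); apply: le_avg => b bn.
by rewrite /F -natrM -natrD ler_nat; apply: cover_full_le => //; rewrite tn.
Qed.

Lemma avg_cover_le n g : (0 < n)%N -> 0 < g ->
  avg n (fun t => (cover_len (full t))%:R : R) <=
  3 + 3 / 2 * (g * entropy_cst * mean_range B d R n + n%:R / g).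
Proof.
move=> n0 g0; apply: le_trans (avg_cover_full n0) _.
have := speed_le_entropy I_gt0 stepVK add_stepK (h := fun x => (cover_len x)%:R : R)
  cover_len_lip n g0.
have -> : cover_len state0 = 0%N.
  by apply/eqP; rewrite -leqn0; apply: (@cover_len_le state0 [::]).
have : g * entropy R add_step state0 n <= g * entropy_cst * mean_range B d R n.
  by rewrite -mulrA ler_pM2l // entropy_le_range.
rewrite -[avg n ((fun x => (cover_len x)%:R) \o _)]/(avg n
  (fun s => (cover_len (foldl add_step state0 s))%:R)).
by set x := avg _ _; set y := entropy _ _ _ _; lra.
Qed.

End ShortWords.

(** * Finitely supported measures as images of uniform measures *)

Section FiniteLaws.
Variables (R : realType) (I : finType).
Hypothesis I_gt0 : (0 < #|I|)%N.

Definition image_law (T : choiceType) (psi : I -> T) (t : T) : R :=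
  mean (fun i => (psi i == t)%:R).

Lemma fsum_image_law (T : choiceType) (psi : I -> T) (D : set T) (g : T -> R) :
  \sum_(t \in D) image_law psi t * g t =
  mean (fun i => if psi i \in D then g (psi i) else 0).
Proof.
rewrite fsbig_mkcond; set A := [fset x in [seq psi i | i <- enum I]]%fset.
have AP i : psi i \in A by rewrite !inE; apply: map_f; rewrite mem_enum.
rewrite (fsbigTE A) => [|t tA]; last first.
  rewrite patchE; case: ifP => // _; rewrite /image_law /mean big1 ?mul0r // => i _.
  by case: eqP => // it; move: tA; rewrite -it AP.
transitivity (mean (fun i => \sum_(t <- A)
    (psi i == t)%:R * (if t \in D then g t else 0))).
  rewrite mean_sum; apply: eq_bigr => t _; rewrite patchE.
  case: ifP => _; first by rewrite /image_law mulrC -meanZ; apply: eq_mean => i; rewrite mulrC.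
  rewrite /mean big1 ?mul0r // => i _; exact: mulr0.
apply: eq_mean => i; rewrite (bigD1_seq (psi i)) //= ?fset_uniq // eqxx mul1r.
rewrite big1 ?addr0 // => t /eqP ti; case: eqP => [E|]; last by rewrite mul0r.
by case: ti; rewrite E.
Qed.

Lemma expectation_image_law (T : choiceType) (psi : I -> T) (g : T -> R) p :
  p =1 image_law psi -> Defs.expectation p g = mean (g \o psi).
Proof.
move=> pE; rewrite /Defs.expectation.
transitivity (\sum_(t \in [set: T]) image_law psi t * g t).
  by apply: eq_fsbigr => t _; rewrite pE.
by rewrite fsum_image_law; apply: eq_mean => i; rewrite in_setT.
Qed.

Lemma law_image_law (T U : choiceType) (psi : I -> T) (X : T -> U) p :
  p =1 image_law psi -> law p X =1 image_law (X \o psi).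
Proof.
move=> pE y; rewrite /law.
transitivity (\sum_(t \in X @^-1` [set y]) image_law psi t * 1).
  by apply: eq_fsbigr => t _; rewrite pE mulr1.
rewrite fsum_image_law; apply: eq_mean => i /=.
case: (X (psi i) =P y) => E.
  by rewrite mem_set.
by rewrite memNset.
Qed.

Lemma image_law_neq0 (T : choiceType) (psi : I -> T) t :
  image_law psi t != 0 <-> exists i, psi i = t.
Proof.
split=> [|[i <-]].
  apply: contra_neqP => /forallNP ne; rewrite /image_law /mean big1 ?mul0r // => i _.
  by case: eqP => // E; case: (ne i).
rewrite gt_eqF // -(@pmulr_rgt0 _ #|I|%:R) ?ltr0n // (lt_le_trans ltr01) //.
have := @le_mean_term R I I_gt0 (fun j => (psi j == psi i)%:R) i.
by rewrite eqxx; apply=> j; exact: ler0n.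
Qed.

Lemma iid_image_law (T : choiceType) (psi : I -> T) p n (t : n.-tuple T) :
  p =1 image_law psi ->
  iid p t = mean (fun s : n.-tuple I => (map psi s == t :> seq T)%:R).
Proof.
move=> pE; rewrite /iid -(avg_tuple n (fun s => (map psi s == t)%:R : R)).
case: t => t /= /eqP.
elim: t n => [|x t IH] [|n] //=; first by rewrite big_nil.
case=> tn; rewrite big_cons (IH n) // pE /image_law.
transitivity (mean (fun i => (psi i == x)%:R * avg n (fun s => (map psi s == t)%:R)) : R).
  by rewrite mulrC -meanZ; apply: eq_mean => i; rewrite mulrC.
apply: eq_mean => i; rewrite -avgZ; apply: eq_avg => s _.
by rewrite /= eqseq_cons -natrM mulnb.
Qed.

End FiniteLaws.

Lemma expectation_iid (R : realType) (I : finType) (T : choiceType) (psi : I -> T)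
    p n (F : seq T -> R) :
  p =1 image_law R psi ->
  Defs.expectation (@iid R T p n) (fun t => F t) = avg n (fun s => F (map psi s)).
Proof.
move=> pE; rewrite avg_tuple.
rewrite (@expectation_image_law R _ _ (map_tuple psi) (fun t : n.-tuple T => F t)) //.
by move=> t; rewrite (iid_image_law _ pE).
Qed.

(** A map with fibres of equal size pushes the uniform measure to the uniform
    measure on its image; here the fibres are permuted by bijections. *)
Lemma uniform_image (R : realType) (F : finType) (T : choiceType) (phi : F -> T) (A : set T) :
  A = range phi ->
  (forall f f', exists2 h : F -> F, injective h &
     forall g, (phi (h g) == phi f') = (phi g == phi f)) ->
  uniform R A =1 image_law R phi.
Proof.
move=> AE fib x; rewrite /uniform /image_law.
case: (boolP (x \in A)) => [xA|xA]; last first.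
  rewrite /mean big1 ?mul0r // => f _; case: eqP => // E.
  by move: xA; rewrite AE -E mem_set //; exists f.
have finA : finite_set A by rewrite AE; apply: finite_image; exact: finite_finset.
pose S := fset_set A; pose n y : R := \sum_f (phi f == y)%:R.
have nE y : y \in S -> n y = n x.
  rewrite in_fset_set //; move: xA; rewrite AE => /set_mem[f' _ <-] /set_mem[f _ <-].
  have [h hI hP] := fib f f'; rewrite /n [RHS](reindex_inj hI).
  by apply: eq_bigr => g _; rewrite hP.
have xS : x \in S by rewrite in_fset_set.
have cardF : #|F|%:R = #|` S|%:R * n x.
  transitivity (\sum_(y <- S) n y); last first.
    rewrite big_seq (eq_bigr (fun=> n x)) => [|y yS]; last exact: nE.
    by rewrite -big_seq big_const_seq count_predT iter_addr_0 mulr_natl.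
  rewrite exchange_big -sum1_card natr_sum; apply: eq_bigr => f _.
  have fS : phi f \in S by rewrite in_fset_set // AE mem_set //; exists f.
  rewrite (bigD1_seq (phi f)) ?fset_uniq //= eqxx big1 ?addr0 // => y /eqP yf.
  by case: eqP => // E; case: yf.
have S0 : #|` S|%:R != 0 :> R by rewrite pnatr_eq0 cardfs_eq0; apply/fset0Pn; exists x.
rewrite /mean -/(n x) cardF; have n0 : n x != 0.
  have : (0 < #|F|)%N.
    by move: xA; rewrite AE => /set_mem[f _ _]; apply/card_gt0P; exists f.
  rewrite lt0n -(@pnatr_eq0 R) cardF mulf_eq0 negb_or => /andP[]//.
by rewrite invfM mulrCA divff // mulr1.
Qed.

(** * The mother group acting on rays *)

Section MotherGroup.
Variables (B : nat) (m : branching).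
Hypothesis mB : forall i, (m i <= B)%N.
Notation letter := (letter B).

Definition deg i : 'I_B.+1 := Ordinal (mB i : (m i < B.+1)%N).

Definition perms_of (f : rules B) : perms m := fun i => f (deg i) : 'S_(m i).

Lemma perms_ofE f i y : letter_act (perms_of f i) y = rule_act f (m i) y.
Proof.
rewrite /rule_act; case: insubP => [c _ cE|]; last by rewrite ltnS mB.
by have -> : c = deg i by exact: val_inj.
Qed.

Lemma rules_castE (f : rules B) (c c' : 'I_B.+1) (e : c = c' :> nat) :
  cast_perm e (f c) = f c'.
Proof.
have E : c = c' by exact: val_inj.
by subst c'; rewrite (eq_irrelevance e (erefl (val c))) cast_perm_id.
Qed.

Lemma value_dependent_perms_of f : value_dependent (perms_of f).
Proof. by move=> i j e; exact: (@rules_castE f (deg i) (deg j) e). Qed.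

Lemma value_dependentE (s : perms m) : value_dependent s -> exists f, s = perms_of f.
Proof.
move=> sv; pose t (c : 'I_B.+1) : 'S_c := if pselect (exists i, m i = c) is left ic
  then cast_perm (projT2 (cid ic)) (s (projT1 (cid ic))) else 1%g.
exists (finfun t); apply: functional_extensionality_dep => i.
rewrite /perms_of ffunE /t; case: pselect => [ic|[]]; last by exists i.
case: (cid ic) => j e /=; rewrite -(sv j i e); congr cast_perm.
exact: eq_irrelevance.
Qed.

Lemma rootedE (s : 'S_(m 0)) : exists f, s = perms_of f 0.
Proof.
pose t (c : 'I_B.+1) : 'S_c :=
  if pselect (m 0 = c) is left e then cast_perm e s else 1%g.
exists (finfun t); rewrite /perms_of ffunE /t; case: pselect => // e.
by rewrite (eq_irrelevance e (erefl (m 0))) cast_perm_id.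
Qed.

Definition letter_aut (l : letter) : Defs.aut m :=
  if l.1 then rooted (perms_of l.2 0) else propagating (perms_of l.2).

Lemma letter_aut_mother l : letter_aut l \in mother_set m.
Proof.
apply/mem_set => K [_]; apply; case: l => -[] f; [right|left].
  by exists (perms_of f 0).
by exists (perms_of f) => //; exact: value_dependent_perms_of.
Qed.

Definition letter_mother l : mother m := exist _ (letter_aut l) (letter_aut_mother l).

(** ** Rays as sites *)

Definition ray_site (r : ray m) : site := fun i => r i : nat.

Lemma propagating_rawE (f : rules B) : forall (m' : branching) (s : perms m') v,
  (forall i y, letter_act (s i) y = rule_act f (m' i) y) ->
  propagating_raw s v = prop_word m' f v.
Proof.
move=> m' s v; elim: v m' s => [//|x v IH] m' s sf /=.
case: (x == 0%N); first by rewrite (IH (Defs.shift m') (shift_perms s)) // => i y; exact: sf.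
by case: v {IH} => [//|y v] /=; rewrite sf.
Qed.

Lemma word_act1 (m' : branching) v : word_act (1%g : Defs.aut m') v = v.
Proof. by rewrite /word_act; case: insubP => // u _ <-. Qed.

Lemma letter_autE l (v : vertex m) : val (letter_aut l v) = act_word m l (val v).
Proof.
case: l => -[] f; rewrite /letter_aut /act_word /=; last first.
  by apply: propagating_rawE => i y; exact: perms_ofE.
case: v => -[//|x v] /= /andP[xm _]; rewrite insubT /= word_act1; congr (_ :: _).
by rewrite -perms_ofE -[x in RHS]/(val (Ordinal xm)) letter_actE.
Qed.

Lemma ray_act_letter l (r : ray m) :
  ray_site (ray_act r (letter_aut l)) = act m l (ray_site r).
Proof.
apply/funext => i; rewrite /ray_site /= letter_autE /=.
by rewrite -[mkseq _ _]/(mkseq (ray_site r) i.+1) -mkseq_act nth_mkseq.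
Qed.

Lemma mother_act_word (w : finitary_ray m) (t : seq letter) :
  ray_site (sval (mother_act w (\prod_(l <- t) letter_mother l)%g)) =
  actw m t (ray_site (sval w)).
Proof.
elim: t w => [|l t IH] w.
  by rewrite big_nil /= ray_act1.
rewrite big_cons -[LHS]/(ray_site (ray_act (sval w)
  (letter_aut l * val (\prod_(j <- t) letter_mother j)%g)%g)) ray_actM.
have := IH (mother_act w (letter_mother l)); rewrite /= => ->.
by rewrite ray_act_letter.
Qed.

Lemma ray_site_inj (w w' : finitary_ray m) :
  ray_site (sval w) = ray_site (sval w') -> w = w'.
Proof.
case: w w' => [w wf] [w' w'f] /= E; apply: eq_exist.
apply: functional_extensionality_dep => i; apply: val_inj.
exact: (congr1 (fun r => r i) E).
Qed.

(** Each vertex is a prefix of a finitary ray. *)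
Lemma mother_eq (g h : mother m) :
  (forall w : finitary_ray m, mother_act w g = mother_act w h) -> g = h.
Proof.
move=> gh; apply: val_inj; apply: aut_eqP => v.
have vP : forall i, (nth 0 (val v) i < m i)%N.
  move=> i; have [iv|vi] := ltnP i (size (val v)).
    by have /is_wordP := valP v; apply.
  by rewrite nth_default // degree_gt0.
pose w : ray m := fun i => Ordinal (vP i).
have wf : finitary w.
  by exists (size (val v)) => i vi /=; rewrite nth_default.
have -> : v = Defs.prefix w (size (val v)).
  apply: val_inj; rewrite /= -[LHS](mkseq_nth 0%N).
  by [].
rewrite -!prefix_ray_act; congr Defs.prefix.
exact: (congr1 sval (gh (exist _ w wf))).
Qed.

Lemma word_mother_eq (t u : seq letter) : actw m t = actw m u ->
  (\prod_(l <- t) letter_mother l = \prod_(l <- u) letter_mother l)%g.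
Proof.
move=> tu; apply: mother_eq => w; apply: ray_site_inj.
by rewrite !mother_act_word tu.
Qed.

Lemma letter_motherM b f g :
  letter_mother (b, ruleM f g) = (letter_mother (b, f) * letter_mother (b, g))%g.
Proof.
have := @word_mother_eq [:: (b, ruleM f g)] [:: (b, f); (b, g)].
rewrite !big_cons !big_nil !mulg1; apply; apply/funext => r /=.
by case: b; rewrite /act /= ?act_rootM ?act_propM.
Qed.

(** Only finitary rays are brought to the origin, so lamps may be indexed by all
    sites. *)
Lemma vis_ray (t : seq letter) r : vis m t r -> exists w : finitary_ray m, ray_site (sval w) = r.
Proof.
elim: t r => [|l t IH] r /=.
  by rewrite orbF => /eqP->; exists (zero_ray m).
case/orP => [/eqP->|/IH[w wE]]; first by exists (zero_ray m).
exists (mother_act w (letter_mother (letterV l))).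
by rewrite /= ray_act_letter wE actK.
Qed.

Lemma zero_rayE (w : finitary_ray m) :
  (w = zero_ray m) <-> (ray_site (sval w) == zero).
Proof. by split=> [->|/eqP E]; [apply/eqP|exact: ray_site_inj]. Qed.

(** ** Laws of the steps *)

Variable R : realType.

Lemma uniform_letters b (A : set (mother m)) :
  A = [set letter_mother (b, f) | f in [set: rules B]]%classic ->
  uniform R A =1 image_law R (fun f => letter_mother (b, f)).
Proof.
move=> AE; apply: uniform_image => // f f'.
have [k ->] : exists k, f' = ruleM f k.
  by exists (ruleM (ruleV f) f'); apply/ffunP => c; rewrite !ffunE mulKVg.
exists (fun g => ruleM g k) => [|g]; first exact: ruleM_injr.
by rewrite !letter_motherM; apply/eqP/eqP => [/mulIg|->].
Qed.

Lemma mother_massE : @mother_mass R m =1 image_law R letter_mother.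
Proof.
move=> g; rewrite /mother_mass /mixture.
rewrite (@uniform_letters true); last first.
  apply/seteqP; split=> [h [s _ sE]|_ [f _ <-]].
    have [f fE] := rootedE s; exists f => //; apply: val_inj.
    by rewrite -sE /= fE.
  by exists (perms_of f 0).
rewrite (@uniform_letters false); last first.
  apply/seteqP; split=> [h [s sv sE]|_ [f _ <-]].
    have [f fE] := value_dependentE sv; exists f => //; apply: val_inj.
    by rewrite -sE /= fE.
  by exists (perms_of f) => //; exact: value_dependent_perms_of.
by rewrite /image_law mean_pair mean_bool mulrDl.
Qed.

Lemma sign_massE : sign_mass R =1 image_law R sgn.
Proof.
apply: uniform_image.
  apply/seteqP; split=> [x|_ [b _ <-]].
    by case=> ->; [exists true|exists false].
  by case: b; [left|right].
move=> b b'; exists (fun c => c (+) (b (+) b')) => [c c'|c]; first by move/addIb.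
by case: b; case: b'; case: c.
Qed.

Local Notation Z := (Algebra.to_multiplicative int).
Definition sample (i : lstep B) : Z * mother m * Z :=
  (sgn i.2.1 : Z, letter_mother i.1, sgn i.2.2 : Z).

Lemma step_massE :
  step_mass (L := Z) (sign_mass R) (@mother_mass R m) =1 image_law R sample.
Proof.
have mean_prod (T U : finType) (F : T -> R) (G : U -> R) :
    mean F * mean G = mean (fun x => mean (fun y => F x * G y)).
  by rewrite mulrC -meanZ; apply: eq_mean => x; rewrite meanZ mulrC.
move=> [[a g] b]; rewrite /step_mass /= !sign_massE mother_massE /image_law.
rewrite mulrAC mulrC mean_prod mean_prod [RHS]mean_pair; apply: eq_mean => l.
rewrite [RHS]mean_pair; apply: eq_mean => c; rewrite -meanZ; apply: eq_mean => e.
rewrite -!natrM !mulnb; congr (_%:R); congr nat_of_bool.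
rewrite /sample /= !xpair_eqE.
by rewrite [RHS]andbAC andbC.
Qed.

End MotherGroup.

(** * Word length in the wreath product *)

Section Norm.
Variables (R : realType) (B : nat) (m : branching).
Hypothesis mB : forall i, (m i <= B)%N.
Notation letter := (letter B).
Notation lstep := (lstep B).
Notation bits := (seq (bool * bool)).
Local Notation Z := (Algebra.to_multiplicative int).
Local Notation wr := (wreath Z (mother_action m)).
Local Notation site_of w := (ray_site (sval w)).

Definition gen (i : lstep) : wr := step (mother_action m) (zero_ray m) (sample mB i).
Definition walk (s : seq lstep) : wr := (\prod_(i <- s) gen i)%g.
Definition norm (x : wr) : nat := walk_norm (L := Z) (zero_ray m) (sign_mass R) (@mother_mass R m) x.

Lemma cursor_walk s :
  cursor (walk s) = (\prod_(l <- unzip1 s) letter_mother mB l)%g.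
Proof.
elim: s => [|i s IH]; first by rewrite /walk !big_nil.
rewrite /walk !big_cons -[LHS]/(cursor (gen i) * cursor (walk s))%g IH.
by rewrite /= mul1g mulg1.
Qed.

Lemma lamps_walk s (w : finitary_ray m) :
  lamps (walk s) w = lamp m (unzip1 s) (unzip2 s) (site_of w).
Proof.
elim: s w => [|[l [b1 b2]] s IH] w; first by rewrite /walk !big_nil.
rewrite /walk !big_cons -/(walk s).
have cE : cursor (gen (l, (b1, b2))) = letter_mother mB l by rewrite /= mul1g mulg1.
have -> : lamps (gen (l, (b1, b2)) * walk s)%g w =
    (lamps (gen (l, (b1, b2))) w : int) + lamps (walk s) (mother_act w (cursor (gen (l, (b1, b2))))).
  by [].
rewrite cE IH /= ray_act_letter; congr (_ + _).
have delta (b : bool) (v : finitary_ray m) :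
    (if `[< v = zero_ray m >] then sgn b : Z else 1%g) = sgn b *+ (site_of v == zero) :> int.
  case: asboolP => [/zero_rayE->//|vz]; rewrite (_ : (_ == zero) = false) //.
  by apply/negP => /zero_rayE.
rewrite -[LHS]/(((if `[< w = zero_ray m >] then sgn b1 : Z else 1%g) : int) + 0 +
    (if `[< mother_act w (1 * letter_mother mB l)%g = zero_ray m >] then sgn b2 : Z else 1%g)).
by rewrite mul1g !delta /= ray_act_letter addr0.
Qed.

Lemma walk_eq s u : actw m (unzip1 s) = actw m (unzip1 u) ->
  (forall r, lamp m (unzip1 s) (unzip2 s) r = lamp m (unzip1 u) (unzip2 u) r) ->
  walk s = walk u.
Proof.
move=> aE lE; apply: wreath_eqP => [w|]; first by rewrite !lamps_walk lE.
by rewrite !cursor_walk; exact: word_mother_eq.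
Qed.

Let I_gt0 : (0 < #|{: lstep}|)%N.
Proof. by rewrite !card_prod card_bool !muln_gt0 card_rules_gt0. Qed.

Lemma support_step x :
  (Defs.support (step_law (L := Z) (a := mother_action m) (zero_ray m) (sign_mass R) (@mother_mass R m)) x)
  <-> exists i, gen i = x.
Proof.
rewrite /Defs.support /= /step_law.
rewrite (law_image_law (step (mother_action m) (zero_ray m)) (step_massE mB R)).
exact: image_law_neq0.
Qed.

Lemma walk_of_lengthP (x : wr) k :
  walk_of_length (cayley (Defs.support (step_law (L := Z) (a := mother_action m) (zero_ray m)
    (sign_mass R) (@mother_mass R m)))) 1%g x k <->
  exists2 s, size s = k & walk s = x.
Proof.
set e := cayley _.
have eP y z : e y z <-> exists i, z = (y * gen i)%g.
  rewrite /e /cayley; split=> [/set_mem/support_step[i E]|[i ->]].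
    by exists i; rewrite E mulKVg.
  by rewrite mulKg; apply/mem_set/support_step; exists i.
split=> [[p [ep <- <-]]|[s <- <-]].
  elim/last_ind: p ep => [|p z IH]; first by exists [::]; rewrite // /walk big_nil.
  rewrite rcons_path last_rcons size_rcons => /andP[/IH[s sp sE] /eP[i ->]].
  exists (rcons s i); first by rewrite size_rcons sp.
  by rewrite /walk -cats1 big_cat big_seq1 /= -/(walk s) sE.
elim/last_ind: s => [|s i [p [ep pl ps]]]; first by exists [::]; rewrite /walk big_nil.
exists (rcons p (walk (rcons s i))); rewrite rcons_path last_rcons !size_rcons ps ep pl.
split=> //; apply/eP; exists i.
by rewrite /walk -cats1 big_cat big_seq1.
Qed.

Lemma norm_le s : (norm (walk s) <= size s)%N.
Proof.
rewrite /norm /walk_norm /graph_dist; case: pselect => // ex.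
case: ex_minnP => k _; apply; apply/asboolP/walk_of_lengthP.
by exists s.
Qed.

Lemma normP s : exists2 u, size u = norm (walk s) & walk u = walk s.
Proof.
rewrite /norm /walk_norm /graph_dist; case: pselect => [ex|[]]; last first.
  by exists (size s); apply/asboolP/walk_of_lengthP; exists s.
by case: ex_minnP => k /asboolP/walk_of_lengthP[u uk uE] _; exists u.
Qed.

(** ** Lower bound: a step changes the sum of the lamps by at most 2 *)

(** At any time, at most one token is at the origin. *)
Lemma sum_origin_le (V : seq site) (f : site -> site) : uniq V -> injective f ->
  (\sum_(r <- V) (f r == zero) <= 1)%N.
Proof.
move=> uV fI; have [/hasP[p pV /eqP fp]|/hasPn nf] := boolP (has (fun r => f r == zero) V).
  rewrite (bigD1_seq p) //= big1 => [|r /eqP rp]; last first.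
    by case: eqP => // fr; case: rp; apply: fI; rewrite fr fp.
  by rewrite fp eqxx.
by rewrite big_seq big1 // => r /nf /negPf->.
Qed.

Lemma sum_lamp_le t b (V : seq site) : uniq V ->
  (\sum_(r <- V) `|lamp (B := B) m t b r| <= 2 * size t)%N.
Proof.
elim: t b V => [|l t IH] b V uV; first by rewrite big1.
case: b => [|c b]; first by rewrite big1.
have uV' : uniq (map (act m l) V) by rewrite map_inj_uniq //; exact: act_inj.
have one (W : seq site) (f : site -> site) (e : bool) : uniq W -> injective f ->
    (\sum_(r <- W) `|sgn e *+ (f r == zero)| <= 1)%N.
  move=> uW fI; apply: leq_trans (sum_origin_le uW fI).
  by apply: leq_sum => r _; case: (f r == zero); case: e.
have := IH b _ uV'; rewrite big_map => IH'.
have := one V id c.1 uV (fun _ _ => id); have := one V (act m l) c.2 uV (@act_inj _ _ l).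
have : (\sum_(r <- V) `|lamp m (l :: t) (c :: b) r| <=
    \sum_(r <- V) (`|sgn c.1 *+ (r == zero)| + `|sgn c.2 *+ (act m l r == zero)|
      + `|lamp m t b (act m l r)|))%N.
  by apply: leq_sum => r _ /=; lia.
by rewrite !big_split /=; lia.
Qed.

Lemma lamp_mass_norm t b : size b = size t ->
  (lamp_mass (B := B) m t b <= 2 * norm (walk (zip t b)))%N.
Proof.
move=> bt; have [u <- uE] := normP (zip t b).
have lE r : r \in visits m t -> lamp m t b r = lamp m (unzip1 u) (unzip2 u) r.
  rewrite mem_visits => /(vis_ray mB)[w <-].
  by rewrite -!lamps_walk uE lamps_walk unzip1_zip ?bt // unzip2_zip ?bt.
rewrite /lamp_mass big_seq (eq_bigr _ (fun r rt => congr1 absz (lE r rt))) -big_seq.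
by have := sum_lamp_le (unzip1 u) (unzip2 u) (visits_uniq m t); rewrite size_map.
Qed.

(** ** Upper bound: lamps are adjusted while following a covering word *)

Definition idle : letter := (true, rule1 B).

Lemma act_idle r : act m idle r = r.
Proof. exact: act_root1. Qed.

Definition lamp_of (s : seq lstep) := lamp m (unzip1 s) (unzip2 s).

(** An idle step with equal switches, inserted when r0 is at the origin. *)
Lemma insert_idle s r0 e : vis m (unzip1 s) r0 -> exists s',
  [/\ size s' = (size s).+1, actw m (unzip1 s') = actw m (unzip1 s),
      forall r, vis m (unzip1 s') r = vis m (unzip1 s) r &
      forall r, lamp_of s' r = lamp_of s r + 2 * (sgn e *+ (r == r0))].
Proof.
elim: s r0 => [|[l c] s IH] r0 /= vr.
  have r00 : r0 = zero by move: vr; rewrite orbF => /eqP.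
  exists [:: (idle, (e, e))]; split=> //= [|r|r].
  - by apply/funext => r /=; rewrite ?act_idle ?act_root1.
  - by rewrite ?act_idle ?act_root1 !orbF orbb.
  by rewrite /lamp_of /= ?act_idle ?act_root1 r00; ring.
have [r00|r0n] := eqVneq r0 zero.
  exists [:: (idle, (e, e)), (l, c) & s]; split=> //= [|r|r].
  - by apply/funext => r /=; rewrite ?act_idle ?act_root1.
  - by rewrite ?act_idle ?act_root1 orbA orbb.
  by rewrite /lamp_of /= ?act_idle ?act_root1 r00; ring.
have {}vr : vis m (unzip1 s) (act m l r0) by move: vr; rewrite (negPf r0n).
have [s' [ss' as' vs' ls']] := IH _ vr.
exists ((l, c) :: s'); split=> /= [||r|r]; first by rewrite ss'.
- by apply/funext => r; have := congr1 (fun f => f (act m l r)) as'.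
- by rewrite vs'.
rewrite /lamp_of /= -/(lamp_of s' _) ls' -/(lamp_of s _).
by rewrite (inj_eq (@act_inj _ m l)) addrA.
Qed.

Lemma adjust_lamps N s (D : site -> int) (V : seq site) : uniq V ->
  (forall r, D r != 0 -> (r \in V) && vis m (unzip1 s) r) ->
  (\sum_(r <- V) `|D r|)%N = N -> exists s',
  [/\ size s' = (size s + N)%N, actw m (unzip1 s') = actw m (unzip1 s) &
      forall r, lamp_of s' r = lamp_of s r + 2 * D r].
Proof.
move=> uV; elim: N s D => [|N IH] s D DP sumD.
  exists s; split=> [|//|r]; first by rewrite addn0.
  have [->|Dr] := eqVneq (D r) 0; first by rewrite mulr0 addr0.
  have /andP[rV _] := DP r Dr; move: sumD; rewrite (bigD1_seq r) //= => /eqP.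
  by rewrite addn_eq0 absz_eq0 (negPf Dr).
have [r0 [r0V Dr0]] : exists r0, r0 \in V /\ D r0 != 0.
  apply: contrapT => /forallNP nD; move: sumD; rewrite big_seq big1 // => r rV.
  by have [->//|Dr] := eqVneq (D r) 0; case: (nD r).
have /andP[_ v0] := DP r0 Dr0.
pose e := 0 <= D r0.
have [s1 [ss1 as1 vs1 ls1]] := insert_idle e v0.
pose D1 r := D r - sgn e *+ (r == r0).
have D1r0 : (`|D r0| = `|D1 r0| + 1)%N.
  by rewrite /D1 eqxx mulr1n /sgn /e; case: leP; move: Dr0; lia.
have [||s' [ss' as' ls']] := IH s1 D1.
- move=> r; rewrite vs1 /D1; have [->|rn] := eqVneq r r0; first by rewrite r0V v0.
  by rewrite mulr0n subr0; exact: DP.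
- suff : (\sum_(r <- V) `|D r| = \sum_(r <- V) `|D1 r| + 1)%N by lia.
  rewrite !(bigD1_seq r0 r0V) //= D1r0 addnAC; congr (_ + _)%N; congr (_ + _)%N.
  by apply: eq_bigr => r /negPf rn; rewrite /D1 rn mulr0n subr0.
exists s'; split; [by rewrite ss' ss1 addSnnS|by rewrite as' as1|].
by move=> r; rewrite ls' ls1 /D1; ring.
Qed.

(** A token at the origin between two steps is switched by -1 and then by +1. *)
Lemma lamp_alternate u r :
  lamp_of [seq (l, (true, false)) | l <- u] r =
  (r == zero)%:R - (actw m u r == zero)%:R.
Proof.
elim: u r => [|l u IH] r; first by rewrite subrr.
rewrite /lamp_of /= -/(lamp_of _ _) IH /sgn /= mulNrn.
by rewrite addrA subrK.
Qed.

(** Half the difference between the lamps left by t and those left by a word with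
    the same endpoint and alternating switches; each visit strictly between the
    ends involves two switches, hence the difference is even. *)
Fixpoint excess (t : seq letter) (b : bits) (r : site) : int :=
  if (t, b) is (l :: t', c :: b') then
    (if c.1 then 0 else -1) *+ (r == zero) + (if c.2 then 1 else 0) *+ (act m l r == zero)
    + excess t' b' (act m l r)
  else 0.

Lemma lamp_excess t b r : size b = size t ->
  lamp m t b r = (r == zero)%:R - (actw m t r == zero)%:R + 2 * excess t b r.
Proof.
elim: t b r => [|l t IH] [|[c1 c2] b] r //=; first by rewrite subrr mulr0.
move=> [bt]; rewrite IH // /sgn.
by case: c1; case: c2; case: (r == zero); case: (act m l r == zero); rewrite /=; ring.
Qed.

Lemma excess_vis t b r : excess t b r != 0 -> vis m t r.
Proof.
elim: t b r => [|l t IH] [|c b] r //=.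
case: (r == zero) => //=; case E : (act m l r == zero).
  by rewrite (eqP E) vis0.
by rewrite !mulr0n !add0r => /IH.
Qed.

(** Follow u with alternating switches, which cancel except at both ends, and
    correct the lamps by idle steps; all tokens with a wrong lamp are visited. *)
Lemma norm_cover t b (u : seq letter) : size b = size t -> covers m (full m t) u ->
  (2 * norm (walk (zip t b)) <= 2 * size u + lamp_mass m t b + 2)%N.
Proof.
move=> bt [uE uv].
pose s0 : seq lstep := [seq (l, (true, false)) | l <- u].
have s0u : unzip1 s0 = u by rewrite /unzip1 -map_comp map_id_in.
have [|s [ss as_ ls]] := @adjust_lamps _ s0 (excess t b) _ (visits_uniq m t) _ erefl.
  by move=> r /excess_vis tr; rewrite mem_visits tr s0u uv.
have <- : walk s = walk (zip t b).
  apply: walk_eq; rewrite unzip1_zip ?bt //; first by rewrite as_ s0u uE.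
  move=> r; rewrite unzip2_zip ?bt // -/(lamp_of s r) ls lamp_alternate lamp_excess //.
  by rewrite uE.
apply: (@leq_trans (2 * size s)); first by rewrite leq_mul2l norm_le orbT.
rewrite ss size_map mulnDr -addnA leq_add2l /lamp_mass.
have H1 := @sum_origin_le (visits m t) id (visits_uniq m t) (fun _ _ => id).
have H2 := sum_origin_le (visits_uniq m t) (@actw_inj _ m t).
have : (2 * (\sum_(r <- visits m t) `|excess t b r|) <= \sum_(r <- visits m t) `|lamp m t b r|
    + (\sum_(r <- visits m t) (r == zero) + \sum_(r <- visits m t) (actw m t r == zero)))%N.
  rewrite big_distrr -!big_split /=; apply: leq_sum => r _; rewrite lamp_excess //.
  by case: (r == zero); case: (actw m t r == zero) => /=; lia.
by move: H1 H2; lia.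
Qed.

Lemma norm_cover_len t b : size b = size t ->
  (2 * norm (walk (zip t b)) <= 2 * cover_len B m (full m t) + lamp_mass m t b + 2)%N.
Proof.
move=> bt; have [u <- uP] := cover_lenP (covers_full m t).
exact: norm_cover.
Qed.

Lemma mother_expected_normE n : mother_expected_norm R m n =
  avg n (fun t => avg n (fun b => (norm (walk (zip t b)))%:R)).
Proof.
rewrite /mother_expected_norm /expected_norm.
rewrite (expectation_iid n (fun s => (walk_norm (L := Z) (zero_ray m) (sign_mass R)
  (@mother_mass R m) (\prod_(x <- s) step (mother_action m) (zero_ray m) x)%g)%:R)
  (step_massE mB R)).
rewrite avg_zip; apply: eq_avg => t _; apply: eq_avg => b _.
by rewrite big_map.
Qed.

End Norm.

(** * The expected distance and the choice of the degrees *)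

Section ExpectedNorm.
Variables (R : realType) (B : nat) (m : branching).
Hypothesis mB : forall i, (m i <= B)%N.

Let mb : bounded B m.
Proof. by move=> i; rewrite degree_ge2 mB. Qed.

Lemma entropy_cst_ge1 : 1 <= entropy_cst R B.
Proof.
rewrite /entropy_cst lerDl mulr_ge0 ?ln_ge0 // ler1n muln_gt0 /=.
by apply/card_gt0P; exists (inr (inl (rule1 B))).
Qed.

(** The lower bound only uses the lamps. In the upper one, g is also the constant
    that balances the entropy bound, since the mean range is at most 4 n / g^2. *)
Lemma expected_norm_bounds n (g : R) : (0 < n)%N -> 0 < g ->
  g ^+ 2 = green B m R n.+1 ->
  n%:R / (10 * g) <= mother_expected_norm R m n <=
    (6 * entropy_cst R B + 11) * (n%:R / g).
Proof.
move=> n0 g0 gE; rewrite (mother_expected_normE R mB).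
have n1 : 1 <= n%:R :> R by rewrite ler1n.
apply/andP; split.
  have := @lamp_mass_ge R B m n g n0 g0; rewrite gE lexx => /(_ isT) low.
  have -> : n%:R / (10 * g) = 2^-1 * (n%:R / (5 * g)) by field; rewrite gt_eqF.
  have half : 2^-1 * avg n (fun t => avg n (fun b => (lamp_mass (B := B) m t b)%:R : R)) <=
      avg n (fun t => avg n (fun b => (norm R (walk mB (zip t b)))%:R : R)).
    rewrite -avgZ; apply: le_avg => t tn; rewrite -avgZ; apply: le_avg => b bn.
    have := lamp_mass_norm R mB (etrans bn (esym tn)).
    by rewrite -(ler_nat R) natrM; lra.
  by apply: le_trans half; rewrite ler_pM2l.
set r := mean_range B m R n.
have rg : r * g ^+ 2 <= 4 * n%:R.
  rewrite gE; apply: (le_trans (@mean_range_green B m R n)).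
  by rewrite -natr1; lra.
have gr : g * r <= 4 * (n%:R / g).
  by rewrite mulrA ler_pdivlMr // mulrAC mulrC -expr2.
have r1 : 1 <= r by exact: mean_range_ge1.
have gn : g <= 2 * n%:R.
  have : g ^+ 2 <= 4 * n%:R.
    by apply: le_trans rg; rewrite ler_peMl // exprn_ge0 // ltW.
  move=> g2; rewrite -(@ler_pXn2r _ 2) ?nnegrE ?mulr_ge0 ?(ltW g0) //.
  by apply: (le_trans g2); rewrite exprMn; nra.
have ng : 1 <= 2 * (n%:R / g) by rewrite mulrA ler_pdivlMr // mul1r.
have C1 := entropy_cst_ge1; set C := entropy_cst R B in C1 *.
have up : avg n (fun t => avg n (fun b => (norm R (walk mB (zip t b)))%:R : R)) <=
    avg n (fun t : seq (letter B) => (cover_len B m (full m t))%:R : R) +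
    2^-1 * avg n (fun t => avg n (fun b => (lamp_mass (B := B) m t b)%:R : R)) + 1.
  have L0 := card_letter_gt0 B.
  have b0 : (0 < #|{: bool * bool}|)%N by rewrite card_prod card_bool.
  apply: (@le_trans _ _ (avg n (fun t : seq (letter B) => (cover_len B m (full m t))%:R +
      2^-1 * avg n (fun b => (lamp_mass (B := B) m t b)%:R : R) + 1))); last first.
    by rewrite !avgD avgZ (avg_cst L0).
  apply: le_avg => t tn.
  apply: (@le_trans _ _ (avg n (fun b => (cover_len B m (full m t))%:R +
      2^-1 * (lamp_mass (B := B) m t b)%:R + 1 : R))); last first.
    by rewrite !avgD avgZ !(avg_cst b0).
  apply: le_avg => b bn; have := norm_cover_len R mB (etrans bn (esym tn)).
  by rewrite -(ler_nat R) (natrD _ (_ + _)%N) (natrD _ (2 * _)%N) !natrM; lra.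
apply: (le_trans up).
have cov := avg_cover_le mb n0 g0; rewrite -/r -/C in cov.
have mass := @lamp_mass_le R B m n g g0; rewrite -/r in mass.
have Cgr : g * C * r <= C * (4 * (n%:R / g)).
  by rewrite mulrAC mulrC ler_pM2l //; lra.
set a := avg n _ in cov *; set b := avg n _ in mass *.
by move: cov mass Cgr gr ng; set x := n%:R / g; lra.
Qed.

End ExpectedNorm.

(** ** The choice of the degrees *)

Section Choice.
Variables (R : realType) (gamma : R) (f : R -> R) (M : nat).
Hypothesis gamma_lt : gamma < 1.
Hypothesis (M_large : 2 <= M%:R `^ (2 - 2 * gamma)) (M_ge2 : (2 <= M)%N).
Hypotheses (f_ge0 : forall x, 0 <= x -> 0 <= f x) (f1 : f 1 = 1).
Hypothesis f_growth : forall a n : R, 1 <= a -> 1 <= n ->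
  a `^ (3 / 4) * f n <= f (a * n) <= a `^ gamma * f n.

(** The pair p is (N, S), where S is the resistance at depth k and N is S times
    the volume. A degree 2 does not lower S f(N)^2 / N^2, and a degree M does not
    raise it. *)
Definition next_degree (p : R * R) : nat :=
  if p.2 * f p.1 ^+ 2 <= p.1 ^+ 2 then 2 else M.

Definition next_scale (p : R * R) : R * R :=
  let x := (next_degree p)%:R in (p.1 * (x * (x / (x - 1))), p.2 * (x / (x - 1))).

Definition scale k : R * R := iter k next_scale (1, 1).
Definition chosen k : nat := next_degree (scale k).

Lemma chosen_ge2 k : (2 <= chosen k)%N.
Proof. by rewrite /chosen /next_degree; case: ifP. Qed.

Lemma chosen_le k : (chosen k <= M)%N.
Proof. by rewrite /chosen /next_degree; case: ifP. Qed.

Definition chosen_branching : branching :=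
  @Branching chosen chosen_ge2 (ex_intro _ M chosen_le).

Lemma scaleE k : scale k = (vol R chosen k * res R chosen k, res R chosen k).
Proof.
elim: k => [|k IH]; first by rewrite /vol /res !big_ord0 mulr1.
rewrite [LHS]/(next_scale (scale k)) /next_scale -/(chosen k) IH /=.
by rewrite /vol /res !big_ord_recr /=; congr pair; ring.
Qed.

Lemma sqr_powR34 (a : R) : 1 <= a -> a <= (a `^ (3 / 4)) ^+ 2.
Proof.
move=> a1; have a0 : 0 <= a by lra.
rewrite -powR_mulrn ?powR_ge0 // -powRrM -{1}(powRr1 a0).
by apply: ler_powR => //; lra.
Qed.

Lemma powR_gamma_le (a : R) : 1 <= a -> a `^ gamma <= a.
Proof.
move=> a1; have a0 : 0 <= a by lra.
by rewrite -[leRHS](powRr1 a0); apply: ler_powR => //; exact: ltW.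
Qed.

(** The exponent 3/4 enters here: 8 = 4^2 / 2 is the growth of f(N)^2 which keeps
    S f(N)^2 / N^2 from decreasing when N is multiplied by 4 and S by 2. *)
Lemma four_powR34 : (4 `^ (3 / 4)) ^+ 2 = 8 :> R.
Proof.
have x0 : 0 <= (4 `^ (3 / 4)) ^+ 2 :> R by rewrite exprn_ge0 ?powR_ge0.
apply/eqP; rewrite -(@eqrXn2 _ 2) //; apply/eqP.
rewrite -exprM -powR_mulrn ?powR_ge0 // -powRrM.
have -> : 3 / 4 * (2 * 2)%N%:R = 3%:R :> R by rewrite natrM; field.
by rewrite powR_mulrn //; ring.
Qed.

Lemma f_ge1 x : 1 <= x -> 1 <= f x.
Proof.
move=> x1; have /andP[+ _] := f_growth x1 (lexx 1); rewrite f1 !mulr1.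
by apply: le_trans; rewrite -[leLHS](powRr0 x); apply: ler_powR => //; lra.
Qed.

(** The ratio S f(N)^2 / N^2 cannot decrease in a step which starts below 1, nor
    increase in a step which starts above 1; and the first kind of step multiplies
    it by at most 2, the second one divides it by at most 2 M. *)
Lemma scale_inv k (N := (scale k).1) (S := (scale k).2) :
  [/\ 1 <= N, 1 <= S, S * f N ^+ 2 <= 2 * N ^+ 2 & N ^+ 2 <= 2 * M%:R * (S * f N ^+ 2)].
Proof.
have M2 : 2 <= M%:R :> R by rewrite ler_nat.
rewrite /N /S {N S}; elim: k => [|k]; first by rewrite /= f1; split; lra.
rewrite [scale k.+1]/(next_scale (scale k)); case: (scale k) => N S /= [N1 S1 up low].
have fN := f_ge1 N1; have fN2 : 0 < f N ^+ 2 by rewrite exprn_gt0 //; lra.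
rewrite /next_degree /=; case: (leP (S * f N ^+ 2) (N ^+ 2)) => cmp.
  have -> : (2 : R) / (2 - 1) = 2 by rewrite (_ : 2 - 1 = 1) ?divr1 //; ring.
  have /andP[g1 g2] : 4 `^ (3 / 4) * f N <= f (4 * N) <= 4 `^ gamma * f N.
    by apply: f_growth => //; lra.
  have {}g2 : f (4 * N) <= 4 * f N.
    by apply: (le_trans g2); rewrite ler_wpM2r ?powR_gamma_le //; lra.
  have f4 : 0 <= f (4 * N) by apply: f_ge0; lra.
  have h1 : 8 * f N ^+ 2 <= f (4 * N) ^+ 2.
    rewrite -four_powR34 -exprMn ler_pXn2r ?nnegrE //.
    by rewrite mulr_ge0 ?powR_ge0 //; lra.
  have h2 : f (4 * N) ^+ 2 <= 16 * f N ^+ 2.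
    have -> : 16 * f N ^+ 2 = (4 * f N) ^+ 2 by ring.
    by rewrite ler_pXn2r ?nnegrE // mulr_ge0 //; lra.
  have -> : N * (2 * 2) = 4 * N by ring.
  have S8 : S * (8 * f N ^+ 2) <= S * f (4 * N) ^+ 2 by rewrite ler_pM2l //; lra.
  have S16 : S * f (4 * N) ^+ 2 <= S * (16 * f N ^+ 2) by rewrite ler_pM2l //; lra.
  split; [lra|lra| |].
    by rewrite exprMn; lra.
  have : M%:R * (S * (8 * f N ^+ 2)) <= M%:R * (S * f (4 * N) ^+ 2).
    by rewrite ler_pM2l //; lra.
  by rewrite exprMn; lra.
set x := M%:R in M2 low *; pose q := x / (x - 1); pose kappa := x * q.
have q1 : 1 <= q by rewrite /q ler_pdivlMr; lra.
have q2 : q <= 2 by rewrite /q ler_pdivrMr; lra.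
have kx : x <= kappa by rewrite /kappa ler_peMr //; lra.
have k2x : kappa <= 2 * x by rewrite /kappa mulrC ler_wpM2r //; lra.
have k1 : 1 <= kappa by lra.
rewrite -/q -/kappa.
have -> : N * kappa = kappa * N by rewrite mulrC.
have /andP[g1 g2] := f_growth k1 N1.
have fk : 0 <= f (kappa * N) by apply: f_ge0; rewrite mulr_ge0; lra.
have h1 : kappa * f N ^+ 2 <= f (kappa * N) ^+ 2.
  apply: (@le_trans _ _ ((kappa `^ (3 / 4) * f N) ^+ 2)).
    by rewrite exprMn ler_wpM2r ?sqr_powR34 // ltW.
  by rewrite ler_pXn2r ?nnegrE // mulr_ge0 ?powR_ge0 //; lra.
have h2 : q * f (kappa * N) ^+ 2 <= kappa ^+ 2 * f N ^+ 2.
  apply: (@le_trans _ _ (q * (kappa `^ gamma * f N) ^+ 2)).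
    rewrite ler_wpM2l ?ler_pXn2r ?nnegrE //; first lra.
    by rewrite mulr_ge0 ?powR_ge0 //; lra.
  rewrite exprMn mulrA ler_wpM2r ?(ltW fN2) //.
  have -> : kappa ^+ 2 = kappa `^ (2 - 2 * gamma) * (kappa `^ gamma) ^+ 2.
    rewrite -(powR_mulrn 2 (powR_ge0 kappa gamma)) -powRrM -powRD; last first.
      by apply/implyP => _; rewrite gt_eqF //; lra.
    by rewrite -[LHS](powR_mulrn 2) ?(le_trans ler01) //; congr powR; ring.
  rewrite ler_wpM2r ?exprn_ge0 ?powR_ge0 //.
  apply: (le_trans q2); apply: (le_trans M_large).
  apply: ge0_ler_powR => //; rewrite ?nnegrE; [|lra|lra].
  by rewrite subr_ge0 -[leRHS]mulr1 ler_pM2l // ltW.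
have NN : 0 < N ^+ 2 by rewrite exprn_gt0 //; lra.
split; [nra|nra| |].
  apply: (@le_trans _ _ (kappa ^+ 2 * (S * f N ^+ 2))).
    have -> : S * q * f (kappa * N) ^+ 2 = S * (q * f (kappa * N) ^+ 2).
      by rewrite mulrA.
    have -> : kappa ^+ 2 * (S * f N ^+ 2) = S * (kappa ^+ 2 * f N ^+ 2) by ring.
    by rewrite ler_pM2l //; lra.
  have -> : 2 * (kappa * N) ^+ 2 = kappa ^+ 2 * (2 * N ^+ 2) by ring.
  by rewrite ler_wpM2l // exprn_ge0 //; lra.
have A : S * (kappa * f N ^+ 2) <= S * q * f (kappa * N) ^+ 2.
  apply: (@le_trans _ _ (S * f (kappa * N) ^+ 2)); first by rewrite ler_pM2l //; lra.
  by rewrite ler_wpM2r ?exprn_ge0 // ler_peMr //; lra.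
rewrite exprMn; apply: (@le_trans _ _ (kappa ^+ 2 * (S * f N ^+ 2))).
  by rewrite ler_wpM2l ?exprn_ge0 ?(ltW cmp) //; lra.
have -> : kappa ^+ 2 * (S * f N ^+ 2) = kappa * (S * (kappa * f N ^+ 2)) by ring.
have k0 := le_trans ler01 k1; have S0 := le_trans ler01 S1.
by apply: ler_pM => //; exact: mulr_ge0 S0 (mulr_ge0 k0 (ltW fN2)).
Qed.

Lemma scale_step k :
  2 * (scale k).1 <= (scale k.+1).1 <= 2 * M%:R * (scale k).1.
Proof.
have M2 : 2 <= M%:R :> R by rewrite ler_nat.
have [N1 _ _ _] := scale_inv k.
rewrite [scale k.+1]/(next_scale (scale k)) /next_scale -/(chosen k) /=.
have x2 : 2 <= (chosen k)%:R :> R by rewrite ler_nat chosen_ge2.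
have xM : (chosen k)%:R <= M%:R :> R by rewrite ler_nat chosen_le.
set x := (chosen k)%:R in x2 xM *; pose q := x / (x - 1); rewrite -/q.
have q1 : 1 <= q by rewrite /q ler_pdivlMr; lra.
have q2 : q <= 2 by rewrite /q ler_pdivrMr; lra.
rewrite [X in _ <= X <= _]mulrC !ler_pM2r; try lra.
by apply/andP; split; nra.
Qed.

Lemma scale_between n : (0 < n)%N -> exists k, (scale k).1 <= n%:R < (scale k.+1).1.
Proof.
move=> n0; have big k : k%:R < (scale k).1.
  elim: k => [|k IH]; first by rewrite ltr01.
  have /andP[+ _] := scale_step k; apply: lt_le_trans.
  by have [N1 _ _ _] := scale_inv k; rewrite -natr1; lra.
have : exists k, n%:R < (scale k).1 by exists n.
case/ex_minnP => -[|k]; first by rewrite /scale /= ltNge ler1n n0.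
move=> nk kmin; exists k; rewrite nk andbT leNgt; apply/negP => /kmin.
by rewrite ltnn.
Qed.

Lemma chosen_bounds n : (0 < n)%N ->
  exists2 g, 0 < g & [/\ g ^+ 2 = green M chosen R n.+1,
    n%:R / g <= 24 * M%:R ^+ 3 * f n%:R &
    f n%:R <= 8 * M%:R ^+ 2 * (8 * M%:R + 64) * (n%:R / g)].
Proof.
move=> n0; have n1 : 1 <= n%:R :> R by rewrite ler1n.
have M2 : 2 <= M%:R :> R by rewrite ler_nat.
have mb : bounded M chosen by move=> i; rewrite chosen_ge2 chosen_le.
have G1_ge1 : 1 <= green M chosen R n.+1 by exact: green_ge1.
pose g := Num.sqrt (green M chosen R n.+1).
have g0 : 0 < g by rewrite sqrtr_gt0; lra.
have gE : g ^+ 2 = green M chosen R n.+1 by rewrite sqr_sqrtr //; lra.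
have [k /andP[Nn nN]] := scale_between n0.
have := scale_step k; have := scale_inv k; have := scaleE k.
have := @green_ge R M chosen n k mb n0; have := @green_le R M chosen n k mb n0.
have G1_le := @greenS_le R M chosen n mb n0.
have G1_ge := @green_homo M chosen R n n.+1 (leqnSn n).
set V := vol R chosen k; set S := res R chosen k.
set G := green M chosen R n in G1_le G1_ge *.
rewrite -gE in G1_le G1_ge.
move: Nn nN; case: (scale k) => N S' /= Nn nN Gle Gge [NE ->] {S'}.
move=> [N1 S1 up low] /andP[_ NM].
have F1 := f_ge1 N1; set F := f N in up low F1 *.
have n_pos : 0 < n%:R :> R by lra.
have S0 : 0 < S by lra.
have V0 : 0 < V by rewrite -(pmulr_lgt0 _ S0) -NE; lra.
have n2M : n%:R <= 2 * M%:R * N by lra.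
have S_le : S <= 3 * g ^+ 2.
  apply: (@le_trans _ _ (3 * G)); last by rewrite ler_pM2l.
  have G0 : 0 <= G by rewrite (le_trans ler01) ?green_ge1.
  have Vn : 2 * V / n%:R <= 2 / S by rewrite ler_pdivrMr // mulrAC ler_pdivlMr //; lra.
  have : G * (S^-1 + 2 * V / n%:R) <= G * (3 / S) by rewrite ler_wpM2l //; lra.
  by move/(le_trans Gge); rewrite mulrA ler_pdivlMr //; lra.
have S_ge : g ^+ 2 <= (8 * M%:R + 64) * S.
  have : 2 * n%:R / V <= 4 * M%:R * S by rewrite ler_pdivrMr //; rewrite NE in n2M; lra.
  by lra.
pose a := n%:R / N.
have N0 : 0 < N by lra.
have a1 : 1 <= a by rewrite ler_pdivlMr //; lra.
have aM : a <= 2 * M%:R by rewrite ler_pdivrMr.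
have /andP[fn_ge fn_le] := f_growth a1 N1; rewrite divfK ?gt_eqF // -/F in fn_ge fn_le.
set fn := f n%:R in fn_ge fn_le *.
have F_le : F <= fn.
  apply: le_trans fn_ge; rewrite ler_peMl //; first lra.
  by rewrite -[leLHS](powRr0 a); apply: ler_powR => //; lra.
have F_ge : fn <= 2 * M%:R * F.
  apply: (le_trans fn_le); rewrite ler_wpM2r //; first lra.
  by apply: le_trans aM; exact: powR_gamma_le.
have M0 : 0 <= M%:R :> R by [].
have fn0 : 0 <= fn by lra.
exists g => //; split=> //.
  rewrite ler_pdivrMr // -(@ler_pXn2r _ 2) ?nnegrE ?mulr_ge0 ?exprn_ge0 ?(ltW g0) //.
  have h1 : n%:R ^+ 2 <= (2 * M%:R * N) ^+ 2.
    by rewrite ler_pXn2r ?nnegrE //; lra.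
  have h2 : (2 * M%:R * N) ^+ 2 <= 4 * M%:R ^+ 2 * (2 * M%:R * (S * F ^+ 2)).
    have -> : (2 * M%:R * N) ^+ 2 = 4 * M%:R ^+ 2 * N ^+ 2 by ring.
    by rewrite ler_wpM2l // mulr_ge0 ?exprn_ge0.
  have h3 : S * F ^+ 2 <= 3 * g ^+ 2 * fn ^+ 2.
    have F0 : 0 <= F by lra.
    by apply: ler_pM S_le _; rewrite ?(ltW S0) ?exprn_ge0 ?ler_pXn2r.
  have h4 : 4 * M%:R ^+ 2 * (2 * M%:R * (S * F ^+ 2)) <= 24 * M%:R ^+ 3 * (g ^+ 2 * fn ^+ 2).
    have -> : 4 * M%:R ^+ 2 * (2 * M%:R * (S * F ^+ 2)) = 8 * M%:R ^+ 3 * (S * F ^+ 2) by ring.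
    have -> : 24 * M%:R ^+ 3 * (g ^+ 2 * fn ^+ 2) =
      8 * M%:R ^+ 3 * (3 * g ^+ 2 * fn ^+ 2) by ring.
    by rewrite ler_wpM2l // mulr_ge0 ?exprn_ge0.
  apply: (le_trans h1); apply: (le_trans h2); apply: (le_trans h4).
  have -> : (24 * M%:R ^+ 3 * fn * g) ^+ 2 =
    (24 * M%:R ^+ 3) ^+ 2 * (g ^+ 2 * fn ^+ 2) by ring.
  rewrite ler_wpM2r ?mulr_ge0 ?exprn_ge0 ?(ltW g0) // ler_eXnr //.
  have : 1 <= M%:R ^+ 3 :> R by rewrite exprn_ege1 //; lra.
  by lra.
set K := 8 * _ * _.
have K1 : 1 <= K.
  have : 1 <= M%:R ^+ 2 :> R by rewrite exprn_ege1 //; lra.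
  by rewrite /K; set y := M%:R ^+ 2 => y1; nra.
have K0 := le_trans ler01 K1.
rewrite mulrA ler_pdivlMr // -(@ler_pXn2r _ 2) ?nnegrE ?mulr_ge0 ?(ltW g0) //.
apply: (@le_trans _ _ ((2 * M%:R * F) ^+ 2 * ((8 * M%:R + 64) * S))).
  rewrite exprMn; apply: ler_pM; rewrite ?exprn_ge0 ?(ltW g0) //.
  by rewrite ler_pXn2r ?nnegrE ?mulr_ge0 //; lra.
have -> : (2 * M%:R * F) ^+ 2 * ((8 * M%:R + 64) * S) =
  4 * M%:R ^+ 2 * (8 * M%:R + 64) * (S * F ^+ 2) by ring.
apply: (@le_trans _ _ (K * n%:R ^+ 2)); last first.
  by rewrite exprMn ler_wpM2r ?exprn_ge0 // ler_eXnr.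
have -> : K * n%:R ^+ 2 = 4 * M%:R ^+ 2 * (8 * M%:R + 64) * (2 * n%:R ^+ 2).
  by rewrite /K; ring.
have c0 : 0 <= 4 * M%:R ^+ 2 * (8 * M%:R + 64) :> R.
  by apply: mulr_ge0; [rewrite mulr_ge0 ?exprn_ge0|lra].
apply: (ler_wpM2l c0); apply: (le_trans up).
by rewrite ler_pM2l // ler_pXn2r ?nnegrE // ltW.
Qed.

End Choice.

(** M = 2^(1 / (2 - 2 gamma)), rounded up. *)
Lemma exists_large (R : realType) (gamma : R) : gamma < 1 ->
  exists M : nat, (2 <= M)%N /\ 2 <= (M%:R : R) `^ (2 - 2 * gamma).
Proof.
move=> g1; have e0 : 0 < 2 - 2 * gamma by lra.
pose y : R := 2 `^ (2 - 2 * gamma)^-1.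
have y0 : 0 <= y := powR_ge0 _ _.
exists (Num.bound y).+2; split=> //.
have yM : y <= (Num.bound y).+2%:R.
  by apply: ltW; apply: lt_le_trans (archi_boundP y0) _; rewrite ler_nat -addn2 leq_addr.
apply: (@le_trans _ _ (y `^ (2 - 2 * gamma))).
  by rewrite -powRrM mulVf ?gt_eqF // powRr1.
by apply: ge0_ler_powR; rewrite ?nnegrE // ltW.
Qed.

Theorem theorem1 (R : realType) (gamma : R) (hgamma : 3 / 4 <= gamma < 1) :
  exists c C : R, [/\ 0 < c, c <= C &
    forall f : R -> R,
      (forall x, 0 <= x -> 0 <= f x) ->
      f 1 = 1 ->
      (forall a n : R, 1 <= a -> 1 <= n ->
         a `^ (3 / 4) * f n <= f (a * n) <= a `^ gamma * f n) ->
      exists m : branching, forall n : nat, (1 <= n)%N ->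
        c * f n%:R <= mother_expected_norm R m n <= C * f n%:R].
Proof.
have /andP[_ gamma_lt] := hgamma.
have [M [M2 M_large]] := exists_large gamma_lt.
have MR2 : 2 <= M%:R :> R by rewrite ler_nat.
pose K : R := 8 * M%:R ^+ 2 * (8 * M%:R + 64).
pose E : R := 6 * entropy_cst R M + 11.
have Mk k : 1 <= M%:R ^+ k :> R by rewrite exprn_ege1 //; lra.
have K1 : 1 <= K.
  by have := Mk 2; rewrite /K; set y := M%:R ^+ 2 => y1; nra.
have E1 : 1 <= E by have := entropy_cst_ge1 R M; rewrite /E; lra.
exists (10 * K)^-1, (E * (24 * M%:R ^+ 3)); split.
- by rewrite invr_gt0; lra.
- apply: (@le_trans _ _ 1); first by rewrite invf_le1; lra.
  by apply: mulr_ege1 => //; have := Mk 3; lra.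
move=> f f_ge0 f1 f_growth; exists (chosen_branching f M2) => n n0.
have [g g0 [gE up low]] := chosen_bounds gamma_lt M_large M2 f_ge0 f1 f_growth n0.
have := @expected_norm_bounds R M (chosen_branching f M2) (chosen_le f M2) n g n0 g0 gE.
move=> /andP[lo hi]; apply/andP; split.
  apply: le_trans lo; rewrite -/K in low.
  rewrite mulrC ler_pdivrMr; last lra.
  have -> : n%:R / (10 * g) * (10 * K) = K * (n%:R / g) by field; rewrite gt_eqF.
  by [].
by apply: (le_trans hi); rewrite -/E -mulrA ler_pM2l //; lra.
Qed.
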